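(* For any $\lambda>0$ and $0<\theta\le\pi/4$, the family $\{t^{-1}\mathcal Y_t\}_{t\ge0}$ satisfies the large-deviation principle with speed $t$ and rate function $$I_{\lambda,\theta}(x)=\inf\{\beta\,\mathcal I_{\lambda,\theta}(1/\beta,x/\beta):\beta>0\},$$ and $I_{\lambda,\theta}=\sqrt{\lambda}\,I_{1,\theta}$.
   Context: Let $\lambda>0$, $0<\theta\le\pi/4$. $\mathcal P_\lambda$ is a homogeneous Poisson point process of intensity $\lambda$ on $\mathbb R^2$ under its Palm distribution (a point added at the origin $o$). Polar coordinates $(r_v,\varphi_v)$, $\varphi_v\in[-\pi,\pi)$, angle from $e_1=(1,0)$; $\mathcal C_\theta=\{v:r_v>0,|\varphi_v|\le\theta\}$, $\mathcal C_\theta(v)=v+\mathcal C_\theta$. Navigation: $V_0=o$, $V_{i+1}=\arg\min\{|v-V_i|:v\in\mathcal P_\lambda\cap\mathcal C_\theta(V_i)\}$; $U_i=V_i-V_{i-1}$. The piecewise-linear path $\bigcup_{k\ge0}[V_k,V_{k+1}]$ is the graph $\{(t,\mathcal Y_t):t\ge0\}$; $\mathcal Y_t$ is the vertical displacement at horizontal position $t$. $\mathcal I_{\lambda,\theta}(u)=\sup\{\langle\gamma,u\rangle-J_{\lambda,\theta}(\gamma):\gamma\in\mathbb R^2\}$ with $J_{\lambda,\theta}(\gamma)=\log\big(\lambda\int_0^\infty re^{-\lambda\theta r^2}\int_{-\theta}^{\theta}\exp(\gamma_1r\cos\varphi+\gamma_2r\sin\varphi)\,d\varphi\,dr\big)$,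 which is the Legendre transform of the log-moment generating function of $U_1$. LDP with speed $t$: for closed $F$, $\limsup t^{-1}\log\mathbb P(t^{-1}\mathcal Y_t\in F)\le-\inf_F I$; for open $G$, $\liminf t^{-1}\log\mathbb P(t^{-1}\mathcal Y_t\in G)\ge-\inf_G I$. *)

(* Defs.v *)
From HB Require Import structures.
From mathcomp Require Import all_boot all_order all_algebra.
From mathcomp Require Import finmap.
From mathcomp Require Import all_classical all_reals all_analysis.
Set Implicit Arguments. Unset Strict Implicit. Unset Printing Implicit Defensive.
Import Order.TTheory GRing.Theory Num.Theory.
Import numFieldNormedType.Exports.
Local Open Scope classical_set_scope.
Local Open Scope ring_scope.

Section Defs.
Variable R : realType.

Definition origin : R * R := (0, 0).

(* Euclidean distance (NB: the library norm on R*R is the max-norm). *)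
Definition edist (p q : R * R) : R :=
  Num.sqrt ((q.1 - p.1) ^+ 2 + (q.2 - p.2) ^+ 2).

(* q lies in the cone C_theta(p) = p + C_theta, where
   C_theta = {v : r_v > 0, |phi_v| <= theta}.  For theta <= pi/4 < pi/2 this
   forces the first coordinate of v to be > 0, where the polar angle is
   phi_v = atan (v_2 / v_1). *)
Definition in_cone (theta : R) (p q : R * R) : Prop :=
  0 < q.1 - p.1 /\ `| atan ((q.2 - p.2) / (q.1 - p.1)) | <= theta.

(* Nearest point of the configuration X in the cone C_theta(v)
   (ties, which have probability 0, are broken lexicographically;
   if the cone contains no point the walk stays at v). *)
Definition nearest_in_cone (theta : R) (X : set (R * R)) (v w : R * R) : Prop :=
  X w /\ in_cone theta v w /\
  forall u, X u -> in_cone theta v u -> edist v w <= edist v u.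

Definition nav_next (theta : R) (X : set (R * R)) (v : R * R) : R * R :=
  xget v [set w | nearest_in_cone theta X v w /\
                  forall u, nearest_in_cone theta X v u ->
                    w.1 < u.1 \/ (w.1 = u.1 /\ w.2 <= u.2)].

Fixpoint nav (theta : R) (X : set (R * R)) (n : nat) : R * R :=
  match n with
  | 0 => origin
  | k.+1 => nav_next theta X (nav theta X k)
  end.

(* Y_t : the piecewise-linear path U_k [V_k, V_{k+1}] is the graph
   {(t, Y_t)}; Y_t is the second coordinate of its point with first
   coordinate t (0 if there is none). *)
Definition Ypath (theta : R) (X : set (R * R)) (t : R) : R :=
  xget 0 [set y | exists k : nat, exists s : R, 0 <= s <= 1 /\
     t = (nav theta X k).1 + s * ((nav theta X k.+1).1 - (nav theta X k).1) /\
     y = (nav theta X k).2 + s * ((nav theta X k.+1).2 - (nav theta X k).2)].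

Definition poissonp (mu : R) (k : nat) : R := expR (- mu) * mu ^+ k / k`!%:R.

Definition bounded2 (B : set (R * R)) : Prop :=
  exists M : R, forall p, B p -> `|p.1| <= M /\ `|p.2| <= M.

Definition leb2 : set (R * R) -> \bar R :=
  ((@lebesgue_measure R) \x (@lebesgue_measure R))%E.

Definition npoints (X : set (R * R)) (B : set (R * R)) : nat :=
  #|` fset_set (X `&` B)|.

Definition is_PPP (d : measure_display) (Omega : measurableType d)
  (P : probability Omega R) (lambda : R) (X : Omega -> set (R * R)) : Prop :=
  (forall w B, bounded2 B -> finite_set (X w `&` B)) /\
  forall (n : nat) (B : 'I_n -> set (R * R)) (k : 'I_n -> nat),
    (forall i, measurable (B i) /\ bounded2 (B i)) ->
    (forall i j, i != j -> B i `&` B j = set0) ->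
    measurable [set w | forall i, npoints (X w) (B i) = k i] /\
    P [set w | forall i, npoints (X w) (B i) = k i] =
      (\prod_(i < n) poissonp (lambda * fine (leb2 (B i))) (k i))%:E.

Definition palm (Omega : Type) (X : Omega -> set (R * R)) : Omega -> set (R * R) :=
  fun w => X w `|` [set origin].

Definition LDP (d : measure_display) (Omega : measurableType d)
  (P : probability Omega R) (Z : R -> Omega -> R) (I : R -> \bar R) : Prop :=
  (forall F : set R, closed F ->
     (limf_esup (fun t : R => (t^-1)%:E * lne (P [set w | F (Z t w)]))%E
        (pinfty_nbhs R)
      <= - ereal_inf (I @` F))%E) /\
  (forall G : set R, open G ->
     (- ereal_inf (I @` G) <=
      limf_einf (fun t : R => (t^-1)%:E * lne (P [set w | G (Z t w)]))%E
        (pinfty_nbhs R))%E).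

Definition Jfun (lambda theta : R) (g : R * R) : R :=
  ln (lambda * Rintegral (@lebesgue_measure R) `[0, +oo[%classic
        (fun r => r * expR (- lambda * theta * r ^+ 2) *
           Rintegral (@lebesgue_measure R) `[- theta, theta]%classic
             (fun phi => expR (g.1 * r * cos phi + g.2 * r * sin phi)))).

Definition Legendre (lambda theta : R) (u : R * R) : \bar R :=
  ereal_sup [set (g.1 * u.1 + g.2 * u.2 - Jfun lambda theta g)%:E | g in [set: R * R]].

Definition rate (lambda theta : R) (x : R) : \bar R :=
  ereal_inf [set ((beta%:E) * Legendre lambda theta (beta^-1, x / beta)%R)%E
            | beta in [set b : R | 0 < b]].

End Defs.

(* Main.v *)
(* Discretize the plane into cells of small size [d].  Two vectors of a cone of
   half-angle at most pi/4 make an acute angle, so every later vertex of a path is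
   farther from V_i than V_{i+1} is; the walk therefore follows a prescribed sequence
   of cells as soon as each of them contains exactly one point and slightly enlarged
   sectors are otherwise empty.  By independence of the counts the probability of a cell path is at least a product of one-step weights.
   As [d] tends to 0 the one-step weights recover the law of U_1; in particular
   their total mass tends to 1, so that the disjoint cell paths exhaust the
   probability space and these lower bounds also yield Chernoff's upper bound
   P (g . V_n >= c) <= e^{-c} E[e^{g . U_1}]^n.

   Upper bound: if V_k.1 <= t <= V_{k+1}.1 then (t, Y_t) lies on the segment
   [V_k, V_{k+1}], so a half-plane containing it contains V_k or V_{k+1}; a compact
   set of pairs (k/t, Y_t/t) is covered by finitely many half-planes.
   Lower bound: for u inside the cone pick g nearly minimizing
   E[e^{g . (U_1 - u)}] and tilt the one-step weights by g; by minimality and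
   Chernoff's bound in the four axis directions the tilted walk stays near n u,
   and Y_t differs from V_n.2 by at most V_n.1 - t. *)

Require Import Defs.
From HB Require Import structures.
From mathcomp Require Import all_boot all_order all_algebra.
From mathcomp Require Import finmap ring lra.
From mathcomp Require Import all_classical all_reals all_analysis.
From mathcomp Require Import measurable_realfun.
Set Implicit Arguments. Unset Strict Implicit. Unset Printing Implicit Defensive.
Import Order.TTheory GRing.Theory Num.Theory.
Import numFieldNormedType.Exports.
Local Open Scope classical_set_scope.
Local Open Scope ring_scope.

(** * Planar integrals and polar coordinates *)

(** [is_PPP] speaks only of counts on bounded disjoint sets, and this shapes the proof. The
    increments are never shown to be independent: cell paths only get a lower bound, and both halves
    run on it. An event is bounded above through lower bounds on its complement, and the missing
    mass [1 - dmgf k (0, 0) ^+ n] is counted in full. The halves take their limits in different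
    orders. For the Chernoff bound [n] is fixed and the mesh tends to 0, which removes the loss. For
    the lower bound the mesh is fixed first and [n] grows, which is why strict inequalities are
    needed there. Convexity-type inequalities for [mgf] are proved term by term on finite grid sums
    and passed to the limit. Since only counts are random variables at the outset, measurability of
    the events on [Y_t] has to be derived as well. Besides the acute angles, [theta <= pi / 4] makes
    the path 1-Lipschitz, so that [Y_t / t] stays in [[-1, 1]] and no tightness estimate is
    needed. *)

Section scaling.
Context {R : realType}.
Local Notation mu := (@lebesgue_measure R).
Local Open Scope ereal_scope.

(** Uniqueness of Lebesgue measure: the rescaled pushforward gives half-open intervals their
    length. *)
Lemma lebesgue_measure_affine (a b : R) (a0 : (0 < a)%R) (A : set R) :
  measurable A -> mu A = a%:E * mu ((fun x : R => a * x + b)%R @^-1` A).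
Proof.
move=> mA.
have mf : measurable_fun setT (fun x : measurableTypeR R => (a * x + b)%R : measurableTypeR R).
  exact/measurable_funD/measurable_cst/measurable_funM.
pose na := NngNum (ltW a0).
rewrite (@lebesgue_measure_unique _ (mscale na (pushforward mu (fun x : measurableTypeR R => (a * x + b)%R : measurableTypeR R)))) //.
move=> _ [[x y]] _ <-.
rewrite -[RHS]/(a%:E * mu ((fun t => a * t + b)%R @^-1` `]x, y])).
have -> : (fun t => a * t + b)%R @^-1` `]x, y] = `]((x - b) / a)%R, ((y - b) / a)%R]%classic.
  apply/seteqP; split => t /=; rewrite !in_itv /= ltr_pdivrMr// ler_pdivlMr// ltrBlDr lerBrDr mulrC //.
rewrite !lebesgue_measure_itv /= !lte_fin ltr_pM2r ?invr_gt0// ltrD2r.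
case: ifPn => _; last by rewrite mule0.
by rewrite -EFinD -EFinM -mulrBl mulrCA divff ?gt_eqF// mulr1 opprB addrA subrK.
Qed.

Lemma integral_affine (a b : R) (f : R -> \bar R) : (0 < a)%R ->
  measurable_fun setT f -> (forall x, 0 <= f x) ->
  \int[mu]_x f x = a%:E * \int[mu]_x f (a * x + b)%R.
Proof.
move=> a0 mf f0.
have mg : measurable_fun setT (fun x : measurableTypeR R => (a * x + b)%R : measurableTypeR R).
  exact/measurable_funD/measurable_cst/measurable_funM.
pose na := NngNum (ltW a0).
have -> : (\int[mu]_x f (a * x + b)%R = \int[pushforward mu (fun x : measurableTypeR R => (a * x + b)%R : measurableTypeR R)]_x f x)%E.
  by rewrite ge0_integral_pushforward.
rewrite -(@ge0_integral_mscale _ _ _ _ _ _ na)//=.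
apply: eq_measure_integral => A mA _.
exact: (lebesgue_measure_affine b a0 mA).
Qed.

Lemma integral_scale (a : R) (f : R -> \bar R) : (0 < a)%R ->
  measurable_fun setT f -> (forall x, 0 <= f x) ->
  \int[mu]_x f x = a%:E * \int[mu]_x f (a * x)%R.
Proof.
move=> a0 mf f0; rewrite (integral_affine 0%R a0 mf f0).
by congr (_ * _); apply: eq_integral => x _; rewrite addr0.
Qed.
End scaling.

Section measurability.
Context {R : realType}.

Lemma measurable_set_lt d (T : measurableType d) (f g : T -> R) :
  measurable_fun setT f -> measurable_fun setT g -> measurable [set x | f x < g x]%R.
Proof.
move=> mf mg; have := measurable_fun_ltr mf mg.
by move=> /(_ measurableT [set true] I); rewrite setTI.
Qed.

Lemma measurable_set_le d (T : measurableType d) (f g : T -> R) :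
  measurable_fun setT f -> measurable_fun setT g -> measurable [set x | f x <= g x]%R.
Proof.
move=> mf mg; rewrite (_ : [set _ | _] = ~` [set x | g x < f x]%R).
  exact/measurableC/measurable_set_lt.
by apply/seteqP; split => x /=; rewrite leNgt => /negP.
Qed.

Lemma measurable_inv : measurable_fun setT (@GRing.inv R).
Proof.
have -> : (@GRing.inv R) = (fun x => if x == 0 then 0 else x^-1).
  by apply/funext => x; case: eqVneq => // ->; rewrite invr0.
apply: measurable_fun_if => //.
- exact: measurable_fun_eqr.
- rewrite setTI (_ : _ @^-1` _ = ~` [set 0]).
    apply: open_continuous_measurable_fun; first by rewrite openC; exact: (accessible_closed_set1 (hausdorff_accessible (@Rhausdorff R))).
    by move=> x /set_mem /= /eqP x0; exact: inv_continuous.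
  by apply/seteqP; split => x /=; [move/negbT/eqP|move/eqP/negbTE].
Qed.
End measurability.

Ltac mfun := repeat first
  [ exact: measurable_fst | exact: measurable_snd | exact: measurable_cst
  | exact: measurable_id | assumption
  | apply: measurable_funD | apply: measurable_funM | apply: measurable_funB
  | apply: measurable_fun_pair | apply: measurable_fun_ltr | apply: measurable_and
  | apply: measurable_fun_ifT
  | apply: (measurableT_comp (@measurable_expR _))
  | apply: (measurableT_comp (@normr_measurable _ setT))
  | apply: (measurableT_comp measurable_fst) | apply: (measurableT_comp measurable_snd)
  | apply: (measurableT_comp (@measurable_inv _))
  | apply: measurable_funX
  | apply: (measurableT_comp (@oppr_measurable _ setT))
  | apply: measurableT_comp; first assumption ].

Section polar.
Context {R : realType}.
Local Notation mu := (@lebesgue_measure R).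

(** Open and written with the slope [t], later [tan theta], instead of an angle. It differs from the
    closed cone of [in_cone] by a null set, and for [t > 0] strictness excludes the apex. *)
Definition cone (t : R) : set (R * R) := [set p | `|p.2| < p.1 * t].

Lemma measurable_cone t : measurable (cone t).
Proof. by apply: measurable_set_lt; mfun. Qed.

Lemma measurable_cos_atan : measurable_fun setT (fun s : R => cos (atan s)).
Proof.
apply: continuous_measurable_fun => s.
by apply: continuous_comp; [exact: continuous_atan | exact: continuous_cos].
Qed.

Lemma derive1_atan : (@atan R)^`()%classic = (fun s => (1 + s ^+ 2)^-1).
Proof.
apply/funext => s; rewrite derive1E.
by have -> := @derive_val _ _ _ _ _ _ _ (is_derive1_atan s).
Qed.

Lemma continuous_inv_sq : continuous (fun s : R => (1 + s ^+ 2)^-1).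
Proof.
move=> s; apply: cvgV; first by rewrite gt_eqF// ltr_wpDr// sqr_ge0.
by apply: cvgD; [exact: cvg_cst | apply: exprn_continuous].
Qed.

Lemma integral_atan (t : R) (G : R -> R) : 0 < t -> continuous G ->
  (\int[mu]_(phi in `[(- atan t)%R, atan t]) (G phi)%:E =
   \int[mu]_(s in `[(- t)%R, t]) (G (atan s) / (1 + s ^+ 2))%:E)%E.
Proof.
move=> t0 cG; rewrite -atanN.
rewrite (@integration_by_substitution_increasing _ (@atan R)).
- by apply: eq_integral => s _; rewrite derive1_atan.
- by rewrite (@le_trans _ _ 0)// ?oppr_le0 ltW.
- by move=> x y _ _; apply: lt_atan.
- by rewrite derive1_atan => s _; exact: continuous_inv_sq.
- rewrite derive1_atan; apply/cvg_ex; eexists.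
  by apply: cvg_at_right_filter; exact: continuous_inv_sq.
- rewrite derive1_atan; apply/cvg_ex; eexists.
  by apply: cvg_at_left_filter; exact: continuous_inv_sq.
- split.
  + by move=> s _; exact: derivable_atan.
  + by apply: cvg_at_right_filter; exact: continuous_atan.
  + by apply: cvg_at_left_filter; exact: continuous_atan.
- exact: continuous_subspaceT.
Qed.

Lemma tan_gt0 (theta : R) : 0 < theta < pi / 2 -> 0 < tan theta.
Proof.
move=> /andP[th0 thpi]; rewrite divr_gt0//.
  by apply: sin_gt0_pi; rewrite th0/= (lt_le_trans thpi)// ler_pdivrMr// ler_peMr// ?pi_ge0// ler1n.
by apply: cos_gt0_pihalf; rewrite thpi (lt_trans _ th0)// oppr_lt0 divr_gt0// pi_gt0.
Qed.

Lemma cos_atan_gt0 (s : R) : 0 < cos (atan s).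
Proof. by apply: cos_gt0_pihalf; rewrite atan_gtNpi2 atan_ltpi2. Qed.

Lemma sin_atan (s : R) : sin (atan s) = s * cos (atan s).
Proof.
rewrite -{2}(atanK s) /tan divfK// gt_eqF//; exact: cos_atan_gt0.
Qed.

Lemma cos_atan_sqr (s : R) : cos (atan s) ^+ 2 = (1 + s ^+ 2)^-1.
Proof. by rewrite cos_atan exprVn sqr_sqrtr// addr_ge0// sqr_ge0. Qed.

(* Slope coordinates [(x, x s)] turn the cone into a strip; for each fixed radius
   the substitution [phi = atan s] is then one-dimensional. *)
Lemma integral_cone_polar (t : R) (f : R * R -> R) :
  0 < t -> measurable_fun setT f -> (forall p, 0 <= f p) ->
  (forall r, continuous (fun phi => f (r * cos phi, r * sin phi))) ->
  (\int[mu \x mu]_(p in cone t) (f p)%:E =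
  \int[mu]_(r in `[0%R, +oo[) (r%:E *
    \int[mu]_(phi in `[(- atan t)%R, atan t]) (f (r * cos phi, r * sin phi)%R)%:E))%E.
Proof.
move=> t0 mf f0 cf.
(* [g] is the integrand cut off to the cone, [h] its form after [y = x s] with Jacobian [x], and [k]
   the form after [x = r cos (atan s)]: one cosine is the Jacobian, the other comes from the factor
   [x]. Their product [cos (atan s) ^+ 2] is the derivative of [atan] at [s]. *)
pose g (p : R * R) := if `|p.2| < p.1 * t then f p else 0.
pose h (p : R * R) := if (0 < p.1) && (`|p.2| < t) then p.1 * f (p.1, p.1 * p.2) else 0.
pose k (p : R * R) := if (0 < p.1) && (`|p.2| < t) then
  p.1 * (f (p.1 * cos (atan p.2), p.1 * (p.2 * cos (atan p.2))) * (cos (atan p.2) ^+ 2)) else 0.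
have mg : measurable_fun setT g by rewrite /g; mfun.
have mca : measurable_fun [set: R * R] (fun x : R * R => cos (atan x.2)).
  exact: (measurableT_comp measurable_cos_atan).
have mh : measurable_fun setT h.
  by rewrite /h; mfun => //; apply: (measurableT_comp mf); mfun.
have mk : measurable_fun setT k.
  by rewrite /k; mfun => //; apply: (measurableT_comp mf); mfun.
have h0 p : 0 <= h p.
  by rewrite /h; case: ifP => // /andP[p0 _]; rewrite mulr_ge0// ltW.
have k0 p : 0 <= k p.
  by rewrite /k; case: ifP => // /andP[p0 _]; apply: mulr_ge0; [exact: ltW|apply: mulr_ge0; [|exact: sqr_ge0]].
have g0 p : 0 <= g p by rewrite /g; case: ifP.
have -> : (\int[mu \x mu]_(p in cone t) (f p)%:E = \int[mu \x mu]_p (g p)%:E)%E.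
  rewrite integral_mkcond; apply: eq_integral => p _; rewrite patchE /g.
  by case: ifPn => [/set_mem/= ->|/negP pc] //; case: ifPn => // pt; case: pc; rewrite inE.
transitivity (\int[mu]_x fubini_F mu (EFin \o g) x)%E.
  by apply: fubini_tonelli1; [exact/measurable_EFinP|move=> p; rewrite lee_fin].
transitivity (\int[mu]_x \int[mu]_s (h (x, s))%:E)%E.
  apply: eq_integral => x _; rewrite /fubini_F/=.
  have [x0|x0] := ltP 0 x.
    rewrite (@integral_scale _ x (fun y => (g (x, y))%:E)) //; last 2 first.
    - by apply/measurable_EFinP; apply: (measurableT_comp mg); exact: pair1_measurable.
    - by move=> y; rewrite lee_fin.
    rewrite -ge0_integralZl_EFin//; last 3 first.
    - by move=> y _; rewrite lee_fin.
    - by apply/measurable_EFinP; apply: (measurableT_comp mg); apply: measurable_fun_pair => //; exact: measurable_funM.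
    - exact: ltW.
    apply: eq_integral => s _; rewrite -EFinM /g /h /= x0/= normrM gtr0_norm// ltr_pM2l//.
    by case: ifP; rewrite ?mulr0.
  apply: eq_integral => y _; rewrite /g/h/= [0 < x]ltNge x0/= ifF//.
  by apply/negbTE; rewrite -leNgt (le_trans _ (normr_ge0 _))// mulr_le0_ge0// ltW.
transitivity (\int[mu]_s \int[mu]_x (h (x, s))%:E)%E.
  by apply: (@fubini_tonelli _ _ _ _ R mu mu (EFin \o h)); [exact/measurable_EFinP|move=> p; rewrite lee_fin].
transitivity (\int[mu]_s \int[mu]_r (k (r, s))%:E)%E.
  apply: eq_integral => s _ /=.
  have c0 := cos_atan_gt0 s.
  rewrite (@integral_scale _ (cos (atan s)) (fun x => (h (x, s))%:E)) //; last 2 first.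
  - by apply/measurable_EFinP; apply: (measurableT_comp mh); exact: pair2_measurable.
  - by move=> y; rewrite lee_fin.
  rewrite -ge0_integralZl_EFin//; last 3 first.
  - by move=> y _; rewrite lee_fin.
  - by apply/measurable_EFinP; apply: (measurableT_comp mh); apply: measurable_fun_pair => //; exact: measurable_funM.
  - exact: ltW.
  apply: eq_integral => r _; rewrite -EFinM /k /h /= pmulr_rgt0//.
  case: ifP => _; rewrite ?mulr0//; congr (EFin _).
  have -> : r * (s * cos (atan s)) = cos (atan s) * r * s by ring.
  rewrite [r * cos (atan s)]mulrC; ring.
transitivity (\int[mu]_r \int[mu]_s (k (r, s))%:E)%E.
  by apply/esym/(@fubini_tonelli _ _ _ _ R mu mu (EFin \o k)); [exact/measurable_EFinP|move=> p; rewrite lee_fin].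
rewrite [RHS]integral_mkcond; apply: eq_integral => r _; rewrite patchE /=.
rewrite mem_setE in_itv/= andbT.
have [r0|r0] := ltP 0 r; last first.
  rewrite integral0_eq; last by move=> s _; rewrite /k/= [0 < r]ltNge r0.
  by case: ifP => // r1; rewrite (_ : r = 0) ?mul0e//; apply/eqP; rewrite eq_le r0 r1.
rewrite ltW// integral_atan//.
have m1 : measurable_fun [set: R] (fun s => f (r * cos (atan s), r * sin (atan s)) / (1 + s ^+ 2)).
  apply: measurable_funM; last exact: continuous_measurable_fun (@continuous_inv_sq).
  apply: continuous_measurable_fun => s; apply: (@continuous_comp _ _ _ atan (fun phi => f (r * cos phi, r * sin phi))); [exact: continuous_atan | exact: cf].
rewrite integral_itv_bndoo; last first.
  by apply/measurable_EFinP; apply: measurable_funS m1.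
rewrite [X in (_ * X)%E]integral_mkcond -ge0_integralZl_EFin//; last 3 first.
- move=> s _; rewrite patchE; case: ifP => // _; rewrite lee_fin.
  by rewrite mulr_ge0 ?invr_ge0 ?addr_ge0 ?sqr_ge0.
- apply/(measurable_restrictT _ (measurable_itv `]- t, t[)).
  by apply/measurable_EFinP; apply: measurable_funS m1.
- exact: ltW.
apply: eq_integral => s _; rewrite patchE mem_setE in_itv/= -ltr_norml /k/= r0/=.
case: ifP => _; rewrite ?mule0// -EFinM; congr EFin.
by rewrite sin_atan -cos_atan_sqr.
Qed.
End polar.

Section plane.
Context {R : realType}.
Local Notation mu := (@lebesgue_measure R).

Lemma leb2_shift (c : R * R) (A : set (R * R)) : measurable A ->
  leb2 [set p : R * R | A (p.1 + c.1, p.2 + c.2)] = leb2 A.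
Proof.
move=> mA; rewrite /leb2 /product_measure1.
pose F := (mu \o xsection A).
have mF : measurable_fun setT F by exact: measurable_fun_xsection.
rewrite [RHS](@integral_affine _ 1 c.1 F)// mul1e.
apply: eq_integral => x _ /=; rewrite mul1r /F /=.
rewrite [RHS](@lebesgue_measure_affine _ 1 c.2)//; last exact: measurable_xsection.
rewrite mul1e; congr (mu _); apply/seteqP; split => y /=; rewrite /xsection/= !inE/= mul1r//.
Qed.

Definition cell (d : R) (p : R * R) : set (R * R) :=
  `[p.1, p.1 + d[%classic `*` `[p.2, p.2 + d[%classic.

Lemma measurable_cell d p : measurable (cell d p).
Proof. exact: measurableX. Qed.

Lemma leb2_cell (d : R) p : 0 < d -> leb2 (cell d p) = (d ^+ 2)%:E.
Proof.
move=> d0.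
transitivity (mu `[p.1, (p.1 + d)%R[%classic * mu `[p.2, (p.2 + d)%R[%classic)%E.
  exact: product_measure1E.
rewrite !lebesgue_measure_itv/= !lte_fin !ltrDl d0.
by rewrite -!EFinD -EFinM; congr EFin; ring.
Qed.

Lemma integral_radial (a : R) : 0 < a ->
  (\int[mu]_(r in `[0%R, +oo[) (r * expR (- a * r ^+ 2))%:E = (2 * a)^-1%:E)%E.
Proof.
move=> a0.
have a2 : (2 * a) != 0 by rewrite mulf_neq0// ?gt_eqF.
pose F (r : R) := - (expR (- a * r ^+ 2) / (2 * a)).
have dF (r : R) : is_derive r 1 F (r * expR (- a * r ^+ 2)).
  rewrite /F; apply: is_derive_eq; rewrite /GRing.scale/=.
  by field; rewrite gt_eqF.
rewrite (@ge0_continuous_FTC2y _ _ F 0 0).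
- by rewrite /F expr0n/= mulr0 expR0 mul1r -EFinB sub0r opprK.
- by move=> x x0; rewrite mulr_ge0// expR_ge0.
- apply: continuous_subspaceT => r.
  apply: cvgM; first exact: cvg_id.
  apply: continuous_comp; last exact: continuous_expR.
  by apply: (@cvgM _ _ _ _ (fun=> - a)); [exact: cvg_cst|apply: exprn_continuous].
- rewrite /F -[X in _ --> X]oppr0 -(mul0r (2 * a)^-1); apply: cvgN; apply: cvgM; last exact: cvg_cst.
  have -> : (fun r : R => expR (- a * r ^+ 2)) = (fun r => expR (- (a * r ^+ 2))).
    by apply/funext => r; rewrite mulNr.
  apply: (cvg_comp _ (fun r => expR (- r))); last exact: cvgr_expR.
  by apply: gt0_cvgMry => //; exact: cvgr_expr2.
- by move=> x _; exact: ex_derive.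
- apply: cvg_at_right_filter; apply: differentiable_continuous; apply/derivable1_diffP; exact: ex_derive.
- by move=> x _; rewrite derive1E derive_val.
Qed.
End plane.

(** * Areas of sectors and the moment generating function of one step *)

Section mgf.
Context {R : realType}.
Local Notation mu := (@lebesgue_measure R).
Variables lambda theta : R.
Hypotheses (lambda0 : 0 < lambda) (thetaP : 0 < theta <= pi / 4).
Local Notation t := (tan theta).

Lemma theta_gt0 : 0 < theta. Proof. by case/andP: thetaP. Qed.

Lemma theta_itv : 0 < theta < pi / 2.
Proof.
case/andP: thetaP => -> /= /le_lt_trans; apply.
by rewrite ltr_pM2l ?pi_gt0// ltf_pV2 ?posrE// ltr_nat.
Qed.

Lemma atan_tan_theta : atan t = theta.
Proof.
apply: tanK; rewrite in_itv/=; case/andP: theta_itv => th0 ->.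
by rewrite (lt_trans _ th0)// oppr_lt0 divr_gt0// pi_gt0.
Qed.

Lemma slope_gt0 : 0 < t. Proof. exact: tan_gt0 theta_itv. Qed.

Lemma slope_le1 : t <= 1.
Proof.
rewrite -tan_piquarter; case/andP: thetaP => th0; rewrite le_eqVlt => /predU1P[->//|th4].
rewrite ltW// ltr_tan// in_itv/=; case/andP: theta_itv => _ th2.
- by rewrite th2 (lt_trans _ th0)// oppr_lt0 divr_gt0// pi_gt0.
- by rewrite (@lt_trans _ _ 0) ?oppr_lt0 ?divr_gt0 ?pi_gt0//= ltr_pM2l ?pi_gt0// ltf_pV2 ?posrE// ltr_nat.
Qed.

Definition sqnorm (p : R * R) : R := p.1 ^+ 2 + p.2 ^+ 2.

Definition sector (w : R * R) (rho : R) : set (R * R) :=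
  [set p | `|p.2 - w.2| < (p.1 - w.1) * t /\
           (p.1 - w.1) ^+ 2 + (p.2 - w.2) ^+ 2 <= rho ^+ 2].

Lemma measurable_sector w rho : measurable (sector w rho).
Proof.
apply: measurableI; first by apply: measurable_set_lt; mfun.
by apply: measurable_set_le; mfun.
Qed.

Lemma sqnorm_polar (r phi : R) : sqnorm (r * cos phi, r * sin phi) = r ^+ 2.
Proof. by rewrite /sqnorm/= !exprMn -mulrDr cos2Dsin2 mulr1. Qed.

Lemma integral_cst_theta (c : R) :
  (\int[mu]_(phi in `[(- theta)%R, theta]) c%:E = (2 * theta * c)%:E)%E.
Proof.
rewrite integral_cst//= lebesgue_measure_itv/= lte_fin gtrN ?theta_gt0//.
by rewrite -EFinB -EFinM; congr EFin; ring.
Qed.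

(** Polar integration of an indicator; the opening angle is [2 * theta]. With intensity [lambda]
    this area yields the void probability [expR (- (lambda * theta * rho ^+ 2))], the source of the
    Gaussian factor in all weights below. *)
Lemma leb2_sector w (rho : R) : 0 < rho -> leb2 (sector w rho) = (theta * rho ^+ 2)%:E.
Proof.
move=> rho0; have := measurable_sector (0, 0) rho => m0.
have -> : sector w rho = [set p : R * R | sector (0, 0) rho (p.1 + (- w.1, - w.2).1, p.2 + (- w.1, - w.2).2)].
  by apply/seteqP; split => p; rewrite /sector/= !subr0.
rewrite leb2_shift//.
pose f (p : R * R) : R := if sqnorm p <= rho ^+ 2 then 1 else 0.
have mf : measurable_fun setT f.
  by rewrite /f /sqnorm; apply: measurable_fun_ifT => //; apply: measurable_fun_ler; mfun.
transitivity (\int[mu \x mu]_(p in cone t) (f p)%:E)%E.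
  transitivity (\int[mu \x mu]_p (\1_(sector (0, 0) rho) p)%:E)%E.
    by rewrite integral_indic// setIT.
  rewrite [RHS]integral_mkcond; apply: eq_integral => p _; rewrite patchE indicE /f.
  rewrite /sector /sqnorm /cone; case: ifPn; rewrite /sqnorm ?inE/= ?notin_setE/= => pc.
    case: ifPn => pr; first by rewrite mem_set//; split; rewrite !subr0.
    by rewrite memNset//= !subr0 => -[_]; apply/negP.
  by rewrite memNset//= !subr0 => -[].
rewrite integral_cone_polar//; [|exact: slope_gt0|by move=> p; rewrite /f; case: ifP|]; last first.
  by move=> r phi; rewrite /f; under eq_fun do rewrite sqnorm_polar; exact: cvg_cst.
rewrite atan_tan_theta.
transitivity (\int[mu]_(r in `[0%R, rho]) (2 * theta * r)%:E)%E.
  rewrite [LHS]integral_mkcond [RHS]integral_mkcond; apply: eq_integral => r _.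
  rewrite !patchE !mem_setE !in_itv/= andbT /f.
  under eq_integral do rewrite sqnorm_polar.
  rewrite integral_cst_theta -EFinM; case: ifPn => //= r0.
  rewrite ler_pXn2r ?nnegrE ?(ltW rho0)//; case: ifP => _; last by rewrite !mulr0.
  by congr EFin; ring.
rewrite (@continuous_FTC2 _ _ (fun r => theta * r ^+ 2))//.
- by rewrite expr0n/= mulr0 oppr0 adde0.
- by apply: continuous_subspaceT => r; apply: cvgM; [exact: cvg_cst|exact: cvg_id].
- split => [x _||]; first exact: ex_derive.
    by apply: cvg_at_right_filter; apply: cvgM; [exact: cvg_cst|apply: exprn_continuous].
  by apply: cvg_at_left_filter; apply: cvgM; [exact: cvg_cst|apply: exprn_continuous].
- move=> x _; rewrite derive1E derive_val /GRing.scale/=; ring.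
Qed.

Definition dot (g p : R * R) : R := g.1 * p.1 + g.2 * p.2.

(** Up to the factor [lambda], the density of [U_1] at [p] (no point of the cone is nearer than
    [p]), tilted by [g]. *)
Definition gauss (g p : R * R) : R :=
  expR (- (lambda * theta) * sqnorm p + dot g p).

Lemma gauss_gt0 g p : 0 < gauss g p. Proof. exact: expR_gt0. Qed.

Lemma measurable_gauss g : measurable_fun setT (gauss g).
Proof. by rewrite /gauss /sqnorm /dot; mfun. Qed.

Lemma lambda_theta_gt0 : 0 < lambda * theta.
Proof. by rewrite mulr_gt0// theta_gt0. Qed.

Lemma integral_cone_radial (a : R) : 0 < a ->
  (\int[mu \x mu]_(p in cone t) (expR (- a * sqnorm p))%:E = (theta / a)%:E)%E.
Proof.
move=> a0; rewrite (@integral_cone_polar _ _ (fun p => expR (- a * sqnorm p))).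
- rewrite atan_tan_theta.
  transitivity (\int[mu]_(r in `[0%R, +oo[) ((2 * theta)%:E * (r * expR (- a * r ^+ 2))%:E))%E.
    apply: eq_integral => r _; under eq_integral do rewrite sqnorm_polar.
    by rewrite integral_cst_theta -!EFinM; congr EFin; ring.
  rewrite ge0_integralZl_EFin//.
  + rewrite integral_radial// -EFinM; congr EFin.
    by field; rewrite gt_eqF.
  + by move=> r; rewrite /= in_itv/= andbT => r0; rewrite lee_fin mulr_ge0// expR_ge0.
  + apply/measurable_EFinP/measurable_funTS; by mfun.
  + by rewrite mulr_ge0// ltW// theta_gt0.
- exact: slope_gt0.
- by rewrite /sqnorm; mfun.
- by move=> p; exact: expR_ge0.
- by move=> r phi; under eq_fun do rewrite sqnorm_polar; exact: cvg_cst.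
Qed.

(** Completing the square: half of the Gaussian decay absorbs the tilt. *)
Lemma gauss_le g p : gauss g p <=
  expR ((g.1 ^+ 2 + g.2 ^+ 2) / (2 * (lambda * theta))) *
  expR (- (lambda * theta / 2) * sqnorm p).
Proof.
have a0 := lambda_theta_gt0; set a := lambda * theta in a0 *.
rewrite /gauss -expRD ler_expR -/a /sqnorm /dot.
rewrite -subr_ge0.
have -> : (g.1 ^+ 2 + g.2 ^+ 2) / (2 * a) + - (a / 2) * (p.1 ^+ 2 + p.2 ^+ 2) -
  (- a * (p.1 ^+ 2 + p.2 ^+ 2) + (g.1 * p.1 + g.2 * p.2)) =
  ((g.1 - a * p.1) ^+ 2 + (g.2 - a * p.2) ^+ 2) / (2 * a).
  by field; rewrite gt_eqF.
by rewrite divr_ge0 ?addr_ge0 ?sqr_ge0// mulr_ge0// ltW.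
Qed.

Lemma integrable_gauss g :
  (mu \x mu)%E.-integrable (cone t) (fun p => (gauss g p)%:E).
Proof.
have mc := @measurable_cone R t.
have a0 : 0 < lambda * theta / 2 by rewrite divr_gt0// lambda_theta_gt0.
refine (@le_integrable _ _ R (mu \x mu)%E _ mc (fun p => (gauss g p)%:E) (fun p => (expR ((g.1 ^+ 2 + g.2 ^+ 2) / (2 * (lambda * theta))) *
  expR (- (lambda * theta / 2) * sqnorm p))%:E) _ _ _).
- by apply/measurable_EFinP; apply: measurable_funTS; exact: measurable_gauss.
- move=> p _; rewrite !abse_EFin lee_fin !ger0_norm ?gauss_le ?mulr_ge0 ?expR_ge0//.
- refine (@integrableZl _ _ R (mu \x mu)%E _ mc (expR ((g.1 ^+ 2 + g.2 ^+ 2) / (2 * (lambda * theta)))) (fun p => (expR (- (lambda * theta / 2) * sqnorm p))%:E) _).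
  apply/integrableP; split.
    by apply/measurable_EFinP; apply: measurable_funTS; rewrite /sqnorm; mfun.
  under eq_integral do rewrite abse_EFin ger0_norm ?expR_ge0//.
  by rewrite integral_cone_radial// ltry.
Qed.

(** This is E[exp (g . U_1)]; by [mgfE] the integral is finite and [fine] discards nothing. *)
Definition mgf (g : R * R) : R :=
  lambda * fine (\int[mu \x mu]_(p in cone t) (gauss g p)%:E)%E.

Lemma mgfE g : (\int[mu \x mu]_(p in cone t) (gauss g p)%:E = (mgf g / lambda)%:E)%E.
Proof.
rewrite /mgf mulrAC divff ?gt_eqF// mul1r fineK//.
by apply: integral_fune_fin_num => //; [exact: measurable_cone|exact: integrable_gauss].
Qed.

(** The density of a step integrates to 1. With [cvg_dmgf] this is what makes the grid paths exhaust
    the probability in the limit. *)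
Lemma mgf0 : mgf (0, 0) = 1.
Proof.
rewrite /mgf (_ : (\int[_]_(_ in _) _)%E = lambda^-1%:E) ?divff ?gt_eqF//.
rewrite -(_ : theta / (lambda * theta) = lambda^-1).
  rewrite -(integral_cone_radial lambda_theta_gt0).
  by apply: eq_integral => p _; rewrite /gauss /dot/= !mul0r !addr0.
by field; rewrite !gt_eqF// theta_gt0.
Qed.

Lemma continuous_polar_exp (g : R * R) (r : R) :
  continuous (fun phi : R => expR (g.1 * r * cos phi + g.2 * r * sin phi)).
Proof.
move=> phi; apply: continuous_comp; last exact: continuous_expR.
by apply: cvgD; (apply: (@cvgM _ _ _ _ (fun=> _)); first exact: cvg_cst);
  [exact: continuous_cos|exact: continuous_sin].
Qed.

Lemma JfunE g : Jfun lambda theta g = ln (mgf g).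
Proof.
rewrite /Jfun /mgf; congr (ln (_ * _)); rewrite /Rintegral; congr fine.
rewrite (@integral_cone_polar _ _ (gauss g)).
- apply: eq_integral => r; rewrite inE/= in_itv/= andbT => r0.
  rewrite atan_tan_theta.
  have intg : mu.-integrable `[- theta, theta]%classic (EFin \o (fun phi : R => expR (g.1 * r * cos phi + g.2 * r * sin phi))).
    apply: continuous_compact_integrable; first exact: segment_compact.
    by apply: continuous_subspaceT; exact: continuous_polar_exp.
  rewrite -mulrA EFinM EFinM; congr (_ * _)%E.
  rewrite fineK; last by apply: integral_fune_fin_num.
  rewrite -integralZl//; apply: eq_integral => phi _.
  rewrite -EFinM -expRD /gauss sqnorm_polar /dot/=; congr (expR _)%:E.
  by rewrite mulNr !mulrA mulNr.
- exact: slope_gt0.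
- exact: measurable_gauss.
- by move=> p; rewrite ltW// gauss_gt0.
- move=> r.
  have -> : (fun phi => gauss g (r * cos phi, r * sin phi)) =
    (fun phi => expR (- (lambda * theta) * r ^+ 2) * expR (g.1 * r * cos phi + g.2 * r * sin phi)).
    apply/funext => phi; rewrite /gauss sqnorm_polar -expRD /dot/=.
    by rewrite !mulrA.
  move=> phi; apply: (@cvgM _ _ _ _ (fun=> _)); first exact: cvg_cst.
  exact: continuous_polar_exp.
Qed.

End mgf.

(** * Grid approximation of the moment generating function *)

Section grid.
Context {R : realType}.
Local Notation mu := (@lebesgue_measure R).
Variables lambda theta : R.
Hypotheses (lambda0 : 0 < lambda) (thetaP : 0 < theta <= pi / 4).
Local Notation t := (tan theta).
Local Notation gauss := (gauss lambda theta).
Local Notation mgf := (mgf lambda theta).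

Lemma cellP (d : R) p q : cell d p q <->
  (p.1 <= q.1 < p.1 + d) /\ (p.2 <= q.2 < p.2 + d).
Proof. by rewrite /cell /= /setX/= !in_itv/=. Qed.

Section cells.
Variables (d : R) (T : finType) (P : pred T) (pos : T -> R * R).
Hypothesis d0 : 0 < d.
Hypothesis disj : forall x y, P x -> P y -> x != y -> cell d (pos x) `&` cell d (pos y) = set0.

Let U := \big[setU/set0]_(z <- enum P) cell d (pos z).

Lemma trivIset_cells : trivIset [set` enum P] (fun z => cell d (pos z)).
Proof.
apply/trivIsetP => x y /=; rewrite !mem_enum => Px Py xy; exact: disj.
Qed.

Lemma measurable_cells : measurable U.
Proof. by apply: bigsetU_measurable => z _; exact: measurable_cell. Qed.

Lemma integral_cells (f : R * R -> R) : measurable_fun setT f -> (forall p, 0 <= f p) ->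
  (\int[mu \x mu]_(p in U) (f p)%:E = \sum_(z | P z) \int[mu \x mu]_(p in cell d (pos z)) (f p)%:E)%E.
Proof.
move=> mf f0; rewrite ge0_integral_bigsetU//.
- by rewrite big_enum.
- by move=> z; exact: measurable_cell.
- exact: enum_uniq.
- exact: trivIset_cells.
- by apply/measurable_EFinP; apply: measurable_funTS.
- by move=> p _; rewrite lee_fin.
Qed.

Lemma integral_cell_cst p (c : R) :
  (\int[mu \x mu]_(_ in cell d p) c%:E = (c * d ^+ 2)%:E)%E.
Proof.
have -> : (\int[mu \x mu]_(_ in cell d p) c%:E = c%:E * leb2 (cell d p))%E.
  by rewrite integral_cst//; exact: measurable_cell.
by rewrite leb2_cell// -EFinM.
Qed.

(** A lower Riemann sum. It serves twice: with the whole grid to bound [dmgf] from above, and with a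
    single cell to bound [mgf] from below in [tilt_coercive]. *)
Lemma sum_cells_le (c : T -> R) g : (forall z, P z -> 0 <= c z) ->
  (forall z p, P z -> cell d (pos z) p -> cone t p /\ c z <= gauss g p) ->
  lambda * (\sum_(z | P z) c z * d ^+ 2) <= mgf g.
Proof.
move=> c0 cP; rewrite mulrC -ler_pdivlMr// -lee_fin -mgfE//.
have mg : measurable_fun setT (gauss g) by exact: measurable_gauss.
apply: (@le_trans _ _ (\int[mu \x mu]_(p in U) (gauss g p)%:E)%E).
  rewrite integral_cells//; last by move=> p; rewrite ltW// gauss_gt0.
  rewrite -sumEFin; apply: lee_sum => z Pz; rewrite -(integral_cell_cst (pos z)).
  apply: ge0_le_integral => //.
  - exact: measurable_cell.
  - by move=> p _; rewrite lee_fin c0.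
  - by apply/measurable_EFinP; apply: measurable_funTS.
  - by move=> p pz; rewrite lee_fin; apply: (cP _ _ Pz pz).2.
apply: ge0_subset_integral => //.
- exact: measurable_cells.
- exact: measurable_cone.
- by apply/measurable_EFinP; apply: measurable_funTS.
- by move=> p _; rewrite lee_fin ltW// gauss_gt0.
- rewrite /U -bigcup_seq => p [z /=]; rewrite mem_enum => Pz pz; exact: (cP _ _ Pz pz).1.
Qed.

Lemma sum_cells_ge (c : T -> R) (f : R * R -> R) (A : set (R * R)) :
  measurable A -> measurable_fun setT f -> (forall p, 0 <= f p) ->
  (forall p, A p -> exists2 z, P z & cell d (pos z) p) ->
  (forall z p, P z -> cell d (pos z) p -> f p <= c z) ->
  (\int[mu \x mu]_(p in A) (f p)%:E <= (\sum_(z | P z) c z * d ^+ 2)%:E)%E.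
Proof.
move=> mA mf f0 AP fP.
apply: (@le_trans _ _ (\int[mu \x mu]_(p in U) (f p)%:E)%E).
  apply: ge0_subset_integral => //.
  - exact: measurable_cells.
  - by apply/measurable_EFinP; apply: measurable_funTS.
  - by move=> p _; rewrite lee_fin.
  - by move=> p /AP[z Pz pz]; rewrite /U -bigcup_seq; exists z => //=; rewrite mem_enum.
rewrite integral_cells// -sumEFin; apply: lee_sum => z Pz; rewrite -(integral_cell_cst (pos z)).
apply: ge0_le_integral => //.
- exact: measurable_cell.
- by move=> p _; rewrite lee_fin.
- by apply/measurable_EFinP; apply: measurable_funTS.
- by move=> p pz; rewrite lee_fin; exact: fP pz.
Qed.
End cells.

Definition enorm (p : R * R) : R := Num.sqrt (sqnorm p).

Lemma sqnorm_ge0 (p : R * R) : 0 <= sqnorm p.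
Proof. by rewrite addr_ge0 ?sqr_ge0. Qed.

Lemma enorm_ge0 p : 0 <= enorm p. Proof. exact: sqrtr_ge0. Qed.

Lemma sqr_enorm p : enorm p ^+ 2 = sqnorm p.
Proof. by rewrite sqr_sqrtr// sqnorm_ge0. Qed.

Lemma enorm_le p (c : R) : 0 <= c -> sqnorm p <= c ^+ 2 -> enorm p <= c.
Proof. by move=> c0 pc; rewrite -(ger0_norm c0) -sqrtr_sqr ler_wsqrtr. Qed.

Lemma enorm_triangle (p q : R * R) : enorm (p + q) <= enorm p + enorm q.
Proof.
apply: enorm_le; first by rewrite addr_ge0 ?enorm_ge0.
have cs : p.1 * q.1 + p.2 * q.2 <= enorm p * enorm q.
  rewrite (le_trans (ler_norm _))// -(@ler_pXn2r _ 2) ?nnegrE ?mulr_ge0 ?enorm_ge0//.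
  rewrite exprMn !sqr_enorm real_normK ?num_real// -subr_ge0 /sqnorm.
  rewrite (_ : _ - _ = (p.1 * q.2 - p.2 * q.1) ^+ 2) ?sqr_ge0//; ring.
rewrite sqrrD !sqr_enorm /sqnorm/=; move: cs; lra.
Qed.

Lemma enorm_le1 (p : R * R) : enorm p <= `|p.1| + `|p.2|.
Proof.
apply: enorm_le; first exact: addr_ge0.
rewrite /sqnorm sqrrD !real_normK ?num_real//.
by rewrite -addrA lerD2l lerDr mulrn_wge0// mulr_ge0.
Qed.

Lemma enormN (p : R * R) : enorm (- p) = enorm p.
Proof. by rewrite /enorm /sqnorm/= !sqrrN. Qed.

Lemma dotD (g p q : R * R) : dot g (p + q) = dot g p + dot g q.
Proof. by rewrite /dot/=; ring. Qed.

(** The l1 norm, dual to the sup norm in which cells are small: moving a point inside a cell of side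
    [d] changes [dot g] by at most [gnorm g * d]. *)
Definition gnorm (g : R * R) : R := `|g.1| + `|g.2|.

Lemma gnorm_ge0 g : 0 <= gnorm g. Proof. exact: addr_ge0. Qed.

Lemma dot_le g (e : R * R) d : `|e.1| <= d -> `|e.2| <= d -> `|dot g e| <= gnorm g * d.
Proof.
move=> e1 e2; rewrite (le_trans (ler_normD _ _))// mulrDl !normrM.
by apply: lerD; exact: ler_wpM2l.
Qed.

Lemma cell_offset (d : R) p q : cell d p q -> exists e : R * R,
  [/\ q = p + e, 0 <= e.1 < d & 0 <= e.2 < d].
Proof.
move=> /cellP[/andP[h1 h2] /andP[h3 h4]]; exists (q - p).
rewrite addrC subrK; split => //=; apply/andP; split; lra.
Qed.

Definition mesh k : R := k.+1%:R^-1.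

(** With mesh [1 / (k+1)], a row of [(k+1)^2] cells has length [k+1], so the grid covers [[0, k+1) x
    [-(k+1), k+1)]: it gets finer and larger at the same time, and stays finite. *)
Definition gridT k : finType := ('I_(k.+1 ^ 2) * 'I_((k.+1 ^ 2).*2))%type.

Definition gridpos k (z : gridT k) : R * R :=
  (mesh k * z.1%:R, mesh k * (z.2%:R - (k.+1 ^ 2)%:R)).

(** The constant of the triangle inequality in [near_sector]: a jump differs from the difference of
    the cell corners by at most [2 * d], and the starting point is within [(2 / t + 2) * d] of the
    apex of the enlarged sector. *)
Definition slack : R := 2 / t + 4.

(** The margin [d] in both coordinates puts every difference between a point of the cell at [p] and
    a point of the cell at the origin into the cone; see [good_step]. *)
Definition good (d : R) (p : R * R) : bool := `|p.2| + d <= (p.1 - d) * t.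

(** The term [lambda * d ^+ 2] comes from the Poisson probability of exactly one point in a cell,
    the other one from the void probability of the enlarged sector. *)
Definition stepdens d (p : R * R) : R :=
  expR (- lambda * d ^+ 2 - lambda * theta * (enorm p + slack * d) ^+ 2).

(* A lower bound for the probability that the walk, sitting anywhere in the cell
   at the origin, jumps into the cell at [z]: that cell contains exactly one point
   and the rest of a sector with radius enlarged by [slack] mesh sizes, which
   covers the cone seen from every possible starting point, contains none. *)
Definition stepw k (z : gridT k) : R :=
  if good (mesh k) (gridpos z) then
    lambda * mesh k ^+ 2 * stepdens (mesh k) (gridpos z)
  else 0.

(** Generating function of the defective step law [stepw]. At [g = (0, 0)] it is the total mass, at
    most 1 by [dmgf_le] and [mgf0]. *)
Definition dmgf k (g : R * R) : R := \sum_(z : gridT k) stepw z * expR (dot g (gridpos z)).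

Lemma mesh_gt0 k : 0 < mesh k. Proof. by rewrite invr_gt0. Qed.

Lemma slack_ge4 : 4 <= slack.
Proof. by rewrite /slack lerDr divr_ge0// ltW// slope_gt0. Qed.

Lemma stepw_ge0 k (z : gridT k) : 0 <= stepw z.
Proof.
rewrite /stepw; case: ifP => // _.
by apply: mulr_ge0; [apply: mulr_ge0; [exact: ltW|exact: sqr_ge0]|exact: expR_ge0].
Qed.

Lemma natr_lt_disj (m n : nat) (d b x : R) : 0 < d ->
  b + d * m%:R <= x < b + d * m%:R + d -> b + d * n%:R <= x < b + d * n%:R + d -> m = n.
Proof.
move=> d0 /andP[h1 h2] /andP[h3 h4].
have aux (i j : nat) : b + d * i%:R < b + d * j%:R + d -> (i <= j)%N.
  have -> : b + d * j%:R + d = b + d * j.+1%:R by rewrite -natr1; ring.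
  by rewrite ltrD2l ltr_pM2l// ltr_nat ltnS.
by apply/eqP; rewrite eqn_leq !aux// ?(le_lt_trans h1)// (le_lt_trans h3).
Qed.

Lemma gridpos_disj k (b : R * R) (z z' : gridT k) : z != z' ->
  cell (mesh k) (b + gridpos z) `&` cell (mesh k) (b + gridpos z') = set0.
Proof.
move=> zz; rewrite -subset0 => q [/cellP[h1 h2] /cellP[h3 h4]]; apply/negP: zz; rewrite negbK.
case: z z' h1 h2 h3 h4 => [i j] [i' j'] /= h1 h2 h3 h4; apply/eqP; congr (_, _).
  by apply/val_inj/(natr_lt_disj (mesh_gt0 k) h1 h3).
set c := mesh k * (k.+1 ^ 2)%:R in h2 h4.
by apply/val_inj/(@natr_lt_disj _ _ (mesh k) (b.2 - c) q.2 (mesh_gt0 k)) => /=;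
   [move: h2|move: h4]; rewrite /gridpos/= mulrBr -/c addrA addrAC.
Qed.

Lemma gridpos_disj0 k (z z' : gridT k) : z != z' ->
  cell (mesh k) (gridpos z) `&` cell (mesh k) (gridpos z') = set0.
Proof. by move=> /(gridpos_disj 0); rewrite !add0r. Qed.

Lemma good_cone d p e : good d p -> 0 <= e.1 -> `|e.2| <= d -> 0 < d -> cone t (p + e).
Proof.
rewrite /good /cone/= => gp e1 e2 d0; have t0 := slope_gt0 thetaP.
rewrite (le_lt_trans (ler_normD _ _))//.
rewrite (@le_lt_trans _ _ ((p.1 - d) * t))// ?(le_trans _ gp) ?lerD//.
by rewrite ltr_pM2r//; lra.
Qed.

(** [slack * d] exceeds the diameter of a cell, so [stepdens] stays below the Gaussian on the whole
    cell; the exponential factor pays for the variation of [dot g] there. *)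
Lemma dmgf_le k g : dmgf k g <= expR (gnorm g * mesh k) * mgf g.
Proof.
have d0 := mesh_gt0 k; set d := mesh k in d0 *.
rewrite mulrC -ler_pdivrMr ?expR_gt0// -expRN.
have lt0 := lambda_theta_gt0 lambda0 thetaP.
apply: le_trans (@sum_cells_le d (gridT k) (fun z => good d (gridpos z)) (@gridpos k) d0
   _ (fun z => expR (- (gnorm g * d)) * (stepdens d (gridpos z) * expR (dot g (gridpos z)))) g _ _).
- rewrite /dmgf mulr_suml mulr_sumr [X in _ <= X]big_mkcond/=; apply: ler_sum => z _.
  rewrite /stepw -/d; case: ifP => _; last by rewrite !mul0r.
  by rewrite le_eqVlt; apply/orP; left; apply/eqP; ring.
- by move=> x y _ _; exact: gridpos_disj0.
- by move=> z _; rewrite !mulr_ge0// expR_ge0.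
- move=> z p gz /cell_offset[e [-> /andP[e1 e1d] /andP[e2 e2d]]]; split.
    by apply: good_cone gz _ _ _ => //; rewrite ger0_norm// ltW.
  have ed : `|dot g e| <= gnorm g * d by rewrite dot_le// ger0_norm// ltW.
  rewrite /stepdens /gauss -!expRD ler_expR dotD -sqr_enorm.
  have : lambda * theta * enorm (gridpos z + e) ^+ 2 <= lambda * theta * (enorm (gridpos z) + slack * d) ^+ 2.
    have sd : 0 <= slack * d by rewrite mulr_ge0 ?(le_trans _ slack_ge4)// ltW.
    rewrite ler_pM2l// ler_pXn2r ?nnegrE ?addr_ge0 ?enorm_ge0//.
    rewrite (le_trans (enorm_triangle _ _))// lerD2l (le_trans (enorm_le1 _))//.
    rewrite !ger0_norm//; have := slack_ge4; nra.
  have : 0 <= lambda * d ^+ 2 by rewrite mulr_ge0 ?sqr_ge0// ltW.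
  move: ed; rewrite ler_norml => /andP[ed _]; lra.
Qed.

(** A minorant of [stepdens d q * expR (dot g q)] expressed through any point [p] of the cell at
    [q]: the corner satisfies [enorm q <= enorm p + 2 * d], whence [slack + 2], and [gnorm g * d]
    bounds the variation of [dot g]. *)
Definition lowdens d g p : R :=
  expR (- lambda * d ^+ 2 - lambda * theta * (enorm p + (slack + 2) * d) ^+ 2 +
     dot g p - gnorm g * d).

(** Twice the margin of [good], because the corner of the cell containing [p] may be one mesh away
    from [p] in each coordinate. *)
Definition lowset k : set (R * R) :=
  [set p | `|p.2| + 2 * mesh k <= (p.1 - 2 * mesh k) * t] `&` [set p | p.1 < k.+1%:R].

Lemma measurable_enorm : measurable_fun setT enorm.
Proof.
apply: (measurableT_comp (continuous_measurable_fun (@sqrt_continuous R))).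
by rewrite /sqnorm; mfun.
Qed.

Lemma measurable_lowdens d g : measurable_fun setT (lowdens d g).
Proof. by have me := measurable_enorm; rewrite /lowdens /dot; mfun. Qed.

Lemma measurable_lowset k : measurable (lowset k).
Proof.
by apply: measurableI; [apply: measurable_set_le; mfun|apply: measurable_set_lt; mfun].
Qed.

Lemma lowset_cone k : lowset k `<=` cone t.
Proof.
move=> p [/= h1 _]; rewrite /cone/=; have t0 := slope_gt0 thetaP; have d0 := mesh_gt0 k.
have : 0 < mesh k * t by rewrite mulr_gt0.
rewrite mulrBl in h1; lra.
Qed.

Lemma cone_pos p : cone t p -> 0 < p.1 /\ `|p.2| < p.1.
Proof.
rewrite /cone/= => pc; have t0 := slope_gt0 thetaP; have t1 := slope_le1 thetaP.
have p0 : 0 < p.1 * t by exact: le_lt_trans pc.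
have {}p0 : 0 < p.1 by move: p0; rewrite pmulr_lgt0.
by split => //; rewrite (lt_le_trans pc)// ler_piMr// ltW.
Qed.

(** The cone has slope at most 1, so [p.1 < k+1] bounds [p.2] too, and the truncated coordinates of
    [p] are valid indices. *)
Lemma lowset_cover k p : lowset k p ->
  exists2 z : gridT k, good (mesh k) (gridpos z) & cell (mesh k) (gridpos z) p.
Proof.
move=> pl; have [p0 p12] := cone_pos (lowset_cone pl); case: pl => /= h1 h2.
have d0 := mesh_gt0 k.
have dk : mesh k * k.+1%:R = 1 by rewrite mulVf.
set N := (k.+1 ^ 2)%N.
have dN : mesh k * N%:R = k.+1%:R by rewrite natrX expr2 mulrA dk mul1r.
have x0 : 0 <= p.1 * k.+1%:R by rewrite mulr_ge0// ltW.
have y0 : 0 <= p.2 * k.+1%:R + N%:R.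
  have : - k.+1%:R <= p.2 by move: (ler_norm (- p.2)); rewrite normrN; lra.
  move=> /(ler_wpM2r (ler0n R k.+1)); rewrite natrX expr2; lra.
have xN : (Num.trunc (p.1 * k.+1%:R) < N)%N.
  rewrite -(ltr_nat R) (@le_lt_trans _ _ (p.1 * k.+1%:R)) ?truncn_le//.
  by rewrite natrX expr2 ltr_pM2r.
have yN : (Num.trunc (p.2 * k.+1%:R + N%:R) < N.*2)%N.
  rewrite -(ltr_nat R) (@le_lt_trans _ _ (p.2 * k.+1%:R + N%:R)) ?truncn_le//.
  rewrite -addnn natrD ltrD2r natrX expr2 ltr_pM2r//.
  by rewrite (le_lt_trans (ler_norm _))// (lt_trans p12).
pose z : gridT k := (Ordinal xN, Ordinal yN).
have cz : cell (mesh k) (gridpos z) p.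
  have /andP[a1 a2] := truncn_itv x0; have /andP[b1 b2] := truncn_itv y0.
  have E y : mesh k * (y * k.+1%:R) = y by rewrite mulrCA dk mulr1.
  apply/cellP; rewrite /gridpos/=.
  rewrite -[X in _ < X]natr1 in a2; rewrite -[X in _ < X]natr1 in b2.
  split; apply/andP; split.
  - by rewrite -[X in _ <= X]E ler_pM2l.
  - by rewrite -[X in X < _]E -[X in _ + X](mulr1 (mesh k)) -mulrDr ltr_pM2l.
  - by rewrite -[X in _ <= X]E ler_pM2l// lerBlDr.
  - by rewrite -[X in X < _]E -[X in _ + X](mulr1 (mesh k)) -mulrDr ltr_pM2l// addrAC ltrBrDr.
exists z => //; have /cellP[/andP[c1 c2] /andP[c3 c4]] := cz.
have t0 := slope_gt0 thetaP.
rewrite /good (@le_trans _ _ (`|p.2| + 2 * mesh k))//.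
  have : `|(gridpos z).2| <= `|p.2| + `|(gridpos z).2 - p.2|.
    by rewrite -{1}(subrK p.2 (gridpos z).2) addrC (le_trans (ler_normD _ _)).
  have : `|(gridpos z).2 - p.2| <= mesh k by rewrite ler_norml; lra.
  lra.
rewrite (le_trans h1)// ler_wpM2r// ?ltW//; lra.
Qed.

Lemma dmgf_ge k g :
  ((\int[mu \x mu]_(p in lowset k) (lowdens (mesh k) g p)%:E) <= (dmgf k g / lambda)%:E)%E.
Proof.
have d0 := mesh_gt0 k; set d := mesh k in d0 *.
have lt0 := lambda_theta_gt0 lambda0 thetaP.
apply: le_trans (@sum_cells_ge d (gridT k) (fun z => good d (gridpos z)) (@gridpos k) d0
   _ (fun z => stepdens d (gridpos z) * expR (dot g (gridpos z))) (lowdens d g) (lowset k) _ _ _ _ _) _.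
- by move=> x y _ _; exact: gridpos_disj0.
- exact: measurable_lowset.
- exact: measurable_lowdens.
- by move=> p; exact: expR_ge0.
- by move=> p /lowset_cover.
- move=> z p gz /cell_offset[e [-> /andP[e1 e1d] /andP[e2 e2d]]].
  have ed : `|dot g e| <= gnorm g * d by rewrite dot_le// ger0_norm// ltW.
  rewrite /stepdens /lowdens -!expRD ler_expR dotD.
  have : lambda * theta * (enorm (gridpos z) + slack * d) ^+ 2 <=
     lambda * theta * (enorm (gridpos z + e) + (slack + 2) * d) ^+ 2.
    have s4 := slack_ge4.
    have sd : 0 <= slack * d by rewrite mulr_ge0 ?(le_trans _ slack_ge4)// ltW.
    have sd2 : 0 <= (slack + 2) * d by rewrite mulrDl addr_ge0// mulr_ge0// ltW.
    rewrite ler_pM2l// ler_pXn2r ?nnegrE ?addr_ge0 ?enorm_ge0//.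
    have : enorm (gridpos z) <= enorm (gridpos z + e) + enorm e.
      by rewrite -{1}(addrK e (gridpos z)) (le_trans (enorm_triangle _ _))// enormN.
    have : enorm e <= d + d by rewrite (le_trans (enorm_le1 _))// !ger0_norm// lerD// ltW.
    lra.
  move: ed; rewrite ler_norml => /andP[_ ed]; lra.
- rewrite lee_fin /dmgf mulr_suml [X in X <= _]big_mkcond/=; apply: ler_sum => z _.
  rewrite /stepw -/d; case: ifP => _; last by rewrite !mul0r.
  rewrite le_eqVlt; apply/orP; left; apply/eqP.
  by field; rewrite gt_eqF.
Qed.

End grid.

(** * Convergence of the grid sums; convexity and coercivity of the tilted generating function *)

Section limits.
Context {R : realType}.
Local Notation mu := (@lebesgue_measure R).
Variables lambda theta : R.
Hypotheses (lambda0 : 0 < lambda) (thetaP : 0 < theta <= pi / 4).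
Local Notation t := (tan theta).
Local Notation gauss := (gauss lambda theta).
Local Notation mgf := (mgf lambda theta).
Local Notation mesh := (@mesh R).
Local Notation gridpos := (@gridpos R _).
Local Notation slack := (slack theta).
Local Notation stepw := (stepw lambda theta).
Local Notation dmgf := (dmgf lambda theta).
Local Notation lowdens := (lowdens lambda theta).
Local Notation lowset := (lowset theta).
Local Notation mesh_gt0 := (@mesh_gt0 R).

Lemma cvg_mesh : mesh k @[k --> \oo] --> 0.
Proof. exact: cvg_harmonic. Qed.

Lemma lowdens_le k g p : cone t p -> lowdens (mesh k) g p <= gauss g p.
Proof.
move=> pc; have d0 := mesh_gt0 k; have s4 := slack_ge4 thetaP.
have lt0 := lambda_theta_gt0 lambda0 thetaP.
rewrite /lowdens /gauss ler_expR -sqr_enorm.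
have : lambda * theta * enorm p ^+ 2 <= lambda * theta * (enorm p + (slack + 2) * mesh k) ^+ 2.
  have sd2 : 0 <= (slack + 2) * mesh k by rewrite mulr_ge0 ?ltW//; lra.
  by rewrite ler_pM2l// ler_pXn2r ?nnegrE ?addr_ge0 ?enorm_ge0// lerDl.
have : 0 <= gnorm g * mesh k by rewrite mulr_ge0 ?gnorm_ge0// ltW.
have : 0 <= lambda * mesh k ^+ 2 by rewrite mulr_ge0 ?sqr_ge0// ltW.
lra.
Qed.

Lemma near_lowset p : cone t p -> \forall k \near \oo, lowset k p.
Proof.
move=> pc; have t0 := slope_gt0 thetaP.
(* The mesh size at which the margin inequality of [lowset] becomes an equality at [p]. *)
have e0 : 0 < (p.1 * t - `|p.2|) / (2 * (1 + t)).
  by rewrite divr_gt0 ?subr_gt0// mulr_gt0// addr_gt0.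
near=> k; split => /=.
- have : mesh k < (p.1 * t - `|p.2|) / (2 * (1 + t)).
    near: k; have /cvgrPdist_lt/(_ _ e0) := cvg_mesh; apply: filterS => k.
    by rewrite sub0r normrN gtr0_norm// mesh_gt0.
  by rewrite ltr_pdivlMr ?mulr_gt0 ?addr_gt0//; lra.
- have : p.1 < k%:R by near: k; exact: nbhs_infty_gtr.
  by move=> /lt_trans; apply; rewrite ltr_nat.
Unshelve. all: by end_near. Qed.
Lemma cvg_lowdens g p : lowdens (mesh k) g p @[k --> \oo] --> gauss g p.
Proof.
have -> : gauss g p = lowdens 0 g p.
  rewrite /gauss /lowdens -sqr_enorm; congr expR; ring.
apply: (@cvg_comp _ _ _ mesh (fun d => lowdens d g p)); first exact: cvg_mesh.
rewrite /lowdens; apply: continuous_cvg; first exact: continuous_expR.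
have c2 (c : R) : (fun d : R => d ^+ 2) d @[d --> c] --> c ^+ 2 by apply: exprn_continuous.
apply: cvgB; last by apply: cvgM; [exact: cvg_cst|exact: cvg_id].
apply: cvgD; last exact: cvg_cst.
apply: cvgB; (apply: (@cvgM _ _ _ _ (fun=> _)); first exact: cvg_cst).
  exact: c2.
apply: (@cvg_comp _ _ _ (fun d => enorm p + (slack + 2) * d) (fun d => d ^+ 2)); last exact: c2.
apply: cvgD; first exact: cvg_cst.
by apply: (@cvgM _ _ _ _ (fun=> _)); [exact: cvg_cst|exact: cvg_id].
Qed.

Lemma cvg_integral_low g :
  (\int[mu \x mu]_(p in lowset k) (lowdens (mesh k) g p)%:E @[k --> \oo] -->
   (mgf g / lambda)%:E)%E.
Proof.
rewrite -mgfE//.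
have mc := @measurable_cone R t.
pose f k p : \bar R := if p \in lowset k then (lowdens (mesh k) g p)%:E else 0%E.
rewrite (_ : (fun _ => _) = (fun k => \int[mu \x mu]_(p in cone t) f k p)%E); last first.
  apply/funext => k; rewrite [LHS]integral_mkcond [RHS]integral_mkcond.
  apply: eq_integral => p _; rewrite !patchE /f.
  case: ifPn; first by rewrite inE => /(lowset_cone thetaP) pc; rewrite mem_set.
  by move=> pl; case: ifP.
refine (let: And3 _ _ H := @dominated_convergence _ _ R (mu \x mu)%E (cone t) mc f (fun p => (gauss g p)%:E)
  (fun p => (gauss g p)%:E) _ _ _ _ _ in H).
- move=> k; rewrite /f; apply: measurable_funTS; apply: measurable_fun_ifT => //.
    apply: (measurable_fun_bool true).
    rewrite setTI (_ : _ @^-1` _ = lowset k); first exact: measurable_lowset.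
    by apply/seteqP; split => p; [exact: set_mem|exact: mem_set].
  by apply/measurable_EFinP; exact: measurable_lowdens.
- by apply/measurable_EFinP; apply: measurable_funTS; exact: measurable_gauss.
- apply: aeW => p pc.
  apply: (cvg_trans (near_eq_cvg (_ : {near \oo, (fun k => (lowdens (mesh k) g p)%:E) =1 f ^~ p}))).
    by apply: filterS (near_lowset pc) => k pl; rewrite /f mem_set.
  by apply/cvg_EFin; [exact: nearW|exact: cvg_lowdens].
- exact: integrable_gauss.
- apply: aeW => p k pc; rewrite /f; case: ifP => _.
    by rewrite abse_EFin ger0_norm ?expR_ge0// lee_fin lowdens_le.
  by rewrite abse0 lee_fin expR_ge0.
Qed.

(** Squeezed between [dmgf_le] and [dmgf_ge], whose integrals converge by domination by [gauss g].
    Through this limit, inequalities between finite sums of exponentials carry over to [mgf]. *)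
Lemma cvg_dmgf g : dmgf k g @[k --> \oo] --> mgf g.
Proof.
have h1 : expR (gnorm g * mesh k) * mgf g @[k --> \oo] --> mgf g.
  rewrite -[X in _ --> X]mul1r -expR0; apply: cvgM; last exact: cvg_cst.
  apply: continuous_cvg; first exact: continuous_expR.
  rewrite -(mulr0 (gnorm g)); apply: cvgM; [exact: cvg_cst|exact: cvg_mesh].
pose I k : \bar R := (\int[mu \x mu]_(p in lowset k) (lowdens (mesh k) g p)%:E)%E.
have I0 k : (0 <= I k)%E by apply: integral_ge0 => p _; rewrite lee_fin expR_ge0.
have Ile k : (I k <= (dmgf k g / lambda)%:E)%E by exact: dmgf_ge.
have Ifin k : (I k = (fine (I k))%:E).
  by rewrite fineK// ge0_fin_numE// (le_lt_trans (Ile k))// ltry.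
have h2 : lambda * fine (I k) @[k --> \oo] --> mgf g.
  rewrite (_ : mgf g = lambda * (mgf g / lambda)); last by field; rewrite gt_eqF.
  apply: cvgM; first exact: cvg_cst.
  by apply: fine_cvg; exact: cvg_integral_low.
apply: (squeeze_cvgr _ h2 h1); apply: nearW => k; rewrite dmgf_le// andbT.
by rewrite mulrC -ler_pdivlMr// -lee_fin -Ifin.
Qed.

Lemma cvg_le_seq (u v : nat -> R) a b : u k @[k --> \oo] --> a -> v k @[k --> \oo] --> b ->
  (forall k, u k <= v k) -> a <= b.
Proof. by move=> ua vb uv; apply: (ler_cvg_to ua vb); exact: nearW. Qed.

(* [tilt u g = exp (- (g . u - J g))]: the Legendre transform at [u] is minus the
   logarithm of the infimum of [tilt u]. *)
Definition tilt (u g : R * R) : R := mgf g * expR (- dot g u).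
Definition dtilt (u g : R * R) k : R := \sum_(z : gridT k) stepw z * expR (dot g (gridpos z - u)).

Lemma dtiltE u g k : dtilt u g k = dmgf k g * expR (- dot g u).
Proof.
rewrite /dtilt mulr_suml; apply: eq_bigr => z _.
rewrite -mulrA -expRD; congr (_ * expR _); rewrite /dot/=; ring.
Qed.

Lemma cvg_dtilt u g : dtilt u g k @[k --> \oo] --> tilt u g.
Proof.
rewrite (_ : dtilt u g = (fun k => dmgf k g * expR (- dot g u))); last exact/funext/dtiltE.
by apply: cvgM; [exact: cvg_dmgf|exact: cvg_cst].
Qed.

Definition along (g e : R * R) (s : R) : R * R := (g.1 + s * e.1, g.2 + s * e.2).

(* Second differences replace second derivatives of the moment generating
   function: they dominate the increments near an approximate minimizer, and no
   differentiation under the integral sign is needed. *)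
Definition diff2 (u g e : R * R) (s : R) : R :=
  tilt u (along g e s) + tilt u (along g e (- s)) - 2 * tilt u g.

Lemma dot_along g e s p : dot (along g e s) p = dot g p + s * dot e p.
Proof. by rewrite /dot/=; ring. Qed.

(** With [y = expR (b / 2)] the difference of the two sides is the square of [(y - 1) ^+ 2 / y]. *)
Lemma cosh_half (b : R) : 4 * (expR (b / 2) + expR (- (b / 2)) - 2) <= expR b + expR (- b) - 2.
Proof.
have := expR_gt0 (b / 2); set y := expR (b / 2) => y0.
have -> : expR (- (b / 2)) = y^-1 by rewrite expRN.
rewrite expRN; have -> : expR b = y ^+ 2 by rewrite expr2 -expRD -splitr.
rewrite -subr_ge0.
have -> : y ^+ 2 + (y ^+ 2)^-1 - 2 - 4 * (y + y^-1 - 2) = ((y - 1) ^+ 2 / y) ^+ 2.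
  by field; rewrite gt_eqF.
exact: sqr_ge0.
Qed.

(** On the grid each term of the second difference is a nonnegative weight times
    [expR (s * b) + expR (- (s * b)) - 2], to which [cosh_half] applies. Iterated, this gives a
    quadratic bound along the steps [2 ^- n]. *)
Lemma diff2_half u g e s : 4 * diff2 u g e (s / 2) <= diff2 u g e s.
Proof.
pose dd s k := dtilt u (along g e s) k + dtilt u (along g e (- s)) k - 2 * dtilt u g k.
have cd s' : dd s' k @[k --> \oo] --> diff2 u g e s'.
  apply: cvgB; first by apply: cvgD; exact: cvg_dtilt.
  by apply: cvgM; [exact: cvg_cst|exact: cvg_dtilt].
have cd4 : 4 * dd (s / 2) k @[k --> \oo] --> 4 * diff2 u g e (s / 2).
  by apply: cvgM; [exact: cvg_cst|exact: cd].
apply: (cvg_le_seq cd4 (cd s)) => k; rewrite /dd /dtilt.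
rewrite !mulr_sumr -!big_split/= -!sumrB mulr_sumr; apply: ler_sum => z _.
rewrite !dot_along !(expRD (dot g _)).
set x := expR (dot g _); set b := dot e _.
have -> : 4 * (stepw z * (x * expR (s / 2 * b)) + stepw z * (x * expR (- (s / 2) * b)) -
   2 * (stepw z * x)) = stepw z * x * (4 * (expR ((s * b) / 2) + expR (- ((s * b) / 2)) - 2)).
  rewrite mulNr (_ : s / 2 * b = s * b / 2); ring.
have -> : stepw z * (x * expR (s * b)) + stepw z * (x * expR (- s * b)) -
   2 * (stepw z * x) = stepw z * x * (expR (s * b) + expR (- (s * b)) - 2).
  rewrite mulNr; ring.
by apply: ler_wpM2l; rewrite ?cosh_half// mulr_ge0 ?expR_ge0// stepw_ge0.
Qed.

Lemma diff2_pow u g e n : 4 ^+ n * diff2 u g e (2 ^- n) <= diff2 u g e 1.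
Proof.
elim: n => [|n IH]; first by rewrite !expr0 invr1 mul1r.
apply: le_trans IH; rewrite exprSr -mulrA ler_wpM2l ?exprn_ge0//.
by rewrite exprSr invfM; exact: diff2_half.
Qed.

Lemma tilt_ge0 u g : 0 <= tilt u g.
Proof.
apply: (@cvg_le_seq (fun=> 0) _ _ _ (cvg_cst _) (@cvg_dtilt u g)) => k.
by apply: sumr_ge0 => z _; rewrite mulr_ge0 ?expR_ge0 ?stepw_ge0.
Qed.

Lemma expR_le_cosh (a b x : R) : `|a| <= b -> expR (a * x) <= expR (b * x) + expR (- b * x).
Proof.
rewrite ler_norml => /andP[ab ba]; have [x0|x0] := leP 0 x.
  by rewrite (le_trans _ (_ : expR (b * x) <= _)) ?lerDl ?expR_ge0// ler_expR ler_wpM2r.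
by rewrite (le_trans _ (_ : expR (- b * x) <= _)) ?lerDr ?expR_ge0// ler_expR ler_wnM2r// ltW.
Qed.

(** On the grid each exponential is a product over the two coordinates; bounding each factor by its
    values at [G] and [- G] and expanding gives the four corners. *)
Lemma tilt_box u g (G : R) : `|g.1| <= G -> `|g.2| <= G ->
  tilt u g <= tilt u (G, G) + tilt u (G, - G) + tilt u (- G, G) + tilt u (- G, - G).
Proof.
move=> g1 g2; apply: (cvg_le_seq (@cvg_dtilt u g) (cvgD (cvgD (cvgD (@cvg_dtilt u _) (@cvg_dtilt u _)) (@cvg_dtilt u _)) (@cvg_dtilt u _))) => k.
rewrite -[leRHS]/(dtilt u (G, G) k + dtilt u (G, - G) k + dtilt u (- G, G) k + dtilt u (- G, - G) k).
rewrite /dtilt -!big_split/=; apply: ler_sum => z _.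
rewrite -!mulrDr ler_wpM2l ?stepw_ge0// /dot !expRD.
have := expR_le_cosh (gridpos z - u).1 g1; have := expR_le_cosh (gridpos z - u).2 g2.
have := expR_ge0 (g.1 * (gridpos z - u).1); have := expR_ge0 (g.2 * (gridpos z - u).2).
rewrite /=; set a := expR (g.1 * _); set b := expR (g.2 * _).
set a1 := expR (G * _); set a2 := expR (- G * _); set b1 := expR _; set b2 := expR _ => *.
rewrite (@le_trans _ _ ((b1 + b2) * (a1 + a2)))//; first exact: ler_pM.
by rewrite le_eqVlt; apply/orP; left; apply/eqP; rewrite /=; ring.
Qed.

(** Since [u] is interior to the cone, so is a small cell next to [u] on the side towards which [g]
    points. On it [g . (p - u)] is at least [c * gnorm g], while the untilted density is bounded
    below uniformly in [g]. *)
Lemma tilt_coercive u : `|u.2| < u.1 * t -> exists m c : R,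
  [/\ 0 < m, 0 < c & forall g, m * expR (c * gnorm g) <= tilt u g].
Proof.
move=> uc; have t0 := slope_gt0 thetaP; have t1 := slope_le1 thetaP.
(* The cell stays within [2 * c] of [u] in each coordinate; as the slope is at most 1, this costs at
   most [4 * c] of the [8 * c] available in the cone inequality. *)
pose c := (u.1 * t - `|u.2|) / 8.
have c0 : 0 < c by rewrite divr_gt0// subr_gt0.
have c8 : 8 * c = u.1 * t - `|u.2| by rewrite /c; field.
have c20 : 0 <= 2 * c by rewrite mulr_ge0// ltW.
clearbody c.
pose W : R := (`|u.1| + 2 * c) ^+ 2 + (`|u.2| + 2 * c) ^+ 2.
exists (lambda * (expR (- (lambda * theta) * W) * c ^+ 2)), c; split => //.
  by rewrite mulr_gt0// mulr_gt0 ?expR_gt0 ?exprn_gt0.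
move=> g; rewrite /tilt expRN ler_pdivlMr ?expR_gt0//.
pose corner (a b : R) := if 0 <= a then b + c else b - 2 * c.
have cornerP (a b x : R) : corner a b <= x < corner a b + c ->
    `|x - b| <= 2 * c /\ c * `|a| <= a * (x - b).
  rewrite /corner; case: ifPn => [a0|/negbTE a0] /andP[h1 h2].
    split; first by rewrite ler_norml; apply/andP; split; lra.
    by rewrite ger0_norm// mulrC ler_wpM2l//; lra.
  have {}a0 : a < 0 by rewrite ltNge a0.
  split; first by rewrite ler_norml; apply/andP; split; lra.
  by rewrite ltr0_norm// mulrN -mulNr mulrC ler_wnM2l ?ltW//; lra.
have := @sum_cells_le _ _ _ lambda0 thetaP c unit xpredT (fun=> (corner g.1 u.1, corner g.2 u.2)) c0 _
  (fun=> expR (- (lambda * theta) * W + dot g u + c * gnorm g)) g.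
rewrite big_const card_unit/= addr0 => H.
apply: le_trans (H _ _ _); first by rewrite !expRD le_eqVlt; apply/orP; left; apply/eqP; ring.
- by case=> -[].
- by move=> *; exact: expR_ge0.
- move=> _ q _ /cellP[/= /cornerP[h1 h2] /cornerP[h3 h4]].
  split.
    rewrite /cone/=.
    have : `|q.2| <= `|u.2| + 2 * c.
      by rewrite -{1}(subrK u.2 q.2) (le_trans (ler_normD _ _))// addrC lerD2l.
    have : (u.1 - 2 * c) * t <= q.1 * t.
      rewrite ler_wpM2r// ?(ltW t0)//; move: h1; rewrite ler_norml => /andP[h1' _].
      by move: h1'; clear; lra.
    have : c * t <= c by rewrite ler_piMr// ltW.
    by rewrite mulrBl; move: c0 c8; clear; lra.
  rewrite /gauss ler_expR -addrA lerD//.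
    rewrite !mulNr lerN2 ler_pM2l ?lambda_theta_gt0// /sqnorm /W lerD//.
      rewrite -real_normK ?num_real// ler_pXn2r ?nnegrE ?addr_ge0//.
      by rewrite -{1}(subrK u.1 q.1) (le_trans (ler_normD _ _))// addrC lerD2l.
    rewrite -real_normK ?num_real// ler_pXn2r ?nnegrE ?addr_ge0//.
    by rewrite -{1}(subrK u.2 q.2) (le_trans (ler_normD _ _))// addrC lerD2l.
  by rewrite /dot /gnorm; move: h2 h4; clear; lra.
Qed.

Lemma mgf_gt0 g : 0 < mgf g.
Proof.
have : `|((1, 0) : R * R).2| < ((1, 0) : R * R).1 * t by rewrite /= normr0 mul1r slope_gt0.
move=> /tilt_coercive[m [c [m0 c0 /(_ g)]]] /(lt_le_trans _) H.
have : 0 < tilt (1, 0) g by apply: H; rewrite mulr_gt0// expR_gt0.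
by rewrite /tilt pmulr_lgt0// expR_gt0.
Qed.

(** Dominated convergence under [gauss (0, 0)]. The ray through [(-1, 0)] will limit the number of
    steps before time [t]; a normal of the cone will make the Legendre transform infinite off the
    open cone. *)
Lemma cvg_mgf_ray g0 : (forall p, cone t p -> dot g0 p < 0) ->
  mgf (n%:R * g0.1, n%:R * g0.2) @[n --> \oo] --> 0.
Proof.
move=> g0P; have mc := @measurable_cone R t.
pose f n p := (gauss (n%:R * g0.1, n%:R * g0.2) p)%:E.
have fE n p : gauss (n%:R * g0.1, n%:R * g0.2) p = gauss (0, 0) p * expR (- (- dot g0 p * n%:R)).
  by rewrite /gauss -expRD /dot/=; congr expR; ring.
have cI : (\int[mu \x mu]_(p in cone t) f n p @[n --> \oo] --> (0 : R)%:E)%E.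
  have -> : (0 : R)%:E = (\int[mu \x mu]_(p in cone t) (0 : R)%:E)%E by rewrite integral0.
  refine (let: And3 _ _ H := @dominated_convergence _ _ R (mu \x mu)%E (cone t) mc f (fun p => 0%:E)
    (fun p => (gauss (0, 0) p)%:E) _ _ _ _ _ in H).
  - by move=> n; apply/measurable_EFinP; apply: measurable_funTS; exact: measurable_gauss.
  - exact: measurable_cst.
  - apply: aeW => p /g0P pc; apply/cvg_EFin; first exact: nearW.
    rewrite (_ : _ \o _ = fun n => gauss (n%:R * g0.1, n%:R * g0.2) p)//.
    under eq_fun do rewrite fE.
    have cE : expR (- (- dot g0 p * n%:R)) @[n --> \oo] --> (0 : R).
      apply: (@cvg_comp _ _ _ (fun n => n%:R) (fun x : R => expR (- (- dot g0 p * x))) _ (pinfty_nbhs R)).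
        exact: cvgr_idn.
      apply: (@cvg_comp _ _ _ (fun x => - dot g0 p * x) (fun x : R => expR (- x)) _ (pinfty_nbhs R)); last exact: cvgr_expR.
      by apply: gt0_cvgMry; [rewrite oppr_gt0|exact: cvg_id].
    have := @cvgM _ _ _ _ _ _ _ _ (cvg_cst (gauss (0, 0) p)) cE.
    by rewrite mulr0; apply.
  - exact: integrable_gauss.
  - apply: aeW => p n /g0P pc; rewrite /f abse_EFin ger0_norm ?expR_ge0// lee_fin fE.
    rewrite ler_piMr ?expR_ge0// -expR0 ler_expR oppr_le0 mulr_ge0// oppr_ge0 ltW//.
rewrite -(mulr0 lambda); apply: cvgM; first exact: cvg_cst.
by apply: fine_cvg; exact: cI.
Qed.

End limits.

(** * Scaling of the rate function *)

Section rate_scaling.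
Context {R : realType}.
Local Notation mu := (@lebesgue_measure R).

Lemma integral2_scale (a : R) (f : R * R -> R) : 0 < a -> measurable_fun setT f ->
  (forall p, 0 <= f p) ->
  (\int[mu \x mu]_p (f p)%:E = (a ^+ 2)%:E * \int[mu \x mu]_p (f (a * p.1, a * p.2)%R)%:E)%E.
Proof.
move=> a0 mf f0.
pose h p := f (a * p.1, a * p.2).
have mh : measurable_fun setT h by apply: (measurableT_comp mf); mfun.
have mFf : measurable_fun setT (fun x => \int[mu]_y (f (x, y))%:E)%E.
  by apply: (@measurable_fun_fubini_tonelli_F _ _ _ _ R mu (EFin \o f)); [exact/measurable_EFinP|move=> p; rewrite lee_fin].
have mFh : measurable_fun setT (fun x => \int[mu]_y (h (x, y))%:E)%E.
  by apply: (@measurable_fun_fubini_tonelli_F _ _ _ _ R mu (EFin \o h)); [exact/measurable_EFinP|move=> p; rewrite lee_fin /h].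
transitivity (\int[mu]_x fubini_F mu (EFin \o f) x)%E.
  by apply: fubini_tonelli1; [exact/measurable_EFinP|move=> p; rewrite lee_fin].
transitivity ((a ^+ 2)%:E * \int[mu]_x fubini_F mu (EFin \o h) x)%E; last first.
  congr (_ * _)%E; apply/esym; apply: fubini_tonelli1; [exact/measurable_EFinP|by move=> p; rewrite lee_fin /h].
rewrite (@integral_scale _ a (fubini_F mu (EFin \o f)))//; last first.
  by move=> x; apply: integral_ge0 => y _; rewrite lee_fin.
rewrite expr2 EFinM -muleA; congr (_ * _)%E.
rewrite -ge0_integralZl_EFin//; last 2 first.
- by move=> x _; apply: integral_ge0 => y _; rewrite lee_fin /h.
- exact: ltW.
apply: eq_integral => x _; rewrite /fubini_F /=.
rewrite (@integral_scale _ a (fun y => (f (a * x, y))%:E))//.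
- by apply/measurable_EFinP; apply: (measurableT_comp mf); exact: pair1_measurable.
- by move=> y; rewrite lee_fin.
Qed.

(** Substitution of [sqrt lambda * p] for [p]: the cone is invariant, and the Jacobian [lambda] is
    the prefactor of [mgf]. *)
Lemma mgf_scale (lambda theta : R) g : 0 < lambda -> 0 < theta <= pi / 4 ->
  mgf lambda theta g = mgf 1 theta (g.1 / Num.sqrt lambda, g.2 / Num.sqrt lambda).
Proof.
move=> lambda0 thetaP; set a := Num.sqrt lambda.
have a0 : 0 < a by rewrite sqrtr_gt0.
have a2 : a ^+ 2 = lambda by rewrite sqr_sqrtr// ltW.
set g' := (_, _); rewrite /mgf mul1r.
pose f (p : R * R) := if `|p.2| < p.1 * tan theta then gauss 1 theta g' p else 0.
have -> : (\int[mu \x mu]_(p in cone (tan theta)) (gauss 1 theta g' p)%:E = \int[mu \x mu]_p (f p)%:E)%E.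
  rewrite integral_mkcond; apply: eq_integral => p _; rewrite patchE /f.
  by case: ifPn => [/set_mem/= ->|/negP pc] //; case: ifPn => // pt; case: pc; rewrite inE.
rewrite (@integral2_scale a f)//; last 2 first.
- by rewrite /f; have mg := measurable_gauss 1 theta g'; mfun.
- by move=> p; rewrite /f; case: ifP => // _; exact: expR_ge0.
have -> : (\int[mu \x mu]_p (f (a * p.1, a * p.2)%R)%:E =
  \int[mu \x mu]_(p in cone (tan theta)) (gauss lambda theta g p)%:E)%E.
  rewrite [RHS]integral_mkcond; apply: eq_integral => p _; rewrite patchE /f/=.
  rewrite normrM gtr0_norm// -mulrA ltr_pM2l//.
  have -> : gauss 1 theta g' (a * p.1, a * p.2) = gauss lambda theta g p.
    rewrite /gauss /sqnorm /dot /g' /= -a2; congr expR; field.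
    by rewrite gt_eqF.
  by case: ifPn => pc; [rewrite mem_set|rewrite memNset//; exact/negP].
by rewrite a2 (mgfE lambda0 thetaP).
Qed.

Opaque mgf.

Lemma LegendreE (lambda theta : R) u : 0 < lambda -> 0 < theta <= pi / 4 ->
  Legendre lambda theta u = ereal_sup [set (dot g u - ln (mgf lambda theta g))%:E | g in [set: R * R]].
Proof.
move=> l0 thP; rewrite /Legendre; congr ereal_sup; apply: eq_imagel => g _.
by rewrite JfunE.
Qed.

Lemma Legendre_scale (lambda theta : R) (u : R * R) : 0 < lambda -> 0 < theta <= pi / 4 ->
  Legendre lambda theta u = Legendre 1 theta (Num.sqrt lambda * u.1, Num.sqrt lambda * u.2).
Proof.
move=> l0 thP; rewrite (LegendreE _ l0 thP) (LegendreE _ ltr01 thP); set a := Num.sqrt lambda.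
have a0 : 0 < a by rewrite sqrtr_gt0.
have an0 : a != 0 by rewrite gt_eqF.
apply: (congr1 (@ereal_sup R)); apply/seteqP; split => _ [g _ <-].
- refine (ex_intro2 _ _ (g.1 / a, g.2 / a) I _); congr (_ - ln _)%:E; last exact/esym/mgf_scale.
  by rewrite /dot/=; field.
- refine (ex_intro2 _ _ (a * g.1, a * g.2) I _); congr (_ - ln _)%:E; first by rewrite /dot/=; ring.
  by apply: etrans (mgf_scale _ l0 thP) _; case: g => ? ?; rewrite -/a /= ![a * _]mulrC !mulfK.
Qed.

(** Putting [sqrt lambda * beta] for [beta] in the infimum cancels the dilation of [Legendre_scale]
    and leaves one factor [sqrt lambda] in front. *)
Lemma rate_scale (lambda theta x : R) : 0 < lambda -> 0 < theta <= pi / 4 ->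
  rate lambda theta x = ((Num.sqrt lambda)%:E * rate 1 theta x)%E.
Proof.
move=> l0 thP; rewrite /rate; set a := Num.sqrt lambda.
have a0 : 0 < a by rewrite sqrtr_gt0.
have an0 : a != 0 by rewrite gt_eqF.
have -> : Legendre lambda theta = (fun u => Legendre 1 theta (a * u.1, a * u.2)).
  by apply/funext => u; exact: Legendre_scale.
move: (Legendre 1 theta) => L.
rewrite -ereal_inf_pZl//; apply: (congr1 (@ereal_inf R)); apply/seteqP; split => _ [b /= b0 <-].
- have bn0 : b != 0 by rewrite gt_eqF.
  exists ((b / a)%:E * L ((b / a)^-1%R, (x / (b / a))%R))%E.
    by exists (b / a) => //; rewrite /= divr_gt0.
  rewrite muleA -EFinM mulrCA divff// mulr1; congr (_ * L (_, _))%E.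
    by field; rewrite an0 bn0.
  by field; rewrite an0 bn0.
- case: b0 => c c0 <-; have cn0 : c != 0 by rewrite gt_eqF.
  exists (a * c); first by rewrite /= mulr_gt0.
  rewrite EFinM -muleA; congr (_ * (_ * L (_, _)))%E.
    by field; rewrite an0 cn0.
  by field; rewrite an0 cn0.
Qed.
End rate_scaling.

(** * Measurability and geometry of the navigation path *)

Section measurable_props.
Context d (T : measurableType d).

Lemma measurable_imp (P Q : T -> Prop) : measurable [set x | P x] ->
  measurable [set x | Q x] -> measurable [set x | P x -> Q x].
Proof.
move=> mP mQ; rewrite (_ : [set x | P x -> Q x] = ~` [set x | P x] `|` [set x | Q x]).
  by apply: measurableU => //; exact: measurableC.
apply/seteqP; split => x /=; last by case=> // + /[swap] => /[apply].
by move=> PQ; have [p|p] := pselect (P x); [right; exact: PQ|left].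
Qed.

Lemma measurable_forall (P : nat -> T -> Prop) : (forall n, measurable [set x | P n x]) ->
  measurable [set x | forall n, P n x].
Proof.
move=> mP; rewrite (_ : [set x | _] = \bigcap_n [set x | P n x]).
  exact: bigcapT_measurable.
by apply/seteqP; split => x /= h n; [move=> _; exact: h|exact: h].
Qed.

Lemma measurable_exists (P : nat -> T -> Prop) : (forall n, measurable [set x | P n x]) ->
  measurable [set x | exists n, P n x].
Proof.
move=> mP; rewrite (_ : [set x | _] = \bigcup_n [set x | P n x]).
  exact: bigcupT_measurable.
by apply/seteqP; split => x /= [n]; [move=> h; exists n|move=> _ h; exists n].
Qed.

Lemma measurable_andP (P Q : T -> Prop) : measurable [set x | P x] ->
  measurable [set x | Q x] -> measurable [set x | P x /\ Q x].
Proof. exact: measurableI. Qed.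

Lemma measurable_orP (P Q : T -> Prop) : measurable [set x | P x] ->
  measurable [set x | Q x] -> measurable [set x | P x \/ Q x].
Proof. exact: measurableU. Qed.

Lemma measurable_preim d' (U : measurableType d') (f : T -> U) (A : set U) :
  measurable_fun setT f -> measurable A -> measurable [set x | A (f x)].
Proof. by move=> mf mA; rewrite -[X in measurable X]setTI; exact: mf. Qed.
End measurable_props.

Lemma xget_singleton (T : choiceType) (x0 p : T) : xget x0 [set p] = p.
Proof. by have /= : [set p] (xget x0 [set p]) by apply: xgetPex; exists p. Qed.

Section enumeration.
Context {R : realType}.
Context d (Omega : measurableType d) (P : probability Omega R).
Variables (lambda : R) (X : Omega -> set (R * R)).
Hypothesis PPP : is_PPP P lambda X.

Lemma measurable_npoints B k : measurable B -> bounded2 B ->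
  measurable [set w | npoints (X w) B = k].
Proof.
move=> mB bB; have [_ /(_ 1%N (fun=> B) (fun=> k))] := PPP.
move=> /(_ (fun=> conj mB bB)) [].
  by move=> i j; rewrite !ord1 eqxx.
move=> + _; congr (measurable _); apply/seteqP; split => w /=; last by move=> ->.
by move=> /(_ ord0).
Qed.

Lemma npoints1 (Y B : set (R * R)) : finite_set (Y `&` B) ->
  npoints Y B = 1%N <-> exists p, Y `&` B = [set p].
Proof.
move=> fin; rewrite /npoints; split => [/eqP/cardfs1P[p Yp]|[p ->]].
  by exists p; rewrite -(fset_setK fin) Yp set_fset1.
by rewrite fset_set1 cardfs1.
Qed.

Lemma npoints0 (Y B : set (R * R)) : finite_set (Y `&` B) ->
  npoints Y B = 0%N <-> Y `&` B = set0.
Proof.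
move=> fin; rewrite /npoints; split => [/eqP|->]; last by rewrite fset_set0 cardfs0.
by rewrite cardfs_eq0 => /eqP Y0; rewrite -(fset_setK fin) Y0 set_fset0.
Qed.

Lemma finite_PPP w B : bounded2 B -> finite_set (X w `&` B).
Proof. by case: PPP => + _; apply. Qed.

Definition box (c : nat * int * int) : set (R * R) :=
  cell (mesh c.1.1) (mesh c.1.1 * c.1.2%:~R, mesh c.1.1 * c.2%:~R).

Lemma bounded_cell (r : R) p : bounded2 (cell r p).
Proof.
exists (`|p.1| + `|p.2| + `|r|) => q /cellP[/andP[h1 h2] /andP[h3 h4]].
have := ler_norm r; have := ler_norm p.1; have := ler_norm p.2.
have := ler_norm (- p.1); have := ler_norm (- p.2); have := normr_ge0 r.
have := normr_ge0 p.1; have := normr_ge0 p.2; rewrite !normrN !ler_norml => *.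
by split; apply/andP; split; lra.
Qed.

Lemma bounded2S (A B : set (R * R)) : A `<=` B -> bounded2 B -> bounded2 A.
Proof. by move=> AB [M MB]; exists M => p /AB; exact: MB. Qed.

(* Only counts of points are random variables a priori; the points themselves
   are recovered as the unique points of the grid boxes containing exactly one. *)
Definition lone (c : option (nat * int * int)) (w : Omega) : R * R :=
  if c is Some c then
    if npoints (X w) (box c) == 1%N then xget (origin R) (X w `&` box c) else origin R
  else origin R.

(** If the box holds a single point, this point lies in [A] exactly when the intersection of the box
    with [A] also holds one point, which is an event about counts. *)
Lemma measurable_lone c : measurable_fun setT (lone c).
Proof.
case: c => [c|]; last exact: measurable_cst.
have bb : bounded2 (box c) by exact: bounded_cell.
have mb : measurable (box c) by exact: measurable_cell.
move=> _ A mA; rewrite setTI.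
have -> : lone (Some c) @^-1` A =
   ([set w | npoints (X w) (box c) = 1%N] `&` [set w | npoints (X w) (box c `&` A) = 1%N]) `|`
   (~` [set w | npoints (X w) (box c) = 1%N] `&` [set w | A (origin R)]).
  have fin w : finite_set (X w `&` (box c `&` A)).
    by apply: finite_PPP; apply: bounded2S bb => p [].
  apply/seteqP; split => w /=.
    rewrite /lone; case: eqP => n1 Aw; last by right.
    left; split => //; have [p Xp] := (npoints1 (finite_PPP w bb)).1 n1.
    apply/npoints1 => //; exists p; rewrite setIA Xp.
    move: Aw; rewrite Xp xget_singleton => Ap.
    by apply/seteqP; split => q //= [->].
  case=> [[n1 n2]|[/eqP n1 Ao]]; rewrite /lone; last by rewrite (negbTE n1).
  rewrite n1 eqxx.
  have [p Xp] := (npoints1 (finite_PPP w bb)).1 n1.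
  have [q] := (npoints1 (fin w)).1 n2; rewrite setIA Xp xget_singleton => pq.
  have : [set q] q by []. 
  by rewrite -pq => -[/= -> ].
apply: measurableU; first by apply: measurableI; apply: measurable_npoints => //;
  [exact: measurableI|apply: bounded2S bb => p []].
apply: measurableI; first by apply: measurableC; exact: measurable_npoints.
by have [Ao|Ao] := pselect (A (origin R)); [rewrite (_ : [set _ | _] = setT)|rewrite (_ : [set _ | _] = set0)];
  rewrite ?predeqE//.
Qed.

(** By local finiteness there are finitely many points in the square of side 2 centred at [p]. A
    grid box around [p] with side below 1 stays in this square, and with side below [e] it misses
    the other points. *)
Lemma isolating_box w p : X w p -> exists c, X w `&` box c = [set p].
Proof.
move=> Xp.
pose S := (X w `&` cell 2 (p.1 - 1, p.2 - 1)) `\ p.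
have finS : finite_set S.
  apply: (@sub_finite_set _ _ (X w `&` cell 2 (p.1 - 1, p.2 - 1))); first by move=> q [].
  by apply: finite_PPP; exact: bounded_cell.
have [e e0 eS] : exists2 e : R, 0 < e & forall q, S q -> e <= `|q.1 - p.1| \/ e <= `|q.2 - p.2|.
  have Sp q : S q -> q <> p by case.
  move: finS Sp => /finite_seqP[s ->]; elim: s => [|q s IH] Sp; first by exists 1.
  have [|e e0 eS] := IH; first by move=> r rs; apply: Sp; rewrite /= inE; apply/orP; right.
  have qp : 0 < `|q.1 - p.1| + `|q.2 - p.2|.
    rewrite lt_neqAle addr_ge0// andbT eq_sym; apply/negP.
    rewrite paddr_eq0// !normr_eq0 !subr_eq0 => /andP[/eqP h1 /eqP h2].
    apply: (Sp q); first by rewrite /= inE eqxx.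
    by move: h1 h2; clear; case: q p => [? ?] [? ?] /= -> ->.
  exists (Num.min e ((`|q.1 - p.1| + `|q.2 - p.2|) / 2)); first by rewrite lt_min e0 divr_gt0.
  move=> r; rewrite /= inE => /predU1P[->|/eS rs].
    have [h|h] := leP ((`|q.1 - p.1| + `|q.2 - p.2|) / 2) `|q.1 - p.1|.
      by left; rewrite ge_min h orbT.
    by right; rewrite ge_min; apply/orP; right; lra.
  by rewrite !ge_min; case: rs => ->; [left|right].
pose m := Num.trunc (e^-1 + 1).
have me : @mesh R m < Num.min e 1.
  rewrite lt_min; apply/andP; split.
    rewrite -[ltRHS]invrK ltf_pV2 ?posrE ?invr_gt0//.
    by rewrite (lt_trans _ (truncnS_gt _))// ltrDl.
  rewrite invf_lt1// (@lt_le_trans _ _ (e^-1 + 1))// ?ltrDr ?invr_gt0//.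
  by rewrite ltW// truncnS_gt.
have m0 := @mesh_gt0 R m.
exists (m, Num.floor (p.1 * m.+1%:R), Num.floor (p.2 * m.+1%:R)).
have dk : @mesh R m * m.+1%:R = 1 by rewrite mulVf.
have E (y : R) : mesh m * (y * m.+1%:R) = y by rewrite mulrCA dk mulr1.
have bp : box (m, Num.floor (p.1 * m.+1%:R), Num.floor (p.2 * m.+1%:R)) p.
  rewrite /box /=; apply/cellP => /=.
  have aux (y : R) : mesh m * (Num.floor (y * m.+1%:R))%:~R <= y <
     mesh m * (Num.floor (y * m.+1%:R))%:~R + mesh m.
    have /andP[f1 f2] := floor_itv (y * m.+1%:R); rewrite intrD in f2.
    apply/andP; split; first by rewrite -[X in _ <= X]E ler_pM2l.
    by rewrite -[X in X < _]E -[X in _ + X](mulr1 (mesh m)) -mulrDr ltr_pM2l.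
  by split; exact: aux.
apply/seteqP; split => q /=; last by move=> ->.
move=> [Xq bq]; apply: contrapT => qp.
move/cellP: bp => /= [/andP[a1 a2] /andP[a3 a4]].
move/cellP: bq => /= [/andP[b1 b2] /andP[b3 b4]].
move: me; rewrite lt_min => /andP[me m1].
have Sq : S q.
  by split => //; split => //; apply/cellP => /=; split; apply/andP; split; lra.
by case: (eS _ Sq); rewrite leNgt => /negP; apply; rewrite ltr_norml; apply/andP; split; lra.
Qed.

(** Codes of no box, and boxes without exactly one point, give the origin, which belongs to the Palm
    configuration; hence [palm_xi] holds without exceptions. *)
Definition xi (n : nat) : Omega -> R * R := lone (odflt None (@choice.unpickle (option (nat * int * int)) n)).

Lemma measurable_xi n : measurable_fun setT (xi n).
Proof. exact: measurable_lone. Qed.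

Lemma palm_xi w p : palm X w p <-> exists n, xi n w = p.
Proof.
split=> [[Xp|->]|[n <-]].
- have [c Xc] := isolating_box Xp; exists (@choice.pickle (option (nat * int * int)) (Some c)).
  rewrite /xi choice.pickleK /= /lone.
  have -> : npoints (X w) (box c) = 1%N.
    by apply/npoints1; [apply: finite_PPP; exact: bounded_cell|exists p].
  by rewrite eqxx Xc xget_singleton.
- by exists (@choice.pickle (option (nat * int * int)) None); rewrite /xi choice.pickleK.
- rewrite /xi; case: (odflt _ _) => [c|]; last by right.
  rewrite /lone; case: eqP => [n1|_]; last by right.
  have [q Xq] := (npoints1 (finite_PPP w (@bounded_cell _ _))).1 n1.
  rewrite Xq xget_singleton; left.
  have : [set q] q by [].
  by rewrite -Xq => -[].
Qed.
End enumeration.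

(** * The navigation path as a 1-Lipschitz graph *)

Section navigation.
Context {R : realType}.
Variable theta : R.
Hypothesis thetaP : 0 < theta <= pi / 4.
Local Notation t := (tan theta).

Lemma norm_atan_le (z : R) : (`|atan z| <= theta) = (`|z| <= t).
Proof.
have E := atan_tan_theta thetaP; set u := t in E *; rewrite -E.
by rewrite !ler_norml -atanN !(le_mono (@lt_atan R)).
Qed.

Lemma in_coneP (p q : R * R) : in_cone theta p q <->
  0 < q.1 - p.1 /\ `|q.2 - p.2| <= (q.1 - p.1) * t.
Proof.
rewrite /in_cone norm_atan_le normrM normfV.
by split=> -[d0]; rewrite (gtr0_norm d0) ler_pdivrMr// mulrC.
Qed.

Variable X : set (R * R).

Definition best (v w : R * R) : Prop :=
  nearest_in_cone theta X v w /\
  forall u, nearest_in_cone theta X v u -> w.1 < u.1 \/ (w.1 = u.1 /\ w.2 <= u.2).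

Lemma best_unique v w w' : best v w -> best v w' -> w = w'.
Proof.
move=> [h1 h2] [h3 h4]; have := h2 _ h3; have := h4 _ h1.
move: w w' {h1 h2 h3 h4} => [a b] [c e] /= [h|[-> h]] [h'|[h' h'']].
- by have := lt_trans h h'; rewrite ltxx.
- by rewrite h' ltxx in h.
- by rewrite ltxx in h'.
- by congr (_, _); apply/eqP; rewrite eq_le h h''.
Qed.

Lemma nav_next_best v w : best v w -> nav_next theta X v = w.
Proof.
move=> bw; rewrite /nav_next; case: xgetP => [p _ bp|/(_ w)]; last by case.
exact: best_unique bp bw.
Qed.

Lemma nav_next_none v : (forall w, ~ best v w) -> nav_next theta X v = v.
Proof. by move=> nb; rewrite /nav_next xgetPN. Qed.

Local Notation V := (nav theta X).

Lemma nav_step k : V k.+1 = V k \/ in_cone theta (V k) (V k.+1).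
Proof.
have [[w bw]|nb] := pselect (exists w, best (V k) w).
  by right; rewrite /= (nav_next_best bw); case: bw => -[_ []].
by left; apply: nav_next_none => w bw; apply: nb; exists w.
Qed.

(** [theta <= pi / 4] makes the slope of the cone at most 1. This bounds [Y_t / t] and controls
    [Y_t] by a later vertex. *)
Lemma nav_slope k : `|(V k.+1).2 - (V k).2| <= (V k.+1).1 - (V k).1.
Proof.
case: (nav_step k) => [->|/in_coneP[d0 h]]; first by rewrite !subrr normr0.
by rewrite (le_trans h)// ler_piMr ?slope_le1// ltW.
Qed.

Lemma nav_lip m n : (m <= n)%N -> `|(V n).2 - (V m).2| <= (V n).1 - (V m).1.
Proof.
elim: n => [|n IH]; first by rewrite leqn0 => /eqP ->; rewrite !subrr normr0.
rewrite leq_eqVlt => /predU1P[->|]; first by rewrite !subrr normr0.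
rewrite ltnS => /IH h; have := nav_slope n.
have -> : (V n.+1).2 - (V m).2 = ((V n.+1).2 - (V n).2) + ((V n).2 - (V m).2) by ring.
move=> h'; rewrite (le_trans (ler_normD _ _))//; lra.
Qed.

Lemma nav_le1 m n : (m <= n)%N -> (V m).1 <= (V n).1.
Proof. by move=> /nav_lip; move: (normr_ge0 ((V n).2 - (V m).2)); lra. Qed.

(** When the walk does not advance the quotient by 0 is 0, and the value is the ordinate of the
    stationary vertex. *)
Definition ypoint k (s : R) : R :=
  (V k).2 + (s - (V k).1) / ((V k.+1).1 - (V k).1) * ((V k.+1).2 - (V k).2).

Lemma nav_flat k : (V k.+1).1 = (V k).1 -> (V k.+1).2 = (V k).2.
Proof.
move=> e; have := nav_slope k; rewrite e subrr normr_le0 => /eqP; lra.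
Qed.

Lemma ypoint_convex k s : (V k).1 <= s <= (V k.+1).1 -> exists2 a : R, 0 <= a <= 1 &
  s = (V k).1 + a * ((V k.+1).1 - (V k).1) /\
  ypoint k s = (V k).2 + a * ((V k.+1).2 - (V k).2).
Proof.
move=> /andP[h1 h2]; have [e|ne] := eqVneq (V k.+1).1 (V k).1.
  exists 0; first by rewrite lexx ler01.
  rewrite /ypoint (nav_flat e) subrr !mulr0; split => //.
  by apply/eqP; rewrite eq_le mul0r addr0 h1 andbT -e.
have d0 : 0 < (V k.+1).1 - (V k).1 by rewrite subr_gt0 lt_neqAle eq_sym ne nav_le1.
exists ((s - (V k).1) / ((V k.+1).1 - (V k).1)).
  by rewrite divr_ge0 ?subr_ge0 ?h1 ?nav_le1//= ?ler_pdivrMr// ?mul1r ?lerB.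
by split => //; rewrite divfK ?gt_eqF//; ring.
Qed.

Lemma ypoint_of_convex k (s a y : R) : 0 <= a <= 1 ->
  s = (V k).1 + a * ((V k.+1).1 - (V k).1) ->
  y = (V k).2 + a * ((V k.+1).2 - (V k).2) ->
  (V k).1 <= s <= (V k.+1).1 /\ y = ypoint k s.
Proof.
move=> /andP[a0 a1] -> ->; have d0 : 0 <= (V k.+1).1 - (V k).1 by rewrite subr_ge0 nav_le1.
split; first by apply/andP; split; nra.
rewrite /ypoint addrAC subrr add0r; have [e|ne] := eqVneq (V k.+1).1 (V k).1.
  by rewrite (nav_flat e) subrr !mulr0.
by rewrite mulfK// subr_eq0.
Qed.

Lemma ypoint_lip k l s : (V k).1 <= s <= (V k.+1).1 -> (k < l)%N ->
  `|ypoint k s - (V l).2| <= (V l).1 - s.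
Proof.
move=> ks kl; have [a /andP[a0 a1] [-> ->]] := ypoint_convex ks.
have := nav_lip kl; have := nav_slope k; rewrite !ler_norml => /andP[h1 h2] /andP[h3 h4].
by apply/andP; split; nra.
Qed.

Lemma ypoint_lip0 k s : (V k).1 <= s <= (V k.+1).1 -> `|ypoint k s| <= s.
Proof.
move=> ks; have [a /andP[a0 a1] [-> ->]] := ypoint_convex ks.
have := nav_lip (leq0n k); have := nav_slope k; rewrite /= !subr0 !ler_norml => /andP[h1 h2] /andP[h3 h4].
by apply/andP; split; nra.
Qed.

(** If [i < j] and both segments lie over [s], monotonicity of the abscissas forces [(V j).1 = s];
    then the bound in [ypoint_lip] is 0. *)
Lemma ypoint_unique k l s : (V k).1 <= s <= (V k.+1).1 -> (V l).1 <= s <= (V l.+1).1 ->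
  ypoint k s = ypoint l s.
Proof.
have aux i j : (i < j)%N -> (V i).1 <= s <= (V i.+1).1 -> (V j).1 <= s <= (V j.+1).1 ->
    ypoint i s = ypoint j s.
  move=> ij ki /andP[h1 h2]; have := ypoint_lip ki ij; have /andP[_ h3] := ki.
  have h4 := nav_le1 ij; have e : (V j).1 = s by apply/eqP; rewrite eq_le h1 (le_trans h3).
  rewrite /ypoint e subrr normr_le0 subr_eq0 => /eqP ->.
  by rewrite /ypoint mul0r mul0r addr0.
by have [kl|kl|->] := ltngtP k l => // h1 h2; [exact: aux|apply/esym/aux].
Qed.

Lemma Ypath_ypoint k s : (V k).1 <= s <= (V k.+1).1 -> Ypath theta X s = ypoint k s.
Proof.
move=> ks; rewrite /Ypath; case: xgetP => [y _ [l [a [a01 [h1 h2]]]]|/(_ (ypoint k s))].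
  have [ls ->] := ypoint_of_convex a01 h1 h2; exact: ypoint_unique ls ks.
have [a a01 [h1 h2]] := ypoint_convex ks.
by case; exists k, a.
Qed.

Lemma Ypath_default s : (forall k, ~ (V k).1 <= s <= (V k.+1).1) -> Ypath theta X s = 0.
Proof.
move=> ns; rewrite /Ypath xgetPN// => y [l [a [a01 [h1 h2]]]].
by have [/ns] := ypoint_of_convex a01 h1 h2.
Qed.

Lemma nav_crossing n s : 0 <= s -> s < (V n).1 ->
  exists2 k, (k < n)%N & (V k).1 <= s <= (V k.+1).1.
Proof.
move=> s0; elim: n => [|n IH]; first by rewrite /= ltNge s0.
move=> sn; have [h|h] := leP (V n).1 s; first by exists n => //; rewrite h ltW.
by have [k kn ks] := IH h; exists k => //; exact: ltnW.
Qed.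

Lemma dot_ypoint_lt k s g (c : R) : (V k).1 <= s <= (V k.+1).1 ->
  dot g (V k) < c -> dot g (V k.+1) < c -> dot g (s, ypoint k s) < c.
Proof.
move=> ks; have [a /andP[a0 a1] [h1 h2]] := ypoint_convex ks.
have -> : dot g (s, ypoint k s) = (1 - a) * dot g (V k) + a * dot g (V k.+1).
  by rewrite /dot/= h2 {1}h1; ring.
move=> h3 h4; rewrite -subr_gt0.
have -> : c - ((1 - a) * dot g (V k) + a * dot g (V k.+1)) =
  (1 - a) * (c - dot g (V k)) + a * (c - dot g (V k.+1)) by ring.
have [->|an0] := eqVneq a 0; first by rewrite subr0 mul1r mul0r addr0 subr_gt0.
have {}a0 : 0 < a by rewrite lt_neqAle eq_sym an0.
apply: ltr_wpDl; first by apply: mulr_ge0; rewrite subr_ge0// ltW.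
by apply: mulr_gt0; rewrite ?subr_gt0.
Qed.
End navigation.

(** * Measurability of the vertices and of [Y_t] *)

Section nav_measurability.
Context {R : realType}.
Context d (Omega : measurableType d) (P : probability Omega R).
Variables (lambda theta : R) (X : Omega -> set (R * R)).
Hypothesis thetaP : 0 < theta <= pi / 4.
Hypothesis PPP : is_PPP P lambda X.
Local Notation xi := (xi X).
Local Notation V := (fun n w => nav theta (palm X w) n).

Lemma measurable_edist (U W : Omega -> R * R) : measurable_fun setT U -> measurable_fun setT W ->
  measurable_fun setT (fun w => Defs.edist (U w) (W w)).
Proof.
move=> mU mW; rewrite /Defs.edist.
apply: (measurableT_comp (continuous_measurable_fun (@sqrt_continuous R))).
by mfun.
Qed.

Lemma measurable_in_cone (U W : Omega -> R * R) : measurable_fun setT U -> measurable_fun setT W ->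
  measurable [set w | in_cone theta (U w) (W w)].
Proof.
move=> mU mW.
rewrite (_ : [set w | _] = [set w | 0 < (W w).1 - (U w).1 /\
   `|(W w).2 - (U w).2| <= ((W w).1 - (U w).1) * tan theta]); last first.
  by apply/seteqP; split => w /= /(in_coneP thetaP).
by apply: measurable_andP; [apply: measurable_set_lt|apply: measurable_set_le]; mfun.
Qed.

(** The quantifier over the configuration becomes a countable one over the enumeration [xi]. *)
Lemma measurable_nearest (U W : Omega -> R * R) : measurable_fun setT U -> measurable_fun setT W ->
  (forall w, palm X w (W w)) ->
  measurable [set w | nearest_in_cone theta (palm X w) (U w) (W w)].
Proof.
move=> mU mW palmW.
rewrite (_ : [set w | _] = [set w | in_cone theta (U w) (W w) /\
  forall n, in_cone theta (U w) (xi n w) -> Defs.edist (U w) (W w) <= Defs.edist (U w) (xi n w)]).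
  apply: measurable_andP; first exact: measurable_in_cone.
  apply: measurable_forall => n; apply: measurable_imp.
    by apply: measurable_in_cone => //; exact: (measurable_xi PPP).
  by apply: measurable_set_le; apply: measurable_edist => //; exact: (measurable_xi PPP).
apply/seteqP; split => w /=.
  by move=> [_ [h1 h2]]; split => // n; apply: h2; apply/(palm_xi PPP); exists n.
move=> [h1 h2]; split => //; split => // u /(palm_xi PPP)[n <-]; exact: h2.
Qed.

Lemma palm_xi' n w : palm X w (xi n w).
Proof. by apply/(palm_xi PPP); exists n. Qed.

Lemma measurable_best (U : Omega -> R * R) n : measurable_fun setT U ->
  measurable [set w | best theta (palm X w) (U w) (xi n w)].
Proof.
move=> mU; have mx m := measurable_xi PPP m.
(* Equality of first coordinates is replaced by the failure of the reverse strict inequality: next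
   to the first alternative this says the same, and it is visibly measurable. *)
rewrite (_ : [set w | _] = [set w | nearest_in_cone theta (palm X w) (U w) (xi n w) /\
  forall m, nearest_in_cone theta (palm X w) (U w) (xi m w) ->
   ((xi n w).1 < (xi m w).1 \/ (~ ((xi m w).1 < (xi n w).1) /\ (xi n w).2 <= (xi m w).2))]).
  apply: measurable_andP; first by apply: measurable_nearest => // w; exact: palm_xi'.
  apply: measurable_forall => m; apply: measurable_imp.
    by apply: measurable_nearest => // w; exact: palm_xi'.
  apply: measurable_orP; first by apply: measurable_set_lt; mfun; exact: mx.
  apply: measurable_andP; last by apply: measurable_set_le; mfun; exact: mx.
  by apply: measurableC; apply: measurable_set_lt; mfun; exact: mx.
apply/seteqP; split => w /= -[h1 h2]; split => //.
  by move=> m /h2[]; [left|case=> -> ->; right; split => //; rewrite ltxx].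
move=> u nu; have [m um] : exists m, xi m w = u by apply/(palm_xi PPP); case: nu.
rewrite -um in nu *; have [|[/negP/negPf h h']] := h2 _ nu; first by left.
have [lt|ge] := ltP (xi n w).1 (xi m w).1; first by left.
by right; split => //; apply/eqP; rewrite eq_le ge andbT leNgt h.
Qed.

Lemma best_palm w v p : best theta (palm X w) v p -> exists n, xi n w = p.
Proof. by move=> [[h _] _]; apply/(palm_xi PPP). Qed.

Lemma measurable_nav n : measurable_fun setT (V n).
Proof.
elim: n => [|n IH]; first exact: measurable_cst.
move=> _ A mA; rewrite setTI.
rewrite (_ : _ @^-1` A = [set w | (exists m, best theta (palm X w) (V n w) (xi m w) /\ A (xi m w)) \/
  ((forall m, ~ best theta (palm X w) (V n w) (xi m w)) /\ A (V n w))]).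
  apply: measurable_orP.
    apply: measurable_exists => m; apply: measurable_andP; first exact: measurable_best.
    by apply: measurable_preim => //; exact: (measurable_xi PPP).
  apply: measurable_andP; last exact: measurable_preim.
  by apply: measurable_forall => m; apply: measurableC; exact: measurable_best.
apply/seteqP; split => w /=.
  have [[p bp]|nb] := pselect (exists p, best theta (palm X w) (V n w) p).
    have [m mp] := best_palm bp; rewrite (nav_next_best bp) -mp => Am; left.
    by exists m; rewrite {1}mp.
  rewrite (nav_next_none (fun p bp => nb (ex_intro _ p bp))) => Am; right.
  by split => // m bm; apply: nb; exists (xi m w).
case=> [[m [/nav_next_best -> ]]//|[nb Am]].
rewrite nav_next_none// => p bp; have [m mp] := best_palm bp.
by apply: (nb m); rewrite mp.
Qed.

Lemma measurable_ypoint k s : measurable_fun setT (fun w => ypoint theta (palm X w) k s).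
Proof.
rewrite /ypoint; have m1 := measurable_nav k; have m2 := measurable_nav k.+1.
mfun; exact: m1 || exact: m2.
Qed.

Lemma measurable_Ypath (A : set R) s : measurable A ->
  measurable [set w | A (Ypath theta (palm X w) s)].
Proof.
move=> mA; have m n := measurable_nav n.
have mk k : measurable [set w | (V k w).1 <= s <= (V k.+1 w).1].
  rewrite (_ : [set w | _] = [set w | (V k w).1 <= s /\ s <= (V k.+1 w).1]); last first.
    by apply/seteqP; split => w /= /andP.
  by apply: measurable_andP; apply: measurable_set_le; mfun; exact: m.
rewrite (_ : [set w | _] = [set w |
  (exists k, (V k w).1 <= s <= (V k.+1 w).1 /\ A (ypoint theta (palm X w) k s)) \/
  ((forall k, ~ (V k w).1 <= s <= (V k.+1 w).1) /\ A 0)]).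
  apply: measurable_orP.
    apply: measurable_exists => k; apply: measurable_andP; first exact: mk.
    by apply: measurable_preim => //; exact: measurable_ypoint.
  apply: measurable_andP; first by apply: measurable_forall => k; exact: measurableC (mk k).
  have [A0|A0] := pselect (A 0).
    by rewrite (_ : [set _ | _] = setT)// predeqE.
  by rewrite (_ : [set _ | _] = set0)// predeqE.
apply/seteqP; split => w /=.
  have [[k ks]|ns] := pselect (exists k, (V k w).1 <= s <= (V k.+1 w).1).
    by rewrite (Ypath_ypoint thetaP ks) => ?; left; exists k.
  have ns' k : ~ (V k w).1 <= s <= (V k.+1 w).1 by move=> ks; apply: ns; exists k.
  by rewrite (Ypath_default thetaP ns') => ?; right.
case=> [[k [ks]]|[ns]]; first by rewrite (Ypath_ypoint thetaP ks).
by rewrite (Ypath_default thetaP ns).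
Qed.
End nav_measurability.

(** * Probabilities of cell paths *)

Lemma stepw_bad (R : realType) (lambda theta : R) k (z : gridT k) :
  ~~ good theta (mesh k) (gridpos z) -> stepw lambda theta z = 0.
Proof. by rewrite /stepw => /negbTE ->. Qed.

Section cell_geometry.
Context {R : realType}.
Variable theta : R.
Hypothesis thetaP : 0 < theta <= pi / 4.
Local Notation t := (tan theta).
Local Notation slack := (slack theta).

Lemma edistE (p q : R * R) : Defs.edist p q = enorm (q - p).
Proof. by []. Qed.

Lemma coneD p q : cone t p -> cone t q -> cone t (p + q).
Proof.
rewrite /cone/= mulrDl => p0 q0; rewrite (le_lt_trans (ler_normD _ _))//; exact: ltrD.
Qed.

Lemma cone_in_cone p q : cone t (q - p) -> in_cone theta p q.
Proof.
by move=> pq; apply/(in_coneP thetaP); have [h _] := cone_pos thetaP pq; split => //; exact: ltW.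
Qed.

(* This is where [theta <= pi / 4] enters: two vectors of the cone make an acute
   angle, so points seen from the next vertex are never nearer to the current one. *)
Lemma cone_farther a b : cone t a -> cone t b -> enorm a < enorm (a + b).
Proof.
move=> ca cb; have [a1 a2] := cone_pos thetaP ca; have [b1 b2] := cone_pos thetaP cb.
rewrite /enorm ltr_sqrt; last first.
  have : 0 < a.1 + b.1 by exact: addr_gt0.
  by move=> h; rewrite /sqnorm/= ltr_pwDl ?sqr_ge0// exprn_gt0.
have ab : 0 < a.1 * b.1 + a.2 * b.2.
  have : `|a.2 * b.2| < a.1 * b.1 by rewrite normrM ltr_pM.
  by rewrite ltr_norml => /andP[]; lra.
have : 0 < b.1 ^+ 2 by rewrite exprn_gt0.
have := sqr_ge0 b.2; rewrite /sqnorm/=; move: ab; clear; nra.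
Qed.

Lemma good_step (d : R) p q v v' : 0 < d -> good theta d q ->
  cell d p v -> cell d (p + q) v' -> cone t (v' - v).
Proof.
move=> d0; rewrite /good => gq /cellP[/andP[h1 h2] /andP[h3 h4]] /cellP[/= /andP[h5 h6] /andP[h7 h8]].
rewrite /cone/=; have t0 := slope_gt0 thetaP.
have : (q.1 - d) * t < (v'.1 - v.1) * t by rewrite ltr_pM2r//; lra.
apply: le_lt_trans; apply: le_trans gq.
rewrite ler_norml; have := ler_norm q.2; have := ler_norm (- q.2); rewrite normrN => *.
apply/andP; split; lra.
Qed.

Lemma near_sector (d : R) p q v v' u : 0 < d ->
  cell d p v -> cell d (p + q) v' -> in_cone theta v u ->
  Defs.edist v u <= Defs.edist v v' ->
  sector theta (p.1 - 2 / t * d, p.2) (enorm q + slack * d) u.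
Proof.
move=> d0 /cellP[/andP[h1 h2] /andP[h3 h4]] /cellP[/= /andP[h5 h6] /andP[h7 h8]].
have t0 := slope_gt0 thetaP.
move=> /(in_coneP thetaP)[c1 c2]; rewrite !edistE => uv.
have td : 2 / t * d * t = 2 * d by field; rewrite gt_eqF.
have td0 : 0 < 2 / t * d by rewrite mulr_gt0// divr_gt0.
split => /=.
  have : `|u.2 - p.2| <= `|u.2 - v.2| + `|v.2 - p.2|.
    by rewrite (_ : u.2 - p.2 = (u.2 - v.2) + (v.2 - p.2)) ?ler_normD//; ring.
  have : `|v.2 - p.2| < d by rewrite ltr_norml; apply/andP; split; lra.
  have : 0 <= (v.1 - p.1) * t by rewrite mulr_ge0 ?subr_ge0// ltW.
  have -> : (u.1 - (p.1 - 2 / t * d)) * t = (u.1 - v.1) * t + (v.1 - p.1) * t + 2 / t * d * t.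
    by ring.
  by rewrite td; move: c2 d0; clear; lra.
set w := (p.1 - 2 / t * d, p.2).
have : enorm (u - w) <= enorm q + slack * d.
  have : enorm (u - w) <= enorm (u - v) + enorm (v - w).
    by rewrite (_ : u - w = (u - v) + (v - w)) ?enorm_triangle// addrA subrK.
  have : enorm (v' - v) <= enorm q + enorm (v' - v - q).
    by have := enorm_triangle q (v' - v - q); rewrite [q + _]addrC subrK.
  have : enorm (v' - v - q) <= 2 * d.
    rewrite (le_trans (enorm_le1 _))//= (_ : 2 * d = d + d); last by ring.
    by apply: lerD; rewrite ler_norml; apply/andP; split; lra.
  have : enorm (v - w) <= d + 2 / t * d + d.
    rewrite (le_trans (enorm_le1 _))//=.
    by apply: lerD; rewrite ler_norml; apply/andP; split; lra.
  by rewrite /slack mulrDl; move: uv; clear; lra.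
have -> : (u.1 - (p.1 - 2 / t * d)) ^+ 2 + (u.2 - p.2) ^+ 2 = enorm (u - w) ^+ 2.
  by rewrite sqr_enorm.
by move=> h; rewrite ler_pXn2r// nnegrE ?(le_trans _ h)// enorm_ge0.
Qed.
End cell_geometry.

(** * Confinement of the walk to a prescribed sequence of cells *)

Section confinement.
Context {R : realType}.
Variable theta : R.
Hypothesis thetaP : 0 < theta <= pi / 4.
Local Notation t := (tan theta).
Local Notation slack := (slack theta).
Variables (d : R) (n : nat) (q : 'I_n -> R * R).
Hypotheses (d0 : 0 < d) (goodq : forall i, good theta d (q i)).

Definition ref (i : nat) : R * R := \sum_(j < n | (j < i)%N) q j.

Lemma ref0 : ref 0 = 0. Proof. by rewrite /ref big_pred0. Qed.

Lemma refS (i : 'I_n) : ref i.+1 = ref i + q i.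
Proof.
rewrite /ref (bigD1 i)//= addrC; congr (_ + _); apply: eq_bigl => j.
by rewrite ltnS leq_eqVlt -val_eqE /=; case: ltngtP.
Qed.

Lemma cell_corner p : cell d p p.
Proof. by apply/cellP; rewrite !lexx !ltrDl. Qed.

(** The difference is split at the corner of the last cell but one, and the cone is closed under
    addition. *)
Lemma ref_chain i j v v' : (i < j <= n)%N -> cell d (ref i) v -> cell d (ref j) v' ->
  cone t (v' - v).
Proof.
elim: j v' => [|j IH] v' /andP[ij jn]; first by rewrite ltn0 in ij.
move=> vi; rewrite -[j]/(nat_of_ord (Ordinal jn)) refS /= => vj.
move: ij; rewrite ltnS leq_eqVlt => /predU1P[e|ij].
  rewrite e in vi; exact: good_step (goodq (Ordinal jn)) vi vj.
have := IH (ref j); rewrite ij (ltnW jn) => /(_ isT vi (cell_corner _)) h1.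
have := good_step thetaP d0 (goodq (Ordinal jn)) (cell_corner _) vj => h2.
have -> : v' - v = (ref j - v) + (v' - ref j) by rewrite [RHS]addrC addrA subrK.
exact: coneD.
Qed.

Variables (X : set (R * R)) (a : 'I_n -> R * R).
Hypothesis aP : forall i : 'I_n, X `&` cell d (ref i.+1) = [set a i].
Hypothesis emptyP : forall u (i : 'I_n), X u ->
  sector theta ((ref i).1 - 2 / t * d, (ref i).2) (enorm (q i) + slack * d) u ->
  exists j : 'I_n, cell d (ref j.+1) u.
Local Notation Xo := (X `|` [set origin R]).
Local Notation V := (nav theta Xo).

(** A competitor of [a i] lies in the enlarged sector, hence by [emptyP] it is some [a j]. Those
    with [j < i] are not ahead of [V i]; those with [j > i] are strictly farther by [cone_farther].
    So [a i] is the unique nearest point and the tie-break is void. *)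
Lemma nav_confined i : (i <= n)%N -> cell d (ref i) (V i) /\ ((0 < i)%N -> X (V i)).
Proof.
have aE (j : 'I_n) u : X u -> cell d (ref j.+1) u -> u = a j.
  by move=> Xu cu; have : (X `&` cell d (ref j.+1)) u by []; rewrite aP.
have aX (j : 'I_n) : X (a j) /\ cell d (ref j.+1) (a j).
  by have : [set a j] (a j) by []; rewrite -aP.
elim: i => [_|i IH lin].
  by rewrite ref0; split => //; exact: (@cell_corner (origin R)).
have [Vi XVi] := IH (ltnW lin); pose o := Ordinal lin.
have [Xao cao] := aX o.
have c1 : cone t (a o - V i) by apply: ref_chain Vi cao; rewrite ltnSn.
suff : best theta Xo (V i) (a o).
  by move=> /nav_next_best /= ->; split.
have key u : Xo u -> in_cone theta (V i) u -> Defs.edist (V i) u <= Defs.edist (V i) (a o) -> u = a o.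
  move=> + cu du; have /(in_coneP thetaP)[cu1 _] := cu.
  (* The added point at the origin is never ahead: all vertices have nonnegative abscissa. *)
  case=> [Xu|u0]; last first.
    have := nav_le1 thetaP Xo (leq0n i); rewrite u0 /= in cu1 *.
    by rewrite sub0r oppr_gt0 in cu1; rewrite leNgt cu1.
  have cao' : cell d (ref o + q o) (a o) by rewrite -refS.
  have := near_sector thetaP d0 (Vi : cell d (ref o) (V i)) cao' cu du.
  move=> /(emptyP Xu)[j cj]; rewrite (aE _ _ Xu cj).
  have [ji|ij|e] := ltngtP j i; last by congr a; exact: val_inj.
    (* [a j] sits in cell [j.+1], so [j.+1 = i] means that [a j] is the current vertex itself, which
       its own cone excludes. *)
    have [e|ne] := eqVneq j.+1 i.
      have i0 : (0 < i)%N by rewrite -e.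
      have := aE j (V i) (XVi i0); rewrite e => /(_ Vi).
      by rewrite -(aE _ _ Xu cj) => e'; rewrite e' subrr ltxx in cu1.
    have ji' : (j.+1 < i <= n)%N by rewrite ltn_neqAle ne ji (ltnW lin).
    have [h _] := cone_pos thetaP (ref_chain ji' cj Vi).
    by exfalso; move: h cu1; rewrite /= !subr_gt0 => /lt_trans h /h; rewrite ltxx.
  have c2 : cone t (u - a o).
    by apply: ref_chain cao cj; rewrite ltnS ij ltn_ord.
  have := cone_farther thetaP c1 c2.
  rewrite (_ : a o - V i + (u - a o) = u - V i); last by rewrite addrC addrA subrK.
  by rewrite ltNge -!edistE du.
have ca : in_cone theta (V i) (a o) by exact: cone_in_cone.
split.
  split; first by left.
  split => // u Xu cu; rewrite leNgt; apply/negP => lt.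
  by move: (lt); rewrite (key _ Xu cu (ltW lt)) ltxx.
move=> u [Xu [cu du]]; right; rewrite (key u Xu cu) //.
by apply: du => //; left.
Qed.
End confinement.

(** * Lower bound for the probability of a cell path *)

Section path_probability.
Context {R : realType}.
Local Notation mu := (@lebesgue_measure R).
Context d (Omega : measurableType d) (P : probability Omega R).
Variables (lambda theta : R) (X : Omega -> set (R * R)).
Hypotheses (lambda0 : 0 < lambda) (thetaP : 0 < theta <= pi / 4).
Hypothesis PPP : is_PPP P lambda X.
Local Notation t := (tan theta).
Local Notation slack := (slack theta).
Local Notation V := (fun n w => nav theta (palm X w) n).
Local Notation mesh := (@mesh R).
Local Notation gridpos := (@gridpos R _).
Local Notation stepw := (stepw lambda theta).

Definition path_ref k n (z : {ffun 'I_n -> gridT k}) (i : nat) : R * R :=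
  ref (fun j => gridpos (z j)) i.

Definition path_ev k n (z : {ffun 'I_n -> gridT k}) : set Omega :=
  [set w | forall i : 'I_n.+1, cell (mesh k) (path_ref z i) (V i w)].

Lemma measurable_path_ev k n (z : {ffun 'I_n -> gridT k}) : measurable (path_ev z).
Proof.
rewrite (_ : path_ev z = [set w | forall i : nat, (i <= n)%N -> cell (mesh k) (path_ref z i) (V i w)]).
  apply: measurable_forall => i; apply: measurable_imp.
    have [h|h] := boolP (i <= n)%N; last by rewrite (_ : [set _ | _] = set0)// predeqE.
    by rewrite (_ : [set _ | _] = setT)// predeqE.
  by apply: measurable_preim; [exact: (measurable_nav thetaP PPP)|exact: measurable_cell].
apply/seteqP; split => w h i; last by apply: h; rewrite -ltnS.
by rewrite -ltnS => ni; exact: h (Ordinal ni).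
Qed.

(** At the first index where the paths differ, the corners reached so far agree and the next two
    cells are disjoint. *)
Lemma path_ev_disj k n (z z' : {ffun 'I_n -> gridT k}) : z != z' ->
  path_ev z `&` path_ev z' = set0.
Proof.
move=> zz; have [i0 zi0] : exists i, z i != z' i.
  apply/existsP; apply: contraR zz => /existsPn h; apply/eqP/ffunP => i.
  by have := h i; rewrite negbK => /eqP.
case: (@arg_minnP _ i0 (fun i => z i != z' i) (fun i => nat_of_ord i) zi0) => i zi imin.
rewrite -subset0 => w [/(_ (lift ord0 i)) + /(_ (lift ord0 i))].
rewrite /= /bump /= add1n /path_ref !refS.
have -> : ref (fun j => gridpos (z j)) i = ref (fun j => gridpos (z' j)) i.
  rewrite /ref; apply: eq_bigr => j ji; congr gridpos; apply/eqP; apply: contraLR ji => /imin.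
  by rewrite -leqNgt.
move=> h1 h2; have := gridpos_disj (ref (fun j => gridpos (z' j)) i) zi.
by rewrite -subset0 => /(_ (nav theta (palm X w) i.+1)); apply.
Qed.

Lemma bounded_sector p (rho : R) : bounded2 (sector theta p rho).
Proof.
exists (`|p.1| + `|p.2| + `|rho|) => u [_ h].
have n1 : `|u.1 - p.1| <= `|rho|.
  by rewrite -(@ler_pXn2r _ 2)// ?nnegrE// !real_normK ?num_real// (le_trans _ h)// lerDl sqr_ge0.
have n2 : `|u.2 - p.2| <= `|rho|.
  by rewrite -(@ler_pXn2r _ 2)// ?nnegrE// !real_normK ?num_real// (le_trans _ h)// lerDr sqr_ge0.
have h1 : `|u.1| <= `|u.1 - p.1| + `|p.1| by rewrite -{1}(subrK p.1 u.1) ler_normD.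
have h2 : `|u.2| <= `|u.2 - p.2| + `|p.2| by rewrite -{1}(subrK p.2 u.2) ler_normD.
have := normr_ge0 p.1; have := normr_ge0 p.2; lra.
Qed.

Section counts.
Variables (k n : nat) (z : {ffun 'I_n -> gridT k}).
Local Notation q := (fun j => gridpos (z j)).
Local Notation dd := (mesh k).
Hypothesis goodz : forall i, good theta dd (q i).

Let S (i : 'I_n) : set (R * R) :=
  sector theta ((ref q i).1 - 2 / t * dd, (ref q i).2) (enorm (q i) + slack * dd).
Let Q (i : 'I_n) : set (R * R) := cell dd (ref q i.+1).
(** The visited cells are removed because they must contain points, and because independence of
    counts is available on disjoint sets only. *)
Let B0 : set (R * R) := (\big[setU/set0]_(i <- enum 'I_n) S i) `\` (\big[setU/set0]_(i <- enum 'I_n) Q i).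
(* Index 0 is the region required to be empty, the others are the visited cells. *)
Let B (j : 'I_n.+1) := if unlift ord0 j is Some i then Q i else B0.
Let c (j : 'I_n.+1) : nat := if unlift ord0 j is Some i then 1%N else 0%N.

Let dd0 : 0 < dd. Proof. exact: mesh_gt0. Qed.

Let mB0 : measurable B0.
Proof.
apply: measurableD; apply: bigsetU_measurable => i _; [exact: measurable_sector|exact: measurable_cell].
Qed.

Lemma bounded_bigsetU (I : eqType) (s : seq I) (F : I -> set (R * R)) :
  (forall i, bounded2 (F i)) -> bounded2 (\big[setU/set0]_(i <- s) F i).
Proof.
move=> bF; elim: s => [|i s [M MP]]; first by rewrite big_nil; exists 0.
rewrite big_cons; have [N NP] := bF i; exists (Num.max M N) => p [/NP|/MP] [h1 h2];
  by rewrite !le_max h1 h2 ?orbT.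
Qed.

Let mbB j : measurable (B j) /\ bounded2 (B j).
Proof.
rewrite /B; case: unlift => [i|]; first by split; [exact: measurable_cell|exact: bounded_cell].
split => //; apply: (@bounded2S _ _ (\big[setU/set0]_(i <- enum 'I_n) S i)); first by move=> p [].
by apply: bounded_bigsetU => i; exact: bounded_sector.
Qed.

Let disjB i j : i != j -> B i `&` B j = set0.
Proof.
have BQ a b : B0 b -> ~ Q a b.
  by move=> [_ h] Qb; apply: h; rewrite -bigcup_seq; exists a => //=; rewrite mem_enum.
(* A common point of two visited cells would put the zero vector into the open cone. *)
have QQ (a b : 'I_n) p : (a < b)%N -> Q a p -> ~ Q b p.
  move=> ab h1 h2; have ab' : (a.+1 < b.+1 <= n)%N by rewrite ltnS ab ltn_ord.
  have := cone_pos thetaP (ref_chain thetaP dd0 goodz ab' h1 h2).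
  by rewrite subrr /= ltxx => -[].
rewrite /B; case: unliftP => [a ->|->]; case: unliftP => [b ->|->] => ij; rewrite -subset0 => p [].
- have : a != b by apply: contraNneq ij => ->.
  rewrite neq_ltn => /orP[ab|ba] h1 h2; first exact: QQ ab h1 h2.
  exact: QQ ba h2 h1.
- by move=> h1 /BQ h2; exact: h2 h1.
- by move=> /BQ h1 h2; exact: h1 h2.
- by rewrite eqxx in ij.
Qed.

Lemma leb2_B0 : (leb2 B0 <= (\sum_(i < n) theta * (enorm (q i) + slack * dd) ^+ 2)%:E)%E.
Proof.
have SE i : leb2 (S i) = (theta * (enorm (q i) + slack * dd) ^+ 2)%:E.
  apply: leb2_sector => //; rewrite ltr_wpDl ?enorm_ge0// mulr_gt0// (lt_le_trans _ (slack_ge4 thetaP))//.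
have sub : (leb2 (\big[setU/set0]_(i <- enum 'I_n) S i) <= \sum_(i <- enum 'I_n) leb2 (S i))%E.
  elim: (enum 'I_n) => [|i s IH]; first by rewrite !big_nil /leb2 measure0.
  rewrite !big_cons; apply: (@le_trans _ _ (leb2 (S i) + leb2 (\big[setU/set0]_(i <- s) S i))%E).
    apply: (@measureU2 _ _ _ (mu \x mu)%E); first exact: measurable_sector.
    by apply: bigsetU_measurable => j _; exact: measurable_sector.
  exact: leeD2l.
apply: (@le_trans _ _ (leb2 (\big[setU/set0]_(i <- enum 'I_n) S i))).
  apply: (@le_measure _ _ _ (mu \x mu)%E); rewrite ?inE//.
    by apply: bigsetU_measurable => j _; exact: measurable_sector.
  by move=> p [].
rewrite (le_trans sub)// big_enum/= -sumEFin le_eqVlt; apply/orP; left; apply/eqP.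
by apply: eq_bigr => i _; rewrite SE.
Qed.

Lemma path_ev_counts : [set w | forall i, npoints (X w) (B i) = c i] `<=` path_ev z.
Proof.
move=> w cw i.
have Qw (j : 'I_n) : exists p, X w `&` Q j = [set p].
  have := cw (lift ord0 j); rewrite /B /c liftK => h.
  by apply/npoints1 => //; apply: (finite_PPP PPP); exact: bounded_cell.
have [a aP] := choice Qw.
have B0w : X w `&` B0 = set0.
  have := cw ord0; rewrite /B /c unlift_none => h.
  by apply/npoints0 => //; apply: (finite_PPP PPP); have [_] := mbB ord0; rewrite /B unlift_none.
have emptyP u (j : 'I_n) : X w u -> S j u -> exists j : 'I_n, cell dd (ref q j.+1) u.
  move=> Xu Su; apply: contrapT => nQ.
  have : (X w `&` B0) u; last by rewrite B0w.
  split => //; split; first by rewrite -bigcup_seq; exists j => //=; rewrite mem_enum.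
  by rewrite -bigcup_seq => -[l _ Ql]; apply: nQ; exists l.
by have [] := nav_confined thetaP dd0 goodz aP emptyP (ltn_ord i : (i <= n)%N).
Qed.

(* The sectors of different steps may overlap, but the area of their union is at
   most the sum of the areas, so the void probability only gets larger. *)
Lemma path_ev_good_prob : ((\prod_(i < n) stepw (z i))%:E <= P (path_ev z))%E.
Proof.
have [mE PE] := PPP.2 _ B c mbB disjB.
apply: (@le_trans _ _ (P [set w | forall i, npoints (X w) (B i) = c i])); last first.
  by apply: le_measure; rewrite ?inE//; [exact: measurable_path_ev|exact: path_ev_counts].
rewrite PE lee_fin big_ord_recl.
have -> : B ord0 = B0 by rewrite /B unlift_none.
have -> : c ord0 = 0%N by rewrite /c unlift_none.
have -> : \prod_(i < n) poissonp (lambda * fine (leb2 (B (lift ord0 i)))) (c (lift ord0 i)) =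
  \prod_(i < n) (expR (- (lambda * dd ^+ 2)) * (lambda * dd ^+ 2)).
  apply: eq_bigr => i _; rewrite /B /c liftK /Q leb2_cell//= /poissonp.
  by rewrite expr1 (_ : 1`! = 1)%N ?divr1.
have B0fin : leb2 B0 \is a fin_num.
  rewrite ge0_fin_numE; last exact: (@measure_ge0 _ _ _ (mu \x mu)%E).
  by rewrite (le_lt_trans leb2_B0)// ltry.
have fineB0 : fine (leb2 B0) <= \sum_(i < n) theta * (enorm (q i) + slack * dd) ^+ 2.
  by rewrite -lee_fin fineK// leb2_B0.
rewrite /poissonp expr0 fact0 mulr1 divr1.
apply: (@le_trans _ _ (expR (- (lambda * \sum_(i < n) theta * (enorm (q i) + slack * dd) ^+ 2)) *
   \prod_(i < n) (expR (- (lambda * dd ^+ 2)) * (lambda * dd ^+ 2)))); last first.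
  rewrite ler_wpM2r//.
    by apply: prodr_ge0 => i _; rewrite mulr_ge0 ?expR_ge0// mulr_ge0 ?sqr_ge0// ltW.
  by rewrite ler_expR lerN2 ler_pM2l.
rewrite mulr_sumr -sumrN expR_sum -big_split/= le_eqVlt; apply/orP; left; apply/eqP.
apply: eq_bigr => i _; rewrite /stepw goodz /stepdens.
rewrite [X in expR (X - _)]mulNr expRD !mulrA; ring.
Qed.
End counts.

Lemma path_ev_prob k n (z : {ffun 'I_n -> gridT k}) :
  ((\prod_(i < n) stepw (z i))%:E <= P (path_ev z))%E.
Proof.
have [h|] := boolP [forall i, good theta (mesh k) (gridpos (z i))].
  by apply: path_ev_good_prob => i; move/forallP: h.
rewrite negb_forall => /existsP[i ni].
by rewrite (bigD1 i)//= stepw_bad// mul0r.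
Qed.

End path_probability.

(** * Upper bound *)

Section chernoff.
Context {R : realType}.
Context d (Omega : measurableType d) (P : probability Omega R).
Variables (lambda theta : R) (X : Omega -> set (R * R)).
Hypotheses (lambda0 : 0 < lambda) (thetaP : 0 < theta <= pi / 4).
Hypothesis PPP : is_PPP P lambda X.
Local Notation V := (fun n w => nav theta (palm X w) n).
Local Notation mesh := (@mesh R).
Local Notation gridpos := (@gridpos R _).
Local Notation stepw := (stepw lambda theta).
Local Notation dmgf := (dmgf lambda theta).
Local Notation mgf := (mgf lambda theta).
Local Notation path_ev := (path_ev theta X).

Lemma path_refE k n (z : {ffun 'I_n -> gridT k}) : path_ref z n = \sum_(i < n) gridpos (z i).
Proof. by rewrite /path_ref /ref; apply: eq_bigl => i; rewrite ltn_ord. Qed.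

Lemma dot_sum g n (q : 'I_n -> R * R) : dot g (\sum_(i < n) q i) = \sum_(i < n) dot g (q i).
Proof.
by apply: (big_morph (dot g)); [exact: dotD|rewrite /dot/= !mulr0 addr0].
Qed.

Definition pathw k n (z : {ffun 'I_n -> gridT k}) : R := \prod_(i < n) stepw (z i).

Lemma pathw_ge0 k n (z : {ffun 'I_n -> gridT k}) : 0 <= pathw z.
Proof. by apply: prodr_ge0 => i _; exact: stepw_ge0. Qed.

(** Expanding the product over paths: under [pathw] the steps are independent. *)
Lemma sum_pathw k n g :
  \sum_(z : {ffun 'I_n -> gridT k}) pathw z * expR (dot g (path_ref z n)) = dmgf k g ^+ n.
Proof.
transitivity (\prod_(i < n) \sum_(z : gridT k) stepw z * expR (dot g (gridpos z))); last first.
  by rewrite prodr_const card_ord.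
rewrite bigA_distr_bigA/=.
by apply: eq_bigr => z _; rewrite path_refE dot_sum expR_sum -big_split.
Qed.

Lemma prob_paths k n (A : pred {ffun 'I_n -> gridT k}) (E : set Omega) : measurable E ->
  (forall z, A z -> path_ev z `<=` E) ->
  ((\sum_(z | A z) pathw z)%:E <= P E)%E.
Proof.
move=> mE AE.
apply: (@le_trans _ _ (P (\big[setU/set0]_(z <- enum A) path_ev z))); last first.
  apply: le_measure; rewrite ?inE//.
    by apply: bigsetU_measurable => z _; exact: (measurable_path_ev thetaP PPP).
  by rewrite -bigcup_seq => w [z /=]; rewrite mem_enum => /AE; apply.
have : uniq (enum A) by exact: enum_uniq.
rewrite -[X in (X%:E <= _)%E]big_enum/=; elim: (enum A) => [|z s IH]; first by rewrite !big_nil.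
rewrite !big_cons => /= /andP[zs us]; rewrite measureU.
- by rewrite EFinD; apply: leeD; [exact: (path_ev_prob lambda0 thetaP PPP)|exact: IH].
- exact: (measurable_path_ev thetaP PPP).
- by apply: bigsetU_measurable => y _; exact: (measurable_path_ev thetaP PPP).
rewrite -bigcup_seq -subset0 => w [wz [y /= ys wy]].
have zy : z != y by apply: contraNneq zs => ->.
by have := path_ev_disj theta X zy; rewrite -subset0 => /(_ w); apply.
Qed.

Lemma fine_prob_le (E : set Omega) (r : R) : measurable E -> (P E <= r%:E)%E = (fine (P E) <= r).
Proof. by move=> mE; rewrite -{1}(fineK (fin_num_measure P _ mE)) lee_fin. Qed.

Lemma measurable_dot_nav g n c : measurable [set w | c <= dot g (V n w)].
Proof.
have m := measurable_nav thetaP PPP n; rewrite /dot.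
by apply: measurable_set_le; mfun; exact: m.
Qed.

Lemma path_ev_dot k n (z : {ffun 'I_n -> gridT k}) g w : path_ev z w ->
  `|dot g (V n w) - dot g (path_ref z n)| <= gnorm g * mesh k.
Proof.
move=> /(_ ord_max) /= /cell_offset[e [-> /andP[e1 e1d] /andP[e2 e2d]]].
by rewrite dotD addrAC subrr add0r dot_le// ger0_norm// ltW.
Qed.

(** The event is bounded through its complement, which contains all path events in [A]. The usual
    exponential Markov inequality is applied to the remaining weights; the mass missing from the
    grid paths enters as [1 - dmgf k (0, 0) ^+ n]. *)
Lemma chernoff_grid k g n c :
  fine (P [set w | c <= dot g (V n w)]) <=
  1 - dmgf k (0, 0) ^+ n + expR (- c + gnorm g * mesh k) * dmgf k g ^+ n.
Proof.
set E := [set w | _]; have mE : measurable E by exact: measurable_dot_nav.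
(* The margin covers the offset of [V n] from the corner of its cell. *)
pose A (z : {ffun 'I_n -> gridT k}) := dot g (path_ref z n) + gnorm g * mesh k < c.
have PA : ((\sum_(z | A z) pathw z)%:E <= P (~` E))%E.
  apply: prob_paths; first exact: measurableC.
  move=> z Az w /(@path_ev_dot _ _ _ g); rewrite ler_norml => /andP[_ h] cw.
  have {}cw : c <= dot g (nav theta (palm X w) n) by [].
  by move: Az h cw; rewrite /A; clear; lra.
have : \sum_(z | A z) pathw z <= 1 - fine (P E).
  by rewrite -lee_fin EFinB (fineK (fin_num_measure P _ mE)) -probability_setC.
have -> : \sum_(z | A z) pathw z = dmgf k (0, 0) ^+ n - \sum_(z | ~~ A z) pathw z.
  have -> : dmgf k (0, 0) ^+ n = \sum_(z : {ffun 'I_n -> gridT k}) pathw z.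
    rewrite -sum_pathw.
    by apply: eq_bigr => z _; rewrite /dot !mul0r addr0 expR0 mulr1.
  by rewrite [X in _ = X - _](bigID A)/= addrK.
have : \sum_(z | ~~ A z) pathw z <= expR (- c + gnorm g * mesh k) * dmgf k g ^+ n.
  rewrite -sum_pathw mulr_sumr big_mkcond/=; apply: ler_sum => z _.
  case: ifPn => [|_]; last by rewrite !mulr_ge0 ?expR_ge0 ?pathw_ge0.
  rewrite /A -leNgt => h; rewrite mulrCA ler_peMr ?pathw_ge0// -expRD -expR0 ler_expR.
  lra.
lra.
Qed.

Lemma chernoff g n c :
  fine (P [set w | c <= dot g (V n w)]) <= expR (- c) * mgf g ^+ n.
Proof.
have c0 := cvg_dmgf lambda0 thetaP.
have h : 1 - dmgf k (0, 0) ^+ n + expR (- c + gnorm g * mesh k) * dmgf k g ^+ n @[k --> \oo] -->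
    1 - mgf (0, 0) ^+ n + expR (- c + gnorm g * 0) * mgf g ^+ n.
  have cX g' : dmgf k g' ^+ n @[k --> \oo] --> mgf g' ^+ n.
    exact: (cvg_comp _ _ (c0 g') (@exprn_continuous R n (mgf g'))).
  apply: cvgD.
    by apply: cvgB; [exact: cvg_cst|exact: cX].
  apply: cvgM; last by exact: cX.
  apply: continuous_cvg; first exact: continuous_expR.
  by apply: cvgD; [exact: cvg_cst|apply: cvgM; [exact: cvg_cst|exact: cvg_mesh]].
have -> : expR (- c) * mgf g ^+ n = 1 - mgf (0, 0) ^+ n + expR (- c + gnorm g * 0) * mgf g ^+ n.
  by rewrite (mgf0 lambda0 thetaP) expr1n subrr add0r mulr0 addr0.
apply: (@cvg_le_seq _ (fun=> fine (P [set w | c <= dot g (V n w)])) _ _ _ (cvg_cst _) h) => k.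
exact: chernoff_grid.
Qed.
End chernoff.

Section upper.
Context {R : realType}.
(* [compact_cover] needs a [ptopologicalType], which is not inferred on products. *)
HB.instance Definition _ (T U : ptopologicalType) := Topological.on (T * U)%type.
Context d (Omega : measurableType d) (P : probability Omega R).
Variables (lambda theta : R) (X : Omega -> set (R * R)).
Hypotheses (lambda0 : 0 < lambda) (thetaP : 0 < theta <= pi / 4).
Hypothesis PPP : is_PPP P lambda X.
Local Notation V := (fun n w => nav theta (palm X w) n).
Local Notation mgf := (mgf lambda theta).

Lemma union_bound (I : eqType) (s : seq I) (E : I -> set Omega) (A : set Omega) :
  measurable A -> (forall i, measurable (E i)) ->
  (forall w, A w -> exists2 i, i \in s & E i w) ->
  fine (P A) <= \sum_(i <- s) fine (P (E i)).
Proof.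
move=> mA mE; elim: s A mA => [|i s IH] A mA AE.
  by rewrite (_ : A = set0) ?measure0 ?big_nil// -subset0 => w /AE[].
rewrite big_cons; apply: (@le_trans _ _ (fine (P (E i)) + fine (P (A `\` E i)))).
  rewrite -fine_prob_le// EFinD (fineK (fin_num_measure P _ (mE i))).
  have mD := measurableD mA (mE i).
  rewrite (fineK (fin_num_measure P _ mD)).
  apply: le_trans (measureU2 _ (mE i) mD).
  apply: le_measure; rewrite ?inE//; first exact: measurableU.
  by move=> w Aw; have [|] := pselect (E i w); [left|right].
rewrite lerD2l; apply: IH; first exact: measurableD.
by move=> w [/AE[j]]; rewrite inE => /predU1P[-> //|js Ej _]; exists j.
Qed.

(* [b = 0] has to be covered as well, to deal with the first few steps. *)
Lemma rate_cover F (alpha b1 : R) : closed F ->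
  (forall x, F x -> (alpha%:E < rate lambda theta x)%E) ->
  exists s : seq (R * R), forall b x, 0 <= b <= b1 -> F x -> `|x| <= 1 ->
    exists2 g, g \in s & alpha < dot g (1, x) - b * ln (mgf g).
Proof.
move=> cF aF.
pose O (g : R * R) : set (R * R) := [set p | alpha < dot g (1, p.2) - p.1 * ln (mgf g)].
pose K : set (R * R) := `[0%R, b1]%classic `*` (`[(- 1)%R, 1%R]%classic `&` F).
have cK : compact K.
  by apply: compact_setX; [|apply: compact_closedI => //]; exact: segment_compact.
have oO g : open (O g).
  apply: (@open_comp _ _ (fun p : R * R => dot g (1, p.2) - p.1 * ln (mgf g)) [set y | alpha < y]).
    move=> p _; rewrite /dot/=; apply: cvgB.
      by apply: cvgD; [exact: cvg_cst|apply: cvgM; [exact: cvg_cst|exact: cvg_snd]].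
    by apply: cvgM; [exact: cvg_fst|exact: cvg_cst].
  exact: open_gt.
have KO : K `<=` cover setT O.
  move=> [b x] [/=]; rewrite in_itv/= => /andP[b0 _] [_ Fx].
  move: b0; rewrite le_eqVlt => /predU1P[<-|b0].
    (* At [b = 0] the logarithm drops out, and any [g] with [dot g (1, x) > alpha] will do. *)
    by exists (alpha + 1, 0) => //; rewrite /O/dot/= mul0r mul0r subr0 addr0 mulr1 ltrDl.
  have : (alpha%:E < b%:E * Legendre lambda theta (b^-1, x / b)%R)%E.
    by apply: lt_le_trans (aF _ Fx) _; apply: ereal_inf_lbound; exists b.
  rewrite -lte_pdivrMl// LegendreE// => /ereal_sup_gt[_ [g _ <-]].
  rewrite -EFinM lte_fin => h; exists g => //.
  move: h; rewrite ltr_pdivrMl// /O/dot/=.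
  rewrite mulrBr mulrDr [b * (g.1 * _)]mulrCA mulfV ?gt_eqF// [b * (g.2 * _)]mulrCA.
  by rewrite [b * (x / b)]mulrC divfK ?gt_eqF.
have {}cK : cover_compact K by rewrite -(@compact_cover (R * R)%type).
have [D _ KD] := cK _ setT O (fun g _ => oO g) KO.
exists (enum_fset D) => b x bb Fx x1.
have : K (b, x) by split => /=; rewrite ?in_itv//=; split => //=; rewrite -ler_norml.
by move=> /KD[g gD Og]; exists g.
Qed.

Lemma measurable_speed (A : set R) (t : R) : measurable A ->
  measurable [set w | A (Ypath theta (palm X w) t / t)].
Proof.
move=> mA; apply: (measurable_Ypath thetaP PPP (A := [set y | A (y / t)])).
have mt : measurable_fun setT (fun y : R => y / t) by mfun.
by rewrite -[X in measurable X]setTI; exact: mt.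
Qed.

(** A union bound over the step [k] at which [t] is crossed and over the finitely many half-planes
    of [rate_cover]: each event costs [expR (- (alpha * t))], and their number is affine in [t].
    Taking more than [b1 * t] steps without passing [t] is a separate event of the same cost. *)
Lemma upper_exp F (alpha : R) : closed F ->
  (forall x, F x -> (alpha%:E < rate lambda theta x)%E) ->
  exists C a : R, forall t, 0 < t ->
    fine (P [set w | F (Ypath theta (palm X w) t / t)]) <= expR (- (alpha * t)) * (C + a * t).
Proof.
move=> cF aF.
have [N MN] : exists N : nat, mgf (- N%:R, 0) < 1.
  have h p : cone (tan theta) p -> dot (-1, 0) p < 0.
    by move=> /(cone_pos thetaP)[p0 _]; rewrite /dot/= mul0r addr0 mulN1r oppr_lt0.
  have /cvgr_lt/(_ 1 ltr01)[N _ /(_ N (leqnn N))] := cvg_mgf_ray lambda0 thetaP h.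
  by rewrite /= mulrN1 mulr0; exists N.
set M := mgf _ in MN; have M0 : 0 < M by exact: mgf_gt0.
have L0 : ln M < 0 by rewrite -ln1 ltr_ln ?posrE.
(* Chernoff's bound with [(- N, 0)] gives [expR (N * t) * M ^+ m] for not having passed [t] after
   [m] steps; this is at most [expR (- (alpha * t))] once [m] exceeds [b1 * t]. *)
pose b1 := Num.max 0 ((N%:R + alpha) / - ln M).
have [s sP] := rate_cover b1 cF aF.
(* The boolean selects the endpoint [V k] or [V k.+1]; the latter costs a further factor [mgf g],
   and [1 + mgf g] covers both. *)
pose s' := [seq (g, b) | g <- s, b <- [:: false; true]].
pose S := \sum_(gb <- s') (1 + mgf gb.1).
have S0 : 0 <= S by apply: sumr_ge0 => gb _; rewrite addr_ge0// ltW// mgf_gt0.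
exists (1 + S), (b1 * S) => t t0.
have b10 : 0 <= b1 by rewrite /b1 le_max lexx.
have [m [mlt mle km1]] : exists m : nat, [/\ b1 * t < m%:R, m%:R <= b1 * t + 1 &
    forall k, (k < m)%N -> k%:R <= b1 * t].
  have /andP[h1 h2] := truncn_itv (mulr_ge0 b10 (ltW t0)).
  exists (Num.truncn (b1 * t)).+1; split => //; first by rewrite -addn1 natrD lerD2r.
  by move=> k; rewrite ltnS => h; apply: le_trans h1; rewrite ler_nat.
pose E (i : option (nat * (R * R * bool))) : set Omega :=
  if i is Some (k, (g, b)) then
    [set w | alpha * t + k%:R * ln (mgf g) <= dot g (V (k + b)%N w)]
  else [set w | - (N%:R * t) <= dot (- N%:R, 0) (V m w)].
pose l := None :: [seq Some (k, gb) | k <- iota 0 m, gb <- s'].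
have mE i : measurable (E i).
  by case: i => [[k [g b]]|]; exact: (measurable_dot_nav thetaP PPP).
have mA : measurable [set w | F (Ypath theta (palm X w) t / t)].
  by apply: measurable_speed; exact: closed_measurable.
have AE w : F (Ypath theta (palm X w) t / t) -> exists2 i, i \in l & E i w.
  move=> Fw; have [h|h] := leP (V m w).1 t.
    exists None; first by rewrite inE eqxx.
    by rewrite /E/dot/= mul0r addr0 mulNr lerN2 ler_wpM2l.
  have [k km kt] := nav_crossing (ltW t0) h.
  rewrite (Ypath_ypoint thetaP kt) in Fw.
  have y1 := ypoint_lip0 thetaP kt.
  have kb : 0 <= k%:R / t <= b1.
    rewrite divr_ge0 ?(ltW t0)//= ler_pdivrMr// (km1 _ km)//.
  have xt : `|ypoint theta (palm X w) k t / t| <= 1.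
    by rewrite normrM normfV (gtr0_norm t0) ler_pdivrMr// mul1r.
  have [g gs h1] := sP _ _ kb Fw xt.
  have inl b : Some (k, (g, b)) \in l.
    rewrite in_cons; apply/orP; right; apply/allpairsPdep; exists k, (g, b); split => //.
      by rewrite mem_iota.
    by apply/allpairsPdep; exists g, b; split => //=; case: b.
  have [h2|h2] := leP (alpha * t + k%:R * ln (mgf g)) (dot g (V k w)).
    by exists (Some (k, (g, false))) => //=; rewrite addn0.
  have [h3|h3] := leP (alpha * t + k%:R * ln (mgf g)) (dot g (V k.+1 w)).
    by exists (Some (k, (g, true))) => //=; rewrite addn1.
  have := dot_ypoint_lt thetaP kt h2 h3.
  move: h1; rewrite -(ltr_pM2r t0) mulrBl mulrAC divfK ?gt_eqF// /dot/= mulr1 mulrDl.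
  rewrite -mulrA divfK ?gt_eqF// => h1 h4; exfalso; move: h1 h4; clear; lra.
apply: le_trans (union_bound mA mE AE) _.
have e0 : 0 < expR (- (alpha * t)) by exact: expR_gt0.
rewrite /l big_cons.
apply: (@le_trans _ _ (expR (- (alpha * t)) * 1 + expR (- (alpha * t)) * (m%:R * S))); last first.
  rewrite -mulrDr ler_pM2l//.
  have : m%:R * S <= (b1 * t + 1) * S by rewrite ler_wpM2r.
  clear; lra.
apply: lerD.
  rewrite mulr1.
  apply: le_trans (chernoff lambda0 thetaP PPP _ _ _) _.
  rewrite -/M -[M in M ^+ _]lnK ?posrE// -expRM_natl -expRD ler_expR opprK.
  have h : (N%:R + alpha) <= b1 * - ln M by rewrite -ler_pdivrMr ?oppr_gt0// /b1 le_max lexx orbT.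
  have h' : m%:R * ln M <= b1 * t * ln M by rewrite ler_wnM2r// ltW.
  have : (N%:R + alpha) * t <= b1 * - ln M * t by rewrite ler_pM2r.
  move: h'; clear; lra.
rewrite big_allpairs_dep/=.
apply: (@le_trans _ _ (\sum_(k <- iota 0 m) expR (- (alpha * t)) * S)); last first.
  by rewrite [leRHS]mulrCA mulr_natl big_const_seq count_predT size_iota iter_addr_0.
apply: ler_sum => k _; rewrite mulr_sumr; apply: ler_sum => -[g b] _ /=.
apply: le_trans (chernoff lambda0 thetaP PPP _ _ _) _.
have Mg := mgf_gt0 lambda0 thetaP g.
rewrite opprD expRD -mulrA ler_pM2l// mulrC -mulrN mulrC expRM_natl expRN lnK ?posrE//.
have Mk : (mgf g)^-1 ^+ k * mgf g ^+ k = 1 by rewrite -exprMn mulVf ?gt_eqF// expr1n.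
case: b; rewrite ?addn0 ?addn1 ?exprS.
  by rewrite mulrCA Mk mulr1 lerDr.
by rewrite Mk lerDl ltW.
Qed.
End upper.

Section ldp_limits.
Context {R : realType}.
Local Open Scope ereal_scope.

Lemma lte_real_dense (x y : \bar R) : x < y -> exists2 a : R, x < a%:E & a%:E < y.
Proof.
case: x y => [x||] [y||]//.
- rewrite !lte_fin => xy; exists ((x + y) / 2)%R; rewrite lte_fin; lra.
- by move=> _; exists (x + 1)%R; rewrite ?ltry// lte_fin ltrDl.
- by move=> _; exists (y - 1)%R; rewrite ?ltNyr// lte_fin gtrBl.
- by move=> _; exists 0%R; rewrite ?ltNyr ?ltry.
Qed.

Lemma lee_real_approx (x y : \bar R) : (forall a : R, a%:E < x -> a%:E <= y) -> x <= y.
Proof.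
move=> h; rewrite leNgt; apply/negP => /lte_real_dense[a ya /h].
by rewrite leNgt ya.
Qed.

Lemma limf_esup_le (f : R -> \bar R) (T : R) x :
  (forall t, (T < t)%R -> f t <= x) -> limf_esup f (pinfty_nbhs R) <= x.
Proof.
move=> fx; rewrite /limf_esup.
apply: (@le_trans _ _ (ereal_sup (f @` [set t | (T < t)%R]))).
  apply: ereal_inf_lbound; exists [set t | (T < t)%R] => //.
  by exists T; split => //; exact: num_real.
by apply: ge_ereal_sup => _ [t tT <-]; exact: fx.
Qed.

Lemma limf_einf_ge (f : R -> \bar R) (T : R) x :
  (forall t, (T < t)%R -> x <= f t) -> x <= limf_einf f (pinfty_nbhs R).
Proof.
move=> xf; rewrite /limf_einf leeNr; apply: (@limf_esup_le _ T) => t /xf.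
by rewrite leeN2.
Qed.
End ldp_limits.

Section log_probability.
Context {R : realType} d (Omega : measurableType d) (P : probability Omega R).

Lemma lne_prob_le (E : set Omega) (t a : R) : measurable E -> 0 < t ->
  fine (P E) <= expR (a * t) -> ((t^-1)%:E * lne (P E) <= a%:E)%E.
Proof.
move=> mE t0; rewrite -fine_prob_le// => h.
rewrite lee_pdivrMl// -EFinM mulrC.
have -> : (a * t)%:E = lne (expR (a * t))%:E by rewrite lne_EFin ?expR_gt0// expRK.
by rewrite lee_lne// in_itv/= ?measure_ge0 ?leey ?lee_fin ?expR_ge0.
Qed.

Lemma lne_prob_ge (E : set Omega) (t a : R) : measurable E -> 0 < t ->
  expR (a * t) <= fine (P E) -> (a%:E <= (t^-1)%:E * lne (P E))%E.
Proof.
move=> mE t0 h.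
rewrite lee_pdivlMl// -EFinM mulrC.
rewrite -(fineK (fin_num_measure P _ mE)).
have -> : (a * t)%:E = lne (expR (a * t))%:E by rewrite lne_EFin ?expR_gt0// expRK.
rewrite lee_lne ?lee_fin// in_itv/= ?leey ?lee_fin ?expR_ge0//.
by rewrite fine_ge0.
Qed.
End log_probability.

(** [expR (e * t)] is at least [(1 + e * t / 2) ^+ 2], whose quadratic term beats [D * t] beyond
    [4 * D / e ^+ 2]. *)
Lemma affine_le_exp {R : realType} (C a e : R) : 0 < e ->
  exists T : R, forall t, T < t -> 0 < t /\ C + a * t <= expR (e * t).
Proof.
move=> e0; pose D : R := `|C| + `|a|; exists (Num.max 1 (4 * D / e ^+ 2)) => t.
rewrite gt_max => /andP[t1 tD]; split; first exact: lt_trans t1.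
have h : C + a * t <= D * t.
  have := ler_norm C; have := ler_norm a; have := normr_ge0 C.
  rewrite /D => h1 h2 h3.
  have : a * t <= `|a| * t by rewrite ler_wpM2r// ltW// (lt_trans _ t1).
  have : `|C| * 1 <= `|C| * t by rewrite ler_wpM2l// ltW.
  move: h3; clear; lra.
apply: le_trans h _.
move: tD; rewrite ltr_pdivrMr ?exprn_gt0// => tD.
have h2 : 0 <= 1 + e * t / 2 <= expR (e * t / 2).
  by rewrite expR_ge1Dx andbT addr_ge0// divr_ge0// mulr_ge0 ?ltW// (lt_trans _ t1).
have -> : expR (e * t) = expR (e * t / 2) ^+ 2 by rewrite -expRM_natl; congr expR; field.
case/andP: h2 => h2 h3.
apply: (@le_trans _ _ ((1 + e * t / 2) ^+ 2)); last by rewrite ler_pXn2r// nnegrE expR_ge0.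
have t0 : 0 < t by rewrite (lt_trans _ t1).
have : 4 * D * t <= t * e ^+ 2 * t by rewrite ler_wpM2r ?ltW.
have : 0 < e * t by rewrite mulr_gt0.
rewrite !expr2; nra.
Qed.

Section upper_ldp.
Context {R : realType} d (Omega : measurableType d) (P : probability Omega R).
Variables (lambda theta : R) (X : Omega -> set (R * R)).
Hypotheses (lambda0 : 0 < lambda) (thetaP : 0 < theta <= pi / 4).
Hypothesis PPP : is_PPP P lambda X.

(** For [a < b] below the infimum of the rate, [upper_exp] gives decay at rate [b], and the gap
    [b - a] absorbs the affine factor. *)
Lemma ldp_upper (F : set R) : closed F ->
  (limf_esup (fun t : R => (t^-1)%:E * lne (P [set w | F (Ypath theta (palm X w) t / t)%R]))
     (pinfty_nbhs R) <= - ereal_inf (rate lambda theta @` F))%E.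
Proof.
move=> cF; rewrite leeNr; apply: lee_real_approx => a /lte_real_dense[b].
rewrite lte_fin => ab bI.
have bF x : F x -> (b%:E < rate lambda theta x)%E.
  by move=> Fx; apply: lt_le_trans bI _; apply: ereal_inf_lbound; exists x.
have [C [c h]] := upper_exp lambda0 thetaP PPP cF bF.
have [T hT] := @affine_le_exp _ C c (b - a) ltac:(by rewrite subr_gt0).
rewrite leeNr; apply: (@limf_esup_le _ _ T) => t /hT[t0 tT].
apply: lne_prob_le => //; first by apply: (measurable_speed thetaP PPP); exact: closed_measurable.
apply: le_trans (h _ t0) _.
apply: (@le_trans _ _ (expR (- (b * t)) * expR ((b - a) * t))).
  by rewrite ler_pM2l ?expR_gt0.
by rewrite -expRD ler_expR; lra.
Qed.
End upper_ldp.

(** * Lower bound *)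

Section lower_grid.
Context {R : realType} d (Omega : measurableType d) (P : probability Omega R).
Variables (lambda theta : R) (X : Omega -> set (R * R)).
Hypotheses (lambda0 : 0 < lambda) (thetaP : 0 < theta <= pi / 4).
Hypothesis PPP : is_PPP P lambda X.
Local Notation V := (fun n w => nav theta (palm X w) n).
Local Notation mesh := (@mesh R).
Local Notation pathw := (pathw lambda theta).
Local Notation dtilt := (dtilt lambda theta).
Local Notation path_ev := (path_ev theta X).

Lemma sum_pathw_tilt k n u g :
  \sum_(z : {ffun 'I_n -> gridT k}) pathw z * expR (dot g (path_ref z n) - n%:R * dot g u) =
  dtilt u g k ^+ n.
Proof.
rewrite dtiltE exprMn -sum_pathw mulr_suml; apply: eq_bigr => z _.
by rewrite -mulrA -expRM_natl -expRD mulrN.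
Qed.

Definition near_drift (n : nat) (u : R * R) (r : R) : set Omega :=
  [set w | `|(V n w).1 - n%:R * u.1| <= r /\ `|(V n w).2 - n%:R * u.2| <= r].

Lemma measurable_near_drift n u r : measurable (near_drift n u r).
Proof.
have m := measurable_nav thetaP PPP n.
by apply: measurable_andP; apply: measurable_set_le; mfun; exact: m.
Qed.

Definition axes : seq (R * R) := [:: (1, 0); (-1, 0); (0, 1); (0, -1)].

Lemma axesP (p : R * R) (r : R) :
  all (fun e => dot e p <= r) axes -> `|p.1| <= r /\ `|p.2| <= r.
Proof.
by rewrite /dot/= => /and5P[h1 h2 h3 h4 _]; rewrite !ler_norml; split; lra.
Qed.

(** The tilted mass is split by the endpoint. Near [n u] the tilt factor is at most
    [expR (gnorm g * r0)], and the weights are bounded by the probability. Any other path exceeds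
    [r0] in some axis direction [e], and tilting further by [s e] gains [expR (s * r0)]. *)
Lemma near_drift_ge k n u g s r0 r : 0 <= s -> r0 + mesh k <= r ->
  dtilt u g k ^+ n <= expR (gnorm g * r0) * fine (P (near_drift n u r)) +
    expR (- (s * r0)) * \sum_(e <- axes) dtilt u (along g e s) k ^+ n.
Proof.
move=> s0 r0r.
pose D e (z : {ffun 'I_n -> gridT k}) := dot e (path_ref z n) - n%:R * dot e u.
pose A z := all (fun e => D e z <= r0) axes.
pose off (z : {ffun 'I_n -> gridT k}) : R * R := path_ref z n - (n%:R * u.1, n%:R * u.2).
have offE e z : D e z = dot e (off z) by rewrite /D /off /dot/=; ring.
have AP z : A z -> `|(off z).1| <= r0 /\ `|(off z).2| <= r0.
  by move=> Az; apply: axesP; apply: sub_all Az => e; rewrite offE.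
have mE := measurable_near_drift n u r.
have PA : \sum_(z | A z) pathw z <= fine (P (near_drift n u r)).
  rewrite -lee_fin (fineK (fin_num_measure P _ mE)).
  apply: (prob_paths lambda0 thetaP PPP mE) => z /AP[h1 h2] w /(_ ord_max) /=.
  rewrite /near_drift/= => /cell_offset[e [-> /andP[e1 e1d] /andP[e2 e2d]]].
  move: h1 h2; rewrite /off/= !ler_norml => /andP[h1 h1'] /andP[h2 h2'].
  by split; apply/andP; split; lra.
apply: (@le_trans _ _ (expR (gnorm g * r0) * \sum_(z | A z) pathw z +
    expR (- (s * r0)) * \sum_(e <- axes) dtilt u (along g e s) k ^+ n)); last first.
  by rewrite lerD2r ler_wpM2l ?expR_ge0.
rewrite -sum_pathw_tilt [X in _ * X + _]big_mkcond/= mulr_sumr.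
under [X in _ + _ * X]eq_bigr do rewrite -sum_pathw_tilt.
rewrite [X in _ + _ * X]exchange_big/= [X in _ + X]mulr_sumr -big_split/=; apply: ler_sum => z _.
have w0 : 0 <= pathw z by exact: pathw_ge0.
rewrite -mulr_sumr mulrCA.
have S0 (s' : seq (R * R)) : 0 <= \sum_(e <- s') expR (dot (along g e s) (path_ref z n) - n%:R * dot (along g e s) u).
  by apply: sumr_ge0 => e _; exact: expR_ge0.
case: ifPn => [/AP[h1 h2]|].
  rewrite [X in _ <= X + _]mulrC -mulrDr ler_wpM2l//.
  apply: (@le_trans _ _ (expR (gnorm g * r0))).
    rewrite ler_expR -/(D g z) offE; apply: le_trans (ler_norm _) _; exact: dot_le.
  by rewrite lerDl mulr_ge0 ?expR_ge0.
rewrite mulr0 add0r => /allPn[e ex]; rewrite -ltNge => re.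
rewrite ler_wpM2l// (perm_big _ (perm_to_rem ex)) big_cons.
apply: (@le_trans _ _ (expR (- (s * r0)) * expR (dot (along g e s) (path_ref z n) - n%:R * dot (along g e s) u))).
  rewrite -expRD ler_expR [X in _ <= _ + X](_ : _ = D g z + s * D e z).
    by rewrite -/(D g z) addrCA lerDl addrC subr_ge0 ler_wpM2l// ltW.
  by rewrite /D !dot_along; ring.
by rewrite ler_wpM2l ?expR_ge0// lerDl.
Qed.
End lower_grid.

Section lower_drift.
Context {R : realType} d (Omega : measurableType d) (P : probability Omega R).
Variables (lambda theta : R) (X : Omega -> set (R * R)).
Hypotheses (lambda0 : 0 < lambda) (thetaP : 0 < theta <= pi / 4).
Hypothesis PPP : is_PPP P lambda X.
Local Notation dtilt := (dtilt lambda theta).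
Local Notation tilt := (tilt lambda theta).
Local Notation diff2 := (diff2 lambda theta).
Local Notation near_drift := (near_drift theta X).
Local Notation axes := (@axes R).

Lemma near_all_in (T : eqType) (U : Type) (F : set_system U) (s : seq T) (Q : T -> U -> Prop) :
  Filter F -> (forall e, e \in s -> \forall x \near F, Q e x) ->
  \forall x \near F, forall e, e \in s -> Q e x.
Proof.
move=> FF; elim: s => [|e s IH] h; first by apply: nearW.
have h1 := h e (mem_head _ _).
have {}IH : \forall x \near F, forall e, e \in s -> Q e x.
  by apply: IH => e' es; apply: h; rewrite inE es orbT.
apply: filterS2 h1 IH => x q1 q2 e'.
by rewrite inE => /predU1P[->|/q2].
Qed.

Lemma tilt_sublevel u (M : R) : `|u.2| < u.1 * tan theta ->
  exists G : R, forall g, tilt u g <= M -> gnorm g <= G.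
Proof.
move=> /(tilt_coercive lambda0 thetaP)[m [c [m0 c0 coer]]].
exists (M / m / c) => g gM; rewrite ler_pdivlMr// ler_pdivlMr// [leLHS]mulrC.
apply: le_trans gM; apply: le_trans (coer g).
by rewrite ler_pM2l// [leLHS]mulrC (le_trans _ (expR_ge1Dx _))// lerDr.
Qed.

(** A unit step along an axis stays in the square of half-side [G + 1], where [tilt_box] applies. *)
Lemma diff2_box u (G : R) : exists K : R, forall g e, gnorm g <= G -> e \in axes ->
  diff2 u g e 1 <= K.
Proof.
pose H := G + 1.
pose C := tilt u (H, H) + tilt u (H, - H) + tilt u (- H, H) + tilt u (- H, - H).
exists (C + C) => g e gG eax.
have e1 : `|e.1| <= 1 /\ `|e.2| <= 1.
  move: eax; rewrite !inE => /or4P[] /eqP-> /=; rewrite ?normrN ?normr1 ?normr0; lra.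
have g1 : `|g.1| <= G /\ `|g.2| <= G.
  have := normr_ge0 g.1; have := normr_ge0 g.2; move: gG; rewrite /gnorm; lra.
have al (s : R) : `|s| <= 1 -> tilt u (along g e s) <= C.
  move=> s1; apply: tilt_box => //=; apply: le_trans (ler_normD _ _) _; rewrite normrM.
    by apply: lerD; [case: g1|rewrite -[leRHS]mulr1; apply: ler_pM => //; case: e1].
  by apply: lerD; [case: g1|rewrite -[leRHS]mulr1; apply: ler_pM => //; case: e1].
have := al 1; have := al (- 1); rewrite normrN normr1 lexx => /(_ isT) h1 /(_ isT) h2.
have := tilt_ge0 lambda0 thetaP u g.
rewrite /diff2; move: h1 h2; clear; lra.
Qed.

Lemma small_dyadic (x : R) : 0 < x -> exists m : nat, 2 ^- m < x.
Proof.
move=> x0; have : 2^-1 ^+ m @[m --> \oo] --> (0 : R).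
  by apply: cvg_expr; rewrite ger0_norm; lra.
move=> /cvgr_lt/(_ _ x0)[N _ /(_ N (leqnn N))] /=.
by rewrite exprVn; exists N.
Qed.

(* The curvature bound on the sublevel box makes a nearly minimal tilt change by
   only O(s^2) in the directions s e, which the gain s r beats. *)
Lemma tilt_descent u (rho : R) : `|u.2| < u.1 * tan theta ->
  0 < rho -> (forall g, rho <= tilt u g) ->
  (forall k, 0 < k -> exists g, tilt u g < rho + k) ->
  exists G : R, 0 < G /\ forall r, 0 < r -> exists s g, [/\ 0 < s, gnorm g <= G &
    forall e, e \in axes -> expR (- (s * r)) * tilt u (along g e s) < tilt u g].
Proof.
move=> uc rho0 rhole rhoinf.
have [G0 G0P] := tilt_sublevel (rho + 1) uc.
pose G := Num.max 1 G0; have G_gt0 : 0 < G by rewrite lt_max ltr01.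
exists G; split => // r r0.
have [K KP] := diff2_box u G.
pose D := Num.max K 1; have D0 : 0 < D by rewrite lt_max ltr01 orbT.
have [m mP] : exists m : nat, 2 ^- m < r * rho / 2 / D.
  by apply: small_dyadic; rewrite !divr_gt0// mulr_gt0.
set s := 2 ^- m in mP; have s0 : 0 < s by rewrite invr_gt0 exprn_gt0.
(* Both the curvature error [s * (s * D)] and the defect from minimality are held below
   [s * (r * rho / 2)]; together they lose against [tilt u g * (expR (s * r) - 1)]. The minimum with
   1 keeps [g] in the sublevel set that defines [G]. *)
have [g gP] : exists g, tilt u g < rho + Num.min 1 (s * (r * rho / 2)).
  by apply: rhoinf; rewrite lt_min ltr01/= mulr_gt0// divr_gt0// mulr_gt0.
have gG : gnorm g <= G.
  rewrite le_max G0P ?orbT//; apply: ltW; apply: lt_le_trans gP _.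
  by rewrite lerD2l ge_min lexx.
exists s, g; split => // e eax.
have h1 : diff2 u g e s <= s * (s * D).
  have := diff2_pow lambda0 thetaP u g e m.
  rewrite -/s => h; have : 4 ^+ m * diff2 u g e s <= D.
    by apply: le_trans h _; rewrite le_max KP.
  have -> : s * (s * D) = D / 4 ^+ m.
    by rewrite mulrA -expr2 mulrC /s -exprVn exprAC -exprVn; congr (_ * _ ^+ _); rewrite expr2; field.
  by rewrite ler_pdivlMr ?exprn_gt0// mulrC.
have h2 : s * (s * D) < s * (r * rho / 2).
  by rewrite ltr_pM2l// -ltr_pdivlMr.
have h3 : tilt u g < rho + s * (r * rho / 2).
  by apply: lt_le_trans gP _; rewrite lerD2l ge_min lexx orbT.
have h4 := rhole (along g e (- s)).
have h5 : tilt u (along g e s) < tilt u g + s * r * rho.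
  move: h1; rewrite /diff2 => h1; move: h1 h2 h3 h4; clear; lra.
have h6 : tilt u g + s * r * rho <= tilt u g * (1 + s * r).
  by rewrite mulrDr mulr1 lerD2l mulrC ler_wpM2r// mulr_ge0// ltW.
rewrite expRN mulrC ltr_pdivrMr ?expR_gt0//.
apply: lt_le_trans h5 (le_trans h6 _).
by rewrite ler_wpM2l ?expR_ge1Dx// (le_trans _ (rhole g))// ltW.
Qed.

(** The strict inequalities of [tilt_descent] survive on a fine enough fixed grid. There the four
    tail terms of [near_drift_ge] are geometrically small against the tilted mass as [n] grows. *)
Lemma drift_lower u (rho eta eps : R) : `|u.2| < u.1 * tan theta ->
  0 < rho -> (forall g, rho <= tilt u g) ->
  (forall k, 0 < k -> exists g, tilt u g < rho + k) -> 0 < eta -> 0 < eps ->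
  exists N : nat, forall n, (N <= n)%N ->
    expR (n%:R * (ln rho - eta)) <= fine (P (near_drift n u (n%:R * eps))).
Proof.
move=> uc rho0 rhole rhoinf eta0 eps0.
have [G [G0 GP]] := tilt_descent uc rho0 rhole rhoinf.
(* [eps / 2] leaves room for the mesh, and [eta / 4 / G] limits the cost of the tilt over the
   distance [n * r]. For this choice [G] had to be independent of [r]. *)
pose r := Num.min (eps / 2) (eta / 4 / G).
have r0 : 0 < r by rewrite lt_min !divr_gt0.
have [s [g [s0 gG desc]]] := GP r r0.
have [k [k1 k2 k3]] : exists k, [/\ @mesh R k < eps / 2,
    rho * expR (- (eta / 4)) < dtilt u g k &
    forall e, e \in axes -> expR (- (s * r)) * dtilt u (along g e s) k < dtilt u g k].
  have h1 : \forall k \near \oo, @mesh R k < eps / 2.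
    by apply: (cvgr_lt _ (@cvg_mesh R)); rewrite divr_gt0.
  have h2 : \forall k \near \oo, rho * expR (- (eta / 4)) < dtilt u g k.
    apply: (cvgr_gt _ (cvg_dtilt lambda0 thetaP (u := u) (g := g))).
    apply: lt_le_trans (rhole g); rewrite -[ltRHS]mulr1 ltr_pM2l// -expR0 ltr_expR oppr_lt0.
    by rewrite divr_gt0.
  have h3 : \forall k \near \oo, forall e, e \in axes ->
      expR (- (s * r)) * dtilt u (along g e s) k < dtilt u g k.
    apply: near_all_in => e eax.
    have : dtilt u g k - expR (- (s * r)) * dtilt u (along g e s) k @[k --> \oo] -->
        tilt u g - expR (- (s * r)) * tilt u (along g e s).
      apply: cvgB; first exact: cvg_dtilt.
      by apply: (@cvgM _ _ _ _ (fun=> _)); [exact: cvg_cst|exact: cvg_dtilt].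
    move=> /cvgr_gt/(_ 0); rewrite subr_gt0 desc// => /(_ isT).
    by apply: filterS => k; rewrite subr_gt0.
  have := filterI h1 (filterI h2 h3).
  by move=> [N _ /(_ N (leqnn N))] /= [? [? ?]]; exists N.
set T := dtilt u g k in k2 k3; have T0 : 0 < T.
  by apply: lt_trans k2; rewrite mulr_gt0 ?expR_gt0.
pose q e := expR (- (s * r)) * dtilt u (along g e s) k / T.
have dt0 g' : 0 <= dtilt u g' k.
  by rewrite dtiltE mulr_ge0 ?expR_ge0//; apply: sumr_ge0 => z _; rewrite mulr_ge0 ?expR_ge0 ?stepw_ge0.
(* Four directions, each below an eighth of [T ^+ n], lose at most half of it. *)
have : \forall n \near \oo, forall e, e \in axes -> q e ^+ n < 8^-1.
  apply: near_all_in => e eax.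
  have : q e ^+ n @[n --> \oo] --> 0.
    apply: cvg_expr; rewrite ger0_norm ?divr_ge0 ?mulr_ge0 ?expR_ge0 ?(ltW T0)//.
    by rewrite ltr_pdivrMr// mul1r k3.
  by move=> /cvgr_lt; apply; rewrite invr_gt0.
move=> [N _ NP]; exists (maxn N (maxn 1 (Num.truncn (2 / eta)).+1)) => n.
rewrite !geq_max => /and3P[Nn n1 neta].
have n0 : 0 < n%:R :> R by rewrite ltr0n.
have e2 : 2 <= expR (n%:R * eta / 2).
  apply: le_trans (expR_ge1Dx _); rewrite -[2]/(1 + 1) lerD2l.
  have h : 2 / eta < n%:R.
    have /andP[_ h] := truncn_itv (ltW (divr_gt0 (ltr0n R 2) eta0)).
    by apply: lt_le_trans h _; rewrite ler_nat.
  by rewrite ler_pdivlMr// mul1r -ler_pdivrMr// ltW.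
have rm : n%:R * r + @mesh R k <= n%:R * eps.
  have h1 : n%:R * r <= n%:R * (eps / 2) by rewrite ler_pM2l// ge_min lexx.
  have h2 : eps / 2 <= n%:R * (eps / 2) by rewrite ler_peMl ?ler1n// ltW// divr_gt0.
  by apply: le_trans (lerD h1 (le_trans (ltW k1) h2)) _; rewrite -mulrDr -splitr.
have := near_drift_ge lambda0 thetaP PPP n u g (ltW s0) rm.
rewrite -/T; set p := fine _ => h.
have h1 : expR (- (s * (n%:R * r))) * \sum_(e <- axes) dtilt u (along g e s) k ^+ n <= T ^+ n / 2.
  have qE e : e \in axes -> expR (- (s * (n%:R * r))) * dtilt u (along g e s) k ^+ n <= T ^+ n / 8.
    move=> eax; have -> : - (s * (n%:R * r)) = n%:R * - (s * r) by ring.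
    rewrite expRM_natl -exprMn -[X in X ^+ n](@divfK _ T) ?gt_eqF// exprMn mulrC.
    by rewrite ler_pM2l ?exprn_gt0// ltW// NP.
  rewrite mulr_sumr big_seq.
  apply: (@le_trans _ _ (\sum_(e <- axes | e \in axes) T ^+ n / 8)); first exact: ler_sum.
  rewrite -big_seq !big_cons big_nil; lra.
have h2 : expR (gnorm g * (n%:R * r)) <= expR (n%:R * (eta / 4)).
  rewrite ler_expR mulrCA ler_pM2l//.
  apply: (@le_trans _ _ (G * (eta / 4 / G))); last by rewrite mulrC divfK ?gt_eqF.
  by apply: ler_pM; rewrite ?gnorm_ge0 ?(ltW r0)// ge_min lexx orbT.
have p0 : 0 <= p by rewrite fine_ge0.
have h3 : T ^+ n / 2 <= expR (n%:R * (eta / 4)) * p.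
  have : expR (gnorm g * (n%:R * r)) * p <= expR (n%:R * (eta / 4)) * p by rewrite ler_wpM2r.
  move: h h1; clear; lra.
have h4 : rho ^+ n * expR (- (n%:R * (eta / 4))) <= T ^+ n.
  by rewrite -mulrN expRM_natl -exprMn ler_pXn2r ?nnegrE ?mulr_ge0 ?expR_ge0 ?ltW.
(* The budget [eta] splits into a quarter for replacing [T] by [rho], a quarter for the tilt, and a
   half that absorbs the factor 2. *)
have -> : expR (n%:R * (ln rho - eta)) = rho ^+ n * expR (- (n%:R * (eta / 4))) *
    expR (- (n%:R * (eta / 4))) / expR (n%:R * eta / 2).
  by rewrite -[X in X ^+ n]lnK ?posrE// -expRM_natl -expRN -!expRD; congr expR; field.
have h5 : 2 * p <= expR (n%:R * eta / 2) * p by rewrite ler_wpM2r.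
rewrite ler_pdivrMr ?expR_gt0// [leRHS]mulrC; apply: le_trans h5.
apply: (le_trans (ler_wpM2r (expR_ge0 _) h4)).
rewrite expRN ler_pdivrMr ?expR_gt0//.
by rewrite -mulrA [p * _]mulrC [leRHS]mulrC -ler_pdivrMr.
Qed.
End lower_drift.

(** * From the drift estimate to open sets *)

Section lower_ldp.
Context {R : realType} d (Omega : measurableType d) (P : probability Omega R).
Variables (lambda theta : R) (X : Omega -> set (R * R)).
Hypotheses (lambda0 : 0 < lambda) (thetaP : 0 < theta <= pi / 4).
Hypothesis PPP : is_PPP P lambda X.
Local Notation V := (fun n w => nav theta (palm X w) n).
Local Notation mgf := (mgf lambda theta).
Local Notation tilt := (tilt lambda theta).

Lemma Legendre_ge u g : ((dot g u - ln (mgf g))%:E <= Legendre lambda theta u)%E.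
Proof. by rewrite LegendreE//; apply: ereal_sup_ubound; exists g. Qed.

(** The normal [(- tan theta, e)] is negative on the open cone but nonnegative at [u], so along its
    multiples [mgf] tends to 0 at no cost. As the boundary is included, a finite value puts [u] in
    the open cone, where [tilt_coercive] applies. *)
Lemma Legendre_off_cone (u : R * R) : u.1 * tan theta <= `|u.2| -> Legendre lambda theta u = +oo%E.
Proof.
move=> uc; pose e : R := if 0 <= u.2 then 1 else -1.
have e1 p : cone (tan theta) p -> dot (- tan theta, e) p < 0.
  rewrite /cone/= ltr_norml => /andP[h1 h2]; rewrite /dot/= /e; case: ifP => _; lra.
have eu (n : nat) : 0 <= dot (n%:R * - tan theta, n%:R * e) u.
  have -> : dot (n%:R * - tan theta, n%:R * e) u = n%:R * (e * u.2 - u.1 * tan theta).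
    by rewrite /dot/=; ring.
  rewrite mulr_ge0// subr_ge0 (le_trans uc)// /e; have [h|h] := leP 0 u.2.
    by rewrite mul1r ger0_norm.
  by rewrite mulN1r ltr0_norm.
apply/eqP; rewrite -leye_eq; apply: lee_real_approx => a _.
have /cvgr_lt/(_ _ (expR_gt0 (- a)))[N _ /(_ N (leqnn N))] := cvg_mgf_ray lambda0 thetaP e1.
set g := (_, _) => /= gN; apply: le_trans (Legendre_ge u g).
have : ln (mgf g) < - a by rewrite -[ltRHS]expRK ltr_ln ?posrE ?expR_gt0 ?mgf_gt0.
rewrite lee_fin; have := eu N; rewrite -/g; move: (dot g u) (ln _) => p q; lra.
Qed.

Lemma tilt_expR u g : tilt u g = expR (- (dot g u - ln (mgf g))).
Proof. by rewrite /tilt opprB expRD lnK ?posrE ?mgf_gt0// expRN. Qed.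

Lemma Legendre_tilt (u : R * R) (L : R) : Legendre lambda theta u = L%:E ->
  [/\ 0 <= L, forall g, expR (- L) <= tilt u g &
      forall k, 0 < k -> exists g, tilt u g < expR (- L) + k].
Proof.
move=> uL; have LL g : dot g u - ln (mgf g) <= L by rewrite -lee_fin -uL Legendre_ge.
split => [|g|k k0].
- by have := LL (0, 0); rewrite mgf0// ln1 subr0 /dot/= !mul0r addr0.
- by rewrite tilt_expR ler_expR lerN2.
have p0 : 0 < expR (- L) + k by rewrite addr_gt0 ?expR_gt0.
have : ((- ln (expR (- L) + k))%:E < Legendre lambda theta u)%E.
  by rewrite uL lte_fin ltrNl -[ltLHS]expRK ltr_ln ?posrE ?expR_gt0// ltrDl.
rewrite LegendreE// => /ereal_sup_gt[_ [g _ <-]]; rewrite lte_fin => h.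
exists g; rewrite tilt_expR -[ltRHS](@lnK _ (expR (- L) + k)) ?posrE// ltr_expR.
by rewrite ltrNl.
Qed.

Lemma Legendre_fin (u : R * R) : Legendre lambda theta u != +oo%E -> exists L, Legendre lambda theta u = L%:E.
Proof.
have := Legendre_ge u (0, 0); case: (Legendre lambda theta u) => [L||]//.
by exists L.
Qed.

(** The typical abscissa [nu = n / b] slightly exceeds [t], so [t] was crossed before step [n], and
    the Lipschitz bound compares [Y_t] with [V n]. *)
Lemma near_drift_Ypath n (b x delta t : R) w : 0 < b -> 0 < t -> 0 < delta <= 2^-1 -> `|x| <= 1 ->
  (1 + delta) * t < n%:R / b <= (1 + 2 * delta) * t ->
  near_drift theta X n (b^-1, x / b) (n%:R * (delta / (2 * b))) w ->
  `|Ypath theta (palm X w) t / t - x| < 8 * delta.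
Proof.
move=> b0 t0 /andP[delta0 delta2] x1; set nu := n%:R / b => /andP[nu1 nu2].
have -> : near_drift theta X n (b^-1, x / b) (n%:R * (delta / (2 * b))) w =
    (`|(V n w).1 - nu| <= nu * delta / 2 /\ `|(V n w).2 - nu * x| <= nu * delta / 2).
  rewrite /near_drift/=; have -> : n%:R * (delta / (2 * b)) = nu * delta / 2.
    by rewrite /nu; field; rewrite gt_eqF.
  by have -> : n%:R * (x / b) = nu * x by rewrite /nu; ring.
move=> [+ h2]; rewrite ler_norml => /andP[h1 h1'].
have dt : 0 < delta * t by rewrite mulr_gt0.
have ddt : delta * (delta * t) <= 2^-1 * (delta * t) by rewrite ler_pM2r.
have nud : nu * delta <= 2 * (delta * t).
  have : nu * delta <= (1 + 2 * delta) * t * delta by rewrite ler_pM2r.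
  move: ddt; lra.
have tV : t < (V n w).1.
  have : (1 + delta) * t * (1 - delta / 2) < nu * (1 - delta / 2) by rewrite ltr_pM2r; lra.
  move: h1 ddt dt; set v := (V n w).1; lra.
have [k kn kt] := nav_crossing (ltW t0) tV.
rewrite (Ypath_ypoint thetaP kt).
have h3 := ypoint_lip thetaP kt kn.
have h4 : `|nu * x - t * x| <= 2 * (delta * t).
  rewrite -mulrBl normrM ger0_norm; last by move: nu1 dt; lra.
  apply: (@le_trans _ _ ((nu - t) * 1)); last by move: nu2; lra.
  by rewrite ler_wpM2l//; move: nu1 dt; lra.
set y := ypoint _ _ _ _ in h3 *.
have -> : y / t - x = ((y - (V n w).2) + ((V n w).2 - nu * x) + (nu * x - t * x)) / t.
  by field; rewrite gt_eqF.
rewrite normrM normfV (gtr0_norm t0) ltr_pdivrMr//.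
apply: le_lt_trans (ler_normD _ _) _.
apply: le_lt_trans (lerD (ler_normD _ _) (lexx _)) _.
(* The three errors are at most 3, 1 and 2 times [delta * t]. *)
move: h1' h2 h3 h4 nud nu2 dt; set v := (V n w).1; set v2 := (V n w).2; lra.
Qed.

Lemma ldp_lower_point (G : set R) (x b a : R) : open G -> G x -> 0 < b ->
  (b%:E * Legendre lambda theta (b^-1, x / b)%R < a%:E)%E ->
  exists T : R, forall t, T < t -> 0 < t /\
    expR (- a * t) <= fine (P [set w | G (Ypath theta (palm X w) t / t)]).
Proof.
move=> oG Gx b0 ba.
have Lfin : Legendre lambda theta (b^-1, x / b) != +oo%E.
  by apply: contraTneq ba => ->; rewrite mulry gtr0_sg// mul1e.
have xb : `|x / b| = b^-1 * `|x| by rewrite normrM mulrC ger0_norm ?invr_ge0 ?ltW.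
have xt : `|x| < tan theta.
  rewrite ltNge; apply: contra_neqN Lfin => tx; apply: Legendre_off_cone => /=.
  by rewrite xb ler_pM2l ?invr_gt0.
have [L LE] := Legendre_fin Lfin; rewrite LE -EFinM lte_fin in ba.
have [L0 tle tinf] := Legendre_tilt LE.
have uc : `|((b^-1, x / b) : R * R).2| < ((b^-1, x / b) : R * R).1 * tan theta.
  by rewrite /= xb ltr_pM2l ?invr_gt0.
have x1 : `|x| <= 1 by rewrite ltW// (lt_le_trans xt)// slope_le1.
have /nbhs_ballP[r /= r0 rG] := open_nbhs_nbhs (conj oG Gx).
(* Chosen so that [sg] below is the midpoint of [b * L] and [a]. *)
pose eta := (a - b * L) / (2 * b).
have eta0 : 0 < eta by rewrite divr_gt0 ?subr_gt0// mulr_gt0.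
pose sg := b * (L + eta).
have sgE : sg = (a + b * L) / 2 by rewrite /sg /eta; field; rewrite gt_eqF.
have bL : 0 <= b * L by rewrite mulr_ge0// ltW.
have sg0 : 0 < sg by rewrite mulr_gt0// ltr_wpDl.
have sga : 0 < a - sg by rewrite sgE; move: ba bL; lra.
(* The three bounds serve [near_drift_Ypath], the ball of radius [r] around [x], and
   [(1 + 2 * delta) * sg <= a]. *)
pose delta := Num.min 2^-1 (Num.min (r / 8) ((a - sg) / (2 * sg))).
have delta0 : 0 < delta by rewrite !lt_min invr_gt0 ltr0n (divr_gt0 r0)//= divr_gt0// mulr_gt0.
have [delta2 deltar deltas] : [/\ delta <= 2^-1, delta <= r / 8 & delta <= (a - sg) / (2 * sg)].
  by rewrite /delta; split; rewrite !ge_min lexx ?orbT.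
have eps0 : 0 < delta / (2 * b) by rewrite divr_gt0// mulr_gt0.
have [N NP] := drift_lower lambda0 thetaP PPP uc (expR_gt0 _) tle tinf eta0 eps0.
(* The first bound gives [delta * (b * t) > 1], so an integer [n] fits between
   [(1 + delta) * (b * t)] and [(1 + 2 * delta) * (b * t)]; the second makes it at least [N]. *)
exists (Num.max (1 / (delta * b)) (N%:R / b)) => t.
rewrite gt_max => /andP[tdb tN].
have t0 : 0 < t by apply: lt_trans tdb; rewrite divr_gt0// mulr_gt0.
split => //.
have db : 0 <= (1 + delta) * (b * t) by rewrite !mulr_ge0 ?addr_ge0 ?(ltW delta0) ?(ltW b0) ?(ltW t0).
have /andP[n1 n2] := truncn_itv db.
set n := (Num.truncn _).+1 in n2.
have n3 : n%:R <= (1 + delta) * (b * t) + 1 by rewrite /n -addn1 natrD lerD2r.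
have tdb' : 1 < delta * (b * t) by rewrite mulrA mulrC -ltr_pdivrMr ?mulr_gt0.
have bt0 : 0 < b * t by rewrite mulr_gt0.
have Nn : (N <= n)%N.
  rewrite -(ler_nat R) ltW//; apply: lt_trans n2.
  have : N%:R < b * t by rewrite mulrC -ltr_pdivrMr.
  move: tdb'; lra.
have n4 : n%:R <= (1 + 2 * delta) * (b * t) by move: n3 tdb'; lra.
apply: (@le_trans _ _ (fine (P (near_drift theta X n (b^-1, x / b) (n%:R * (delta / (2 * b))))))).
  apply: le_trans (NP _ Nn); rewrite ler_expR expRK mulNr -opprD mulrN lerN2.
  apply: (@le_trans _ _ ((1 + 2 * delta) * (b * t) * (L + eta))).
    by rewrite ler_wpM2r// addr_ge0// ltW.
  have -> : (1 + 2 * delta) * (b * t) * (L + eta) = (1 + 2 * delta) * sg * t by rewrite /sg; ring.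
  rewrite ler_pM2r//; move: deltas; rewrite ler_pdivlMr ?mulr_gt0//; lra.
rewrite fine_le ?fin_num_measure//; try exact: measurable_near_drift thetaP PPP _ _ _.
- by apply: (measurable_speed thetaP PPP); exact: open_measurable.
apply: le_measure; rewrite ?inE.
- exact: (measurable_near_drift thetaP PPP).
- by apply: (measurable_speed thetaP PPP); exact: open_measurable.
move=> w wn; apply: rG; rewrite /ball/= distrC.
apply: (@lt_le_trans _ _ (8 * delta)); last by move: deltar; lra.
apply: (near_drift_Ypath b0 t0 _ x1 _ wn); first by rewrite delta0.
by rewrite ltr_pdivlMr// ler_pdivrMr// -!mulrA ![t * b]mulrC n2.
Qed.

Lemma ldp_lower (G : set R) : open G ->
  (- ereal_inf (rate lambda theta @` G) <=
   limf_einf (fun t : R => (t^-1)%:E * lne (P [set w | G (Ypath theta (palm X w) t / t)%R]))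
     (pinfty_nbhs R))%E.
Proof.
move=> oG; rewrite leeNl; apply/ereal_infP => _ [x Gx <-].
apply/ereal_infP => _ [b b0 <-].
rewrite leNgt; apply/negP => /lte_real_dense[a ba]; apply/negP; rewrite -leNgt leeNl.
have [T TP] := ldp_lower_point oG Gx b0 ba.
apply: (@limf_einf_ge _ _ T) => t /TP[t0 h].
by apply: lne_prob_ge => //; apply: (measurable_speed thetaP PPP); exact: open_measurable.
Qed.
End lower_ldp.

Unset Implicit Arguments.

Theorem theorem2p3 (R : realType) (lambda theta : R) :
  0 < lambda -> 0 < theta <= pi / 4 ->
  (forall (d : measure_display) (Omega : measurableType d)
          (P : probability Omega R) (X : Omega -> set (R * R)),
     is_PPP P lambda X ->
     LDP P (fun t w => Ypath theta (palm X w) t / t) (rate lambda theta)) /\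
  (forall x : R, rate lambda theta x = ((Num.sqrt lambda)%:E * rate 1 theta x)%E).
Proof.
move=> lambda0 thetaP; split=> [d Omega P X PPP|x]; last exact: rate_scale.
split=> A; [exact: (ldp_upper lambda0 thetaP PPP)|exact: (ldp_lower lambda0 thetaP PPP)].
Qed.
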